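(* Let $\mathcal{O} \subset \mathbb{T}^2 = \mathbb{S}^1 \times \mathbb{S}^1$ be a nonempty strictly convex open set with $C^\infty$ boundary in the flat square torus, and let $S = \mathbb{T}^2 \setminus \mathcal{O}$ be the corresponding Sinai billiard. Let $V$ be any open neighbourhood of the convex boundary $\partial \mathcal{O}$ in $S$. If $\Delta$ is the Dirichlet or Neumann Laplace operator on $S$, then there exists a constant $C = C(V) > 0$ such that for every $\lambda$ and every $u$ in the domain of $\Delta$, $$ -\Delta u = \lambda u \ \Longrightarrow \ \int_V |u(x)|^2\, dx \geq \frac{1}{C} \int_S |u(x)|^2\, dx . $$ The constant $C$ does not depend on $u$ or $\lambda$.
   Context: $\mathbb{T}^2 = \mathbb{S}^1 \times \mathbb{S}^1$ denotes the flat torus, where the two circles have the same length (a square torus). A Sinai billiard is the set $S = \mathbb{T}^2 \setminus \mathcal{O}$ obtained by removing from $\mathbb{T}^2$ a strictly convex open set $\mathcal{O}$ (the obstacle) with $C^\infty$ boundary. The Dirichlet (respectively Neumann) Laplace operator on $S$ is the flat Laplacian on $L^2(S)$ with Dirichlet (respectively Neumann) boundary condition on $\partial S = \partial \mathcal{O}$; solutions $u$ of $-\Delta u = \lambda u$ are understood to satisfy the corresponding boundary condition, i.e. to be eigenfunctions of this operator. A neighbourhood of $\partial\mathcal{O}$ in $S$ means a relatively open subset of $S$ containing $\partial \mathcal{O}$. *)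

(* Defs.v *)
From mathcomp Require Import all_boot all_order all_algebra.
From mathcomp Require Import all_classical all_reals all_analysis.
From mathcomp.real_closed Require Export complex.
Set Implicit Arguments.
Unset Strict Implicit.
Unset Printing Implicit Defensive.
Import Order.TTheory GRing.Theory Num.Theory.
Import numFieldNormedType.Exports.
Local Open Scope classical_set_scope.
Local Open Scope ring_scope.

(* The square torus T^2 = R^2 / (L Z)^2 is handled through its universal
   cover: a subset of T^2 is an (L Z)^2-periodic subset of R^2 (open, closed, ...
   in T^2 iff its lift is), a function on T^2 is a periodic function, and
   integrals over T^2 are integrals over the fundamental cell [0, L[^2. *)

Section torus.
Context {R : realType}.
Implicit Types (L : R) (A O S V : set (R * R)).

Definition lattice L (k : int * int) : R * R := (k.1%:~R * L, k.2%:~R * L).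

Definition periodic_set L A := forall k x, A (x + lattice L k) <-> A x.

Definition periodic_on L A {T : Type} (f : R * R -> T) :=
  forall k x, A x -> f (x + lattice L k) = f x.

Definition cell L : set (R * R) := `[0, L[%classic `*` `[0, L[%classic.

Definition leb2 := (@lebesgue_measure R \x @lebesgue_measure R)%E.

Definition tint L A (f : R * R -> R) : R :=
  \int[leb2]_(x in A `&` cell L) f x.

Definition boundary A : set (R * R) := closure A `\` A°.

Definition strictly_convex A :=
  forall x y, closure A x -> closure A y -> x != y ->
  forall t : R, 0 < t < 1 -> A° ((1 - t) *: x + t *: y).

Fixpoint class_C (n : nat) (f : R * R -> R) : Prop :=
  continuous f /\
  if n is m.+1 then
    forall v : R * R,
      (forall x, derivable f x v) /\ class_C m (fun x => 'D_v f x)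
  else True.

Definition smooth (f : R * R -> R) := forall n, class_C n f.

Definition smooth_boundary O :=
  forall p, boundary O p ->
  exists rho : R * R -> R,
    [/\ smooth rho,
        exists v : R * R, 'D_v rho p != 0 &
        \forall x \near p, O x <-> rho x < 0].

(* A strictly convex subset of T^2 is the one-to-one projection of a strictly
   convex subset A of the plane; O is the lift of this subset, i.e. the disjoint
   union of the translates of A.  Since A is convex and has finite area, it is
   bounded.  Smoothness is required of the boundary of O in T^2 (rather than
   of A in the plane), so that distinct translates cannot touch each other. *)
Definition convex_obstacle L O :=
  (exists A : set (R * R),
    [/\ open A, A !=set0, strictly_convex A,
        (forall k x, k != 0 -> A x -> ~ A (x + lattice L k)) &
        O = [set x | exists k, A (x + lattice L k)]]) /\
  smooth_boundary O.

Definition billiard O : set (R * R) := ~` O.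

Definition rel_neighbourhood L O V :=
  [/\ periodic_set L V,
      exists2 W, open W & V = W `&` billiard O &
      boundary O `<=` V].

(* Sobolev spaces on S = T^2 \ O and the Laplace operators; elements of L^2(S)
   are given by representatives, whose values on O are irrelevant. *)

Definition L2 L O (u : R * R -> R) :=
  [/\ periodic_on L (billiard O) u,
      measurable_fun (billiard O `&` cell L) u &
      leb2.-integrable (billiard O `&` cell L) (EFin \o (fun x => u x ^+ 2))].

(* C^oo functions with compact support in the interior of S. *)
Definition test_function L O (phi : R * R -> R) :=
  [/\ periodic_on L setT phi,
      smooth phi &
      closure [set x | phi x != 0] `<=` (billiard O)°].

Definition d1 (f : R * R -> R) (x : R * R) : R := 'D_((1, 0) : R * R) f x.
Definition d2 (f : R * R -> R) (x : R * R) : R := 'D_((0, 1) : R * R) f x.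

Definition weak_gradient L O (u g1 g2 : R * R -> R) :=
  forall phi, test_function L O phi ->
    tint L (billiard O) (fun x => u x * d1 phi x)
      = - tint L (billiard O) (fun x => g1 x * phi x) /\
    tint L (billiard O) (fun x => u x * d2 phi x)
      = - tint L (billiard O) (fun x => g2 x * phi x).

(* u is in H^1(S), with gradient (g1, g2). *)
Definition H1 L O (u g1 g2 : R * R -> R) :=
  [/\ L2 L O u, L2 L O g1, L2 L O g2 & weak_gradient L O u g1 g2].

(* H^1_0(S) is the closure of the test functions in H^1(S). *)
Definition H10 L O (u g1 g2 : R * R -> R) :=
  H1 L O u g1 g2 /\
  forall eps : R, 0 < eps ->
  exists2 phi, test_function L O phi &
    tint L (billiard O) (fun x =>
      (u x - phi x) ^+ 2 + (g1 x - d1 phi x) ^+ 2 + (g2 x - d2 phi x) ^+ 2)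
    < eps.

Inductive boundary_condition := Dirichlet | Neumann.

Definition form_domain (bc : boundary_condition) :=
  match bc with Dirichlet => H10 | Neumann => H1 end.

(* Graph of the self-adjoint operator associated with the Dirichlet form:
   u is in the domain of the Laplacian and its image is f.  For Neumann, the
   boundary condition is the natural one, from testing against all of H^1. *)
Definition laplacian_real bc L O (u f : R * R -> R) :=
  L2 L O f /\
  exists g1 g2, form_domain bc L O u g1 g2 /\
    forall v h1 h2, form_domain bc L O v h1 h2 ->
      tint L (billiard O) (fun x => g1 x * h1 x + g2 x * h2 x)
        = - tint L (billiard O) (fun x => f x * v x).

(* The operator on L^2(S; C) is the complexification of the real one. *)
Definition laplacian bc L O (u f : R * R -> R[i]) :=
  laplacian_real bc L O (fun x => complex.Re (u x))
                        (fun x => complex.Re (f x)) /\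
  laplacian_real bc L O (fun x => complex.Im (u x))
                        (fun x => complex.Im (f x)).

Definition mass L A (u : R * R -> R[i]) : R :=
  tint L A (fun x => ComplexField.Normc.normc (u x) ^+ 2).

End torus.

(* Main.v *)
(* Let U be the extension by 0 of an eigenfunction to the torus, with eigenvalue
   kap^2 Lam where kap = 2 pi / L, and let G be the union of V and the obstacle,
   a neighbourhood of the closed obstacle.  For a cutoff a that vanishes near
   the obstacle, the equation gives a linear relation between the Fourier
   coefficients of a U and of derivatives of a times U.  With derivatives of a
   supported in G, it shows that the part of U with frequencies outside an
   annulus | |xi|^2 - Lam | <= sqrt (dl Lam) is controlled by U on G.

   Let X be the part of U with frequencies in the annulus, and rho a
   trigonometric polynomial that is at least 1/2 near the obstacle and small
   outside G.  It only couples frequencies at bounded distance.  For large Lam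
   two such frequencies of the annulus differ by a short lattice vector tangent
   to the circle |xi|^2 = Lam, and the tangent direction is determined by either
   of them.  Hence the average of rho |X|^2 splits into a sum over isolated
   points and over parts of lines.  If the direction k of a line is longer than
   the degree of a fixed trigonometric bump function, this function does not
   couple distinct points of the line, so that the corresponding part of X has
   mass near the obstacle.  For the finitely many shorter k, the modulus of a
   part X_l with frequencies on a line of direction k is invariant along the
   closed geodesics orthogonal to k: it is controlled on all those that meet a
   neighbourhood of the obstacle, hence everywhere by a one-dimensional
   observability estimate, obtained from the cutoff relation for functions of
   k.x, with an exponential weight that moves the resonances off the real axis.

   For bounded Lam only finitely many frequencies are left, and trigonometric
   polynomials with given frequencies are controlled by their restriction to any
   ball: the difference of a polynomial and of its translate, suitably
   normalised, has one frequency less. *)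

From HB Require Import structures.
Require Import Defs.
From mathcomp Require Import all_boot all_order all_algebra.
From mathcomp Require Import all_classical all_reals all_analysis.
From mathcomp Require Import measurable_realfun.
From mathcomp Require Import ring lra zify.
Set Implicit Arguments.
Unset Strict Implicit.
Unset Printing Implicit Defensive.
Import Order.TTheory GRing.Theory Num.Theory.
Import numFieldNormedType.Exports.
Local Open Scope classical_set_scope.
Local Open Scope ring_scope.

(** * Smooth functions *)

(** The extension by 0 of an eigenfunction satisfies the equation only when it is tested away from
    the closed obstacle. Whatever a cutoff produces near the obstacle must therefore be bounded by
    the mass on G, which is the mass on V because U vanishes on the obstacle; both boundary
    conditions are then treated alike. The order of the constants shapes the argument. The weight
    rho is a trigonometric polynomial, so outside G it is only small, at most e, and the term e
    |U|^2 has to be absorbed by the left-hand side. The constant of the high frequency estimate must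
    hence be fixed before rho, whereas the width of the annulus and the threshold on Lam depend on
    the degree of rho and come after it. This is why the bump for long directions and the strips for
    short ones depend only on the region where rho is at least 1/2. On a line of frequencies of
    direction k the equation becomes one-dimensional, with a spectral parameter mu that varies with
    Lam and with the line. Its estimate must be uniform over all real mu: the exponential weight
    serves when mu is bounded below, and no weight is used for the other, very negative mu. *)

Section smoothness.
Context {R : realType}.
Implicit Types (f g : R * R -> R) (x v : R * R) (h : nat -> R -> R).

(** Both sides are limits of the same difference quotient; this transfers the one-variable chain
    rule to directional derivatives. *)
Lemma is_derive_lineP (W : normedModType R) (f : W -> R) (x v : W) (df : R) :
  is_derive x v f df <-> is_derive (0 : R) 1 (fun t : R => f (t *: v + x)) df.
Proof.
have E : (fun t : R => t^-1 *: ((f \o shift x) (t *: v) - f x)) =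
  (fun t : R => t^-1 *: (((fun t : R => f (t *: v + x)) \o shift 0) (t *: 1) -
     (fun t : R => f (t *: v + x)) 0)).
  by apply/funext => t /=; rewrite /shift /= addr0 scale0r add0r [_ *: 1]mulr1.
have E1 : derivable f x v = derivable (fun t : R => f (t *: v + x)) (0 : R) 1.
  by rewrite /derivable E.
have E2 : 'D_v f x = 'D_1 (fun t : R => f (t *: v + x)) (0 : R).
  by rewrite /derive E.
split=> -[Hd He]; split.
- by rewrite -E1.
- by rewrite -E2.
- by rewrite E1.
- by rewrite E2.
Qed.

Lemma is_derive_comp1 (h : R -> R) f x v (dh df : R) :
  is_derive (f x) 1 h dh -> is_derive x v f df -> is_derive x v (h \o f) (dh * df).
Proof.
move=> Hh /is_derive_lineP Hf; apply/is_derive_lineP.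
apply: (@is_derive1_comp R h (fun t => f (t *: v + x))).
by rewrite scale0r add0r.
Qed.

Lemma class_CS n f : class_C n.+1 f -> class_C n f.
Proof.
elim: n f => [|n IH] f [cf Hf]; split => // v.
by have [Hd Hc] := Hf v; split => //; apply: IH.
Qed.

Lemma smooth_continuous f : smooth f -> continuous f.
Proof. by move=> /(_ 0) []. Qed.

Lemma smooth_derivable f x v : smooth f -> derivable f x v.
Proof. by move=> /(_ 1%N) [_ /(_ v) []]. Qed.

Lemma smooth_is_derive f x v : smooth f -> is_derive x v f ('D_v f x).
Proof. by move=> sf; split => //; apply: smooth_derivable. Qed.

Lemma smooth_derive f v : smooth f -> smooth (fun x => 'D_v f x).
Proof. by move=> sf n; have [_ /(_ v) []] := sf n.+1. Qed.

Lemma derive_eq_fun f v (df : R * R -> R) :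
  (forall x, is_derive x v f (df x)) -> (fun x => 'D_v f x) = df.
Proof. by move=> H; apply/funext => x; have [_] := H x. Qed.

Lemma class_C_cst n (c : R) : class_C n (fun _ : R * R => c).
Proof.
elim: n c => [|n IH] c; split => //; first by move=> x; apply: cvg_cst.
  by move=> x; apply: cvg_cst.
move=> v; split; first by move=> x; apply: derivable_cst.
have -> : (fun x => 'D_v (fun _ : R * R => c) x) = (fun _ => 0).
  by apply: derive_eq_fun => x; apply: is_derive_cst.
exact: IH.
Qed.

Lemma smooth_cst (c : R) : smooth (fun _ : R * R => c).
Proof. by move=> n; apply: class_C_cst. Qed.

Lemma class_CD n f g : class_C n f -> class_C n g -> class_C n (fun x => f x + g x).
Proof.
elim: n f g => [|n IH] f g [cf Hf] [cg Hg]; split => //.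
- by move=> x; apply: cvgD; [apply: cf|apply: cg].
- by move=> x; apply: cvgD; [apply: cf|apply: cg].
move=> v; have [df Cf] := Hf v; have [dg Cg] := Hg v.
split; first by move=> x; apply: (@derivableD _ _ _ f g).
have -> : (fun x => 'D_v (fun x => f x + g x) x) = (fun x => 'D_v f x + 'D_v g x).
  by apply: derive_eq_fun => x; apply: (@is_deriveD _ _ _ f g); split.
exact: IH.
Qed.

Lemma class_CM n f g : class_C n f -> class_C n g -> class_C n (fun x => f x * g x).
Proof.
elim: n f g => [|n IH] f g Hf0 Hg0.
  case: Hf0 Hg0 => cf _ [cg _]; split => // x; apply: cvgM; [exact: cf|exact: cg].
have [cf Hf] := Hf0; have [cg Hg] := Hg0; split.
  by move=> x; apply: cvgM; [apply: cf|apply: cg].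
move=> v; have [df Cf] := Hf v; have [dg Cg] := Hg v.
split; first by move=> x; apply: (@derivableM _ _ f g).
have -> : (fun x => 'D_v (fun x => f x * g x) x) =
    (fun x => f x * 'D_v g x + g x * 'D_v f x).
  by apply: derive_eq_fun => x; apply: (@is_deriveM _ _ f g); split.
by apply: class_CD; apply: IH => //; exact: class_CS.
Qed.

Lemma smoothD f g : smooth f -> smooth g -> smooth (fun x => f x + g x).
Proof. by move=> sf sg n; apply: class_CD. Qed.

Lemma smoothM f g : smooth f -> smooth g -> smooth (fun x => f x * g x).
Proof. by move=> sf sg n; apply: class_CM. Qed.

Lemma smoothZ (c : R) f : smooth f -> smooth (fun x => c * f x).
Proof. by move=> sf; apply: smoothM => //; apply: smooth_cst. Qed.

Lemma smoothB f g : smooth f -> smooth g -> smooth (fun x => f x - g x).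
Proof.
move=> sf sg; have := smoothD sf (smoothZ (-1) sg).
by congr smooth; apply/funext => x; rewrite mulN1r.
Qed.

Lemma smooth_prod (I : Type) (s : seq I) (F : I -> R * R -> R) :
  (forall i, smooth (F i)) -> smooth (fun x => \prod_(i <- s) F i x).
Proof.
move=> HF; elim: s => [|i s IH].
  by under eq_fun do rewrite big_nil; apply: smooth_cst.
by under eq_fun do rewrite big_cons; apply: smoothM.
Qed.

Lemma smooth_linear (a b : R) : smooth (fun x : R * R => a * x.1 + b * x.2).
Proof.
have cf : continuous (fun x : R * R => a * x.1 + b * x.2).
  move=> x; apply: cvgD; apply: cvgM; try exact: cvg_cst.
    exact: cvg_fst.
  exact: cvg_snd.
have H x v : is_derive x v (fun x : R * R => a * x.1 + b * x.2) (a * v.1 + b * v.2).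
  apply/is_derive_lineP => /=.
  have -> : (fun t : R => a * (t * v.1 + x.1) + b * (t * v.2 + x.2)) =
     (fun t : R => (a * v.1 + b * v.2) * t + (a * x.1 + b * x.2)).
    by apply/funext => t; ring.
  by apply: is_derive_eq; rewrite /GRing.scale /= ; ring.
case=> [|n]; split => // v; split; first by move=> x; have [] := H x v.
by rewrite (derive_eq_fun (H ^~ v)); apply: class_C_cst.
Qed.

(* A sequence of successive derivatives encodes a C^oo function of one real
   variable, namely its first term. *)
Definition derivatives h := forall m t, is_derive t (1 : R) (h m) (h m.+1 t).

Lemma derivatives_continuous h m : derivatives h -> continuous (h m).
Proof.
move=> Hh x; apply: differentiable_continuous; apply/derivable1_diffP.
by have [] := Hh m x.
Qed.

Lemma smooth_comp h f : derivatives h -> smooth f -> smooth (h 0%N \o f).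
Proof.
move=> Hh sf n; move: 0%N; elim: n => [|n IH] m.
  split => // x; apply: continuous_comp; first exact: (smooth_continuous sf).
  exact: derivatives_continuous.
have D x v := is_derive_comp1 (Hh m (f x)) (smooth_is_derive x v sf).
split.
  move=> x; apply: continuous_comp; first exact: (smooth_continuous sf).
  exact: derivatives_continuous.
move=> v; split; first by move=> x; have [] := D x v.
rewrite (derive_eq_fun (D ^~ v)); apply: class_CM; first exact: IH.
exact: smooth_derive.
Qed.

(** Functions with a jump hidden by a cutoff, such as the exponential profile of the strips, have
    one formula near the jump and another one elsewhere; smoothness is then checked locally. *)
Lemma smooth_local f :
  (forall x, exists2 g, smooth g & \near x, f x = g x) -> smooth f.
Proof.
move=> H n; elim: n f H => [|n IH] f H.
  split => // x; have [g sg fg] := H x.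
  have fgx : f x = g x by apply: nbhs_singleton fg.
  apply: (@cvg_trans _ (g y @[y --> x])); last first.
    by rewrite fgx; apply: (smooth_continuous sg).
  by apply: near_eq_cvg; near=> y; symmetry; near: y.
have cf : continuous f.
  move=> x; have [g sg fg] := H x.
  have fgx : f x = g x by apply: nbhs_singleton fg.
  apply: (@cvg_trans _ (g y @[y --> x])); last first.
    by rewrite fgx; apply: (smooth_continuous sg).
  by apply: near_eq_cvg; near=> y; symmetry; near: y.
split => // v; split.
  move=> x; have [g sg fg] := H x.
  apply: (@near_eq_derivable _ _ _ g); last exact: smooth_derivable.
  by near=> y; symmetry; near: y.
apply: IH => x; have [g sg fg] := H x.
exists (fun x => 'D_v g x); first exact: smooth_derive.
have := nbhs_interior fg; apply: filterS => y fgy.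
exact: near_eq_derive.
Unshelve. all: by end_near. Qed.

Definition cos_seq m (t : R) : R := cos (t + m%:R * (pi / 2)).

Lemma cos_derivatives : derivatives cos_seq.
Proof.
move=> m t; rewrite /cos_seq.
have A : is_derive t (1 : R) (fun t : R => t + m%:R * (pi / 2)) 1.
  by apply: is_derive_eq; rewrite addr0.
have := @is_derive1_comp R cos (fun t => t + m%:R * (pi / 2)) t _ _ (is_derive_cos _) A; congr is_derive.
have -> : t + m.+1%:R * (pi / 2) = t + m%:R * (pi / 2) + pi / 2 by rewrite -natr1; ring.
by rewrite [RHS]cosD cos_pihalf sin_pihalf mulr0 !mulr1 sub0r.
Qed.

Lemma smooth_cos f : smooth f -> smooth (fun x => cos (f x)).
Proof.
move=> sf; have := smooth_comp cos_derivatives sf; congr smooth.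
by apply/funext => x; rewrite /cos_seq /= mul0r addr0.
Qed.

Lemma smooth_sin f : smooth f -> smooth (fun x => sin (f x)).
Proof.
move=> sf; have := smooth_cos (smoothD sf (smooth_cst (- (pi / 2)))).
congr smooth; apply/funext => x.
by rewrite cosD cosN sinN cos_pihalf sin_pihalf; ring.
Qed.

Lemma smooth_expR f : smooth f -> smooth (fun x => expR (f x)).
Proof. by move=> sf; apply: (@smooth_comp (fun _ => expR)) => // m t; apply: is_derive_expR. Qed.

End smoothness.

(** * Flat functions and smooth steps *)

Section bump.
Context {R : realType}.

(** The functions p(1/x) exp(-1/x), extended by 0 to x <= 0, are closed under differentiation, which
    replaces p by X^2 (p - p'); [flat_poly] iterates this rule from p = 1. *)
Definition flat_fun (p : {poly R}) (x : R) : R :=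
  if 0 < x then p.[x^-1] * expR (- x^-1) else 0.

Lemma horner_bound (p : {poly R}) :
  exists2 C : R, 0 <= C & forall y, 1 <= y -> `|p.[y]| <= C * y ^+ (size p).
Proof.
exists (\sum_(i < size p) `|p`_i|); first exact: sumr_ge0.
move=> y y1; have y0 : 0 <= y by apply: le_trans y1.
rewrite horner_coef; apply: (le_trans (ler_norm_sum _ _ _)).
rewrite mulr_suml; apply: ler_sum => i _.
rewrite normrM ler_wpM2l // normrX ger0_norm //.
by apply: ler_weXn2l => //; apply: ltnW.
Qed.

(** With n = [size p], exp(1/x) is at least (1/x)^(n+2) / (n+2)!, while |p(1/x)| is at most C
    (1/x)^n. Two powers of x remain, enough for a zero derivative at 0. *)
Lemma flat_fun_small (p : {poly R}) :
  exists2 C : R, 0 <= C & forall x, `|x| <= 1 -> `|flat_fun p x| <= C * x ^+ 2.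
Proof.
have [C C0 HC] := horner_bound p.
exists (C * ((size p).+2)`!%:R); first by rewrite mulr_ge0.
move=> x x1; rewrite /flat_fun; case: ltP => x0; last first.
  by rewrite normr0 mulr_ge0 ?sqr_ge0 ?mulr_ge0.
have y1 : 1 <= x^-1.
  by rewrite -[1]invr1 lef_pV2 ?posrE //; apply: le_trans x1; apply: ler_norm.
have y0 : 0 < x^-1 by rewrite invr_gt0.
rewrite normrM (ger0_norm (expR_ge0 _)) expRN.
have E := expR_ge1Dxn (size p).+1 (ltW y0).
have F0 : 0 < ((size p).+2)`!%:R :> R by rewrite ltr0n fact_gt0.
have E2 : x^-1 ^+ (size p).+2 / ((size p).+2)`!%:R <= expR x^-1.
  by apply: le_trans E; rewrite lerDr.
apply: (@le_trans _ _ (C * x^-1 ^+ size p / (x^-1 ^+ (size p).+2 / ((size p).+2)`!%:R))).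
  apply: ler_pM => //; first exact: HC.
  by rewrite lef_pV2 ?posrE ?expR_gt0 // divr_gt0 // exprn_gt0.
rewrite invf_div -!exprVn invrK le_eqVlt; apply/orP; left; apply/eqP.
rewrite !exprS; set u := x ^+ size p.
have u0 : u != 0 by rewrite expf_neq0 // gt_eqF.
rewrite expr0 exprVn -/u.
by field.
Qed.

Lemma is_derive0_flat (f : R -> R) (C : R) : f 0 = 0 ->
  (forall x, `|x| <= 1 -> `|f x| <= C * x ^+ 2) -> is_derive (0 : R) (1 : R) f 0.
Proof.
move=> f0 Hf.
have L : h^-1 *: ((f \o shift 0) (h *: 1) - f 0) @[h --> (0 : R)^'] --> (0 : R).
  apply/norm_cvg0P; apply: (@squeeze_cvgr _ _ _ _ (fun=> 0) (fun h => C * `|h|)).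
  - near=> h; apply/andP; split => //=.
    have h0 : h != 0 by near: h; apply: nbhs_dnbhs_neq.
    rewrite /shift /= addr0 f0 subr0 [_ *: 1]mulr1 /GRing.scale /= normrM normfV.
    rewrite ler_pdivrMl ?normr_gt0 // mulrCA.
    rewrite -expr2 real_normK ?num_real //; apply: Hf; near: h.
    apply: dnbhs0_le; exact: ltr01.
  - exact: cvg_cst.
  - rewrite -[X in _ --> X](mulr0 C); apply: cvgM; first exact: cvg_cst.
    rewrite -[X in _ --> X](@normr0 R R); apply: cvg_norm.
    exact: (@cvg_within _ (nbhs (0 : R))).
split; first by apply/cvg_ex; exists 0.
by apply/cvg_lim.
Unshelve. all: by end_near. Qed.

Fixpoint flat_poly m : {poly R} :=
  if m is m'.+1 then 'X^2 * (flat_poly m' - (flat_poly m')^`()) else 1.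

Lemma flat_derivatives : derivatives (fun m => flat_fun (flat_poly m)).
Proof.
move=> m x; have [x0|x0|->] := ltgtP x 0.
- have N : \near x, (fun=> 0) x = flat_fun (flat_poly m) x.
    near=> y; rewrite /flat_fun ltNge (_ : y <= 0) //; apply: ltW.
    by near: y; apply: lt_nbhsl.
  apply: (near_eq_is_derive N); rewrite /flat_fun ltNge (ltW x0) /=.
  exact: is_derive_cst.
- have N : \near x, (flat_poly m).[x^-1] * expR (- x^-1) = flat_fun (flat_poly m) x.
    near=> y; rewrite /flat_fun (_ : 0 < y) //.
    by near: y; apply: lt_nbhsr.
  apply: (near_eq_is_derive N); rewrite /flat_fun x0 /=.
  have xn0 : x != 0 by rewrite gt_eqF.
  have V : is_derive x (1 : R) (fun y : R => y^-1) (- x ^- 2).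
    have := @is_deriveV R id x 1 1 xn0 (is_derive_id _ _).
    by congr is_derive; rewrite /GRing.scale /= mulr1.
  have P := @is_derive1_comp R _ (fun y => y^-1) x _ _ (is_derive_poly (flat_poly m) x^-1) V.
  have Q := @is_derive1_comp R expR (fun y => - y^-1) x _ _ (is_derive_expR (- x^-1))
    (@is_deriveN R _ _ (fun y : R => y^-1) x 1 _ V).
  have := @is_deriveM R _ _ _ x 1 _ _ P Q; congr is_derive.
  rewrite /GRing.scale /= !hornerE /= exprVn; ring.
- have [C C0 HC] := flat_fun_small (flat_poly m).
  rewrite {2}/flat_fun ltxx.
  by apply: is_derive0_flat HC; rewrite /flat_fun ltxx.
Unshelve. all: by end_near. Qed.

Definition flat (x : R) : R := if 0 < x then expR (- x^-1) else 0.

Lemma smooth_flat (f : R * R -> R) : smooth f -> smooth (flat \o f).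
Proof.
move=> sf; have := smooth_comp flat_derivatives sf; congr smooth.
by apply/funext => x; rewrite /flat_fun /flat /= hornerC mul1r.
Qed.

Lemma flat0 x : x <= 0 -> flat x = 0.
Proof. by rewrite /flat leNgt; case: ifP. Qed.

Lemma flat_ge0 x : 0 <= flat x.
Proof. by rewrite /flat; case: ifP => // _; apply: expR_ge0. Qed.

Lemma flat1_gt0 : 0 < flat 1.
Proof. by rewrite /flat ltr01 expR_gt0. Qed.

Lemma flat_le x y : x <= y -> flat x <= flat y.
Proof.
move=> xy; rewrite {1}/flat; case: ltP => [x0|_]; last exact: flat_ge0.
have y0 : 0 < y by apply: lt_le_trans xy.
by rewrite /flat y0 ler_expR lerN2 lef_pV2.
Qed.

(** A smooth step from 1 on t <= 1 to 0 on t >= 2: the inner [flat] vanishes for t <= 1 and reaches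
    [flat 1] at t = 2, where the argument of the outer one becomes nonpositive. *)
Definition bump (t : R) : R := flat (1 - flat (t - 1) / flat 1) / flat 1.

Lemma bump_le1 t : bump t <= 1.
Proof.
rewrite ler_pdivrMr ?flat1_gt0 // mul1r; apply: flat_le.
by rewrite lerBlDr lerDl divr_ge0 ?flat_ge0.
Qed.

Lemma bump1 t : t <= 1 -> bump t = 1.
Proof.
move=> t1; rewrite /bump (@flat0 (t - 1)) ?subr_le0 //.
by rewrite mul0r subr0 divff // gt_eqF // flat1_gt0.
Qed.

Lemma bump0 t : 2 <= t -> bump t = 0.
Proof.
move=> t2; rewrite /bump flat0 ?mul0r // subr_le0.
by rewrite ler_pdivlMr ?flat1_gt0 // mul1r flat_le //; lra.
Qed.

Lemma smooth_bump (f : R * R -> R) : smooth f -> smooth (fun x => bump (f x)).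
Proof.
move=> sf.
have s1 := smooth_flat (smoothD sf (smooth_cst (- 1))).
have s2 := smooth_flat (smoothB (smooth_cst 1) (smoothZ (flat 1)^-1 s1)).
have := smoothZ (flat 1)^-1 s2; congr smooth; apply/funext => x.
by rewrite /bump /= mulrC; congr (flat (_ - _) / _); rewrite mulrC.
Qed.

End bump.

(** * Averages over the torus *)

Section cell_integral.
Context {R : realType} (L : R) (L0 : 0 < L).
Implicit Types (f g : R * R -> R).

(* Defs uses two measurable structures on R, with convertible sigma-algebras;
   this is the one for which leb2 is a measure. *)
Local Notation T2 := (measurableTypeR R * measurableTypeR R)%type.

Lemma open_measurable2 (U : set (R * R)) : open U -> measurable (U : set T2).
Proof.
move=> oU.
pose B (i : rat * rat * nat) : set (R * R) :=
  ball (ratr i.1.1 : R) (i.2.+1%:R^-1) `*` ball (ratr i.1.2 : R) (i.2.+1%:R^-1).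
pose F i := if `[< B i `<=` U >] then B i else set0.
have -> : U = \bigcup_i F i.
  apply/seteqP; split => [[x1 x2] Ux|x [i _]]; last first.
    by rewrite /F; case: asboolP => [|_ []]; apply.
  have /nbhs_ballP[e /= e0 He] : nbhs (x1, x2) U by apply: open_nbhs_nbhs.
  have [n Hn] : exists n : nat, n.+1%:R^-1 < e / 2.
    have /ltr_add_invr[n] : 0 < e / 2 by rewrite divr_gt0.
    by rewrite add0r; exists n.
  have n0 : 0 < n.+1%:R^-1 :> R by rewrite invr_gt0.
  pose d : R := n.+1%:R^-1; rewrite -/d in Hn n0.
  have /rat_in_itvoo[q1] : x1 - d < x1 + d by lra.
  have /rat_in_itvoo[q2] : x2 - d < x2 + d by lra.
  rewrite !in_itv /= => /andP[a1 a2] /andP[b1 b2].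
  have HB : B ((q1, q2), n) `<=` U.
    move=> [y1 y2] [/= c1 c2]; apply: He; split => /=; move: c1 c2;
      rewrite /ball /= -?/d !ltr_distl => /andP[? ?] /andP[? ?]; apply/andP; split; lra.
  exists ((q1, q2), n) => //; rewrite /F asboolT //.
  by split; rewrite /ball /= -?/d ltr_distl; apply/andP; split; lra.
apply: countable_bigcupT_measurable; first exact: countableP.
move=> i; rewrite /F; case: ifP => _; last exact: measurable0.
by apply: measurableX; apply: open_measurable; apply: ball_open.
Qed.

Lemma continuous_measurable2 f : continuous f -> measurable_fun setT (f : T2 -> R).
Proof.
move=> /continuousP cf; apply: (measurability _ (RGenOpens.measurableE R)).
move=> _ [_ [a [b ->] <-]]; rewrite setTI; apply: open_measurable2.
exact/cf/interval_open.
Qed.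

Lemma measurable_cell : measurable (cell L : set T2).
Proof. by apply: measurableX. Qed.
Hint Resolve measurable_cell : core.

Lemma leb2_cell : leb2 (cell L) = (L ^+ 2)%:E.
Proof.
have m0 : measurable (`[0, L[%classic : set R) by [].
etransitivity; first exact: (product_measure1E lebesgue_measure lebesgue_measure m0 m0).
have E : lebesgue_measure (`[0, L[%classic : set R) = L%:E.
  by rewrite lebesgue_measure_itv /= lte_fin L0 -EFinB subr0.
transitivity (L%:E * L%:E)%E; first by congr (_ * _)%E; exact: E.
by rewrite -EFinM.
Qed.

Lemma leb2_cell_fin : (leb2 (cell L) < +oo)%E.
Proof. by rewrite leb2_cell ltry. Qed.

Definition intg f := leb2.-integrable (cell L) (EFin \o f).
Definition bdd f := measurable_fun (cell L) (f : T2 -> R) /\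
  exists M, forall x, cell L x -> `|f x| <= M.
Definition sqi f := measurable_fun (cell L) (f : T2 -> R) /\ intg (fun x => f x ^+ 2).

(** With this normalisation the characters of the torus are orthonormal. *)
Definition avg f : R := (L ^+ 2)^-1 * \int[leb2]_(x in cell L) f x.

Lemma bdd_intg f : bdd f -> intg f.
Proof.
move=> [mf [M HM]]; apply: measurable_bounded_integrable => //.
  exact: leb2_cell_fin.
by exists M; split; [exact: num_real|move=> ? ? ? ?; apply: (le_trans (HM _ _)) => //; exact: ltW].
Qed.

Lemma bdd_cst (c : R) : bdd (fun=> c).
Proof. by split; [exact: measurable_cst|exists `|c|]. Qed.

Lemma bddD f g : bdd f -> bdd g -> bdd (fun x => f x + g x).
Proof.
move=> [mf [M HM]] [mg [N HN]]; split; first exact: measurable_funD.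
by exists (M + N) => x cx; apply: (le_trans (ler_normD _ _)); apply: lerD; auto.
Qed.

Lemma bddM f g : bdd f -> bdd g -> bdd (fun x => f x * g x).
Proof.
move=> [mf [M HM]] [mg [N HN]]; split; first exact: measurable_funM.
by exists (M * N) => x cx; rewrite normrM; apply: ler_pM; auto.
Qed.

Lemma bddZ (c : R) f : bdd f -> bdd (fun x => c * f x).
Proof. by apply: bddM; apply: bdd_cst. Qed.

Lemma bddN f : bdd f -> bdd (fun x => - f x).
Proof. by move=> /(bddZ (-1)); under eq_fun do rewrite mulN1r. Qed.

Lemma bddB f g : bdd f -> bdd g -> bdd (fun x => f x - g x).
Proof. by move=> bf bg; apply: bddD => //; apply: bddN. Qed.

Lemma bdd_sqi f : bdd f -> sqi f.
Proof.
move=> bf; split; first by case: bf.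
by apply: bdd_intg; under eq_fun do rewrite expr2; apply: bddM.
Qed.

Lemma intgD f g : intg f -> intg g -> intg (fun x => f x + g x).
Proof.
by move=> If Ig; exact: (integrableD measurable_cell If Ig).
Qed.

Lemma intgZ (c : R) f : intg f -> intg (fun x => c * f x).
Proof.
by move=> If; exact: (integrableZl measurable_cell c If).
Qed.

Lemma intg_le f g : measurable_fun (cell L) (f : T2 -> R) -> intg g ->
  (forall x, cell L x -> `|f x| <= g x) -> intg f.
Proof.
move=> mf Ig H; apply: (le_integrable measurable_cell _ _ Ig).
  exact/measurable_EFinP.
move=> x cx; rewrite /= lee_fin; apply: (le_trans (H _ cx)); exact: ler_norm.
Qed.

Lemma sqiM_intg f g : sqi f -> sqi g -> intg (fun x => f x * g x).
Proof.
move=> [mf If] [mg Ig]; apply: (intg_le _ (intgD If Ig)).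
  exact: measurable_funM.
move=> x _; rewrite ler_norml; apply/andP; split; nra.
Qed.

Lemma sqi_intg f : sqi f -> intg f.
Proof.
move=> sf; have := sqiM_intg sf (bdd_sqi (bdd_cst 1)).
by under eq_fun do rewrite mulr1.
Qed.

Lemma sqiD f g : sqi f -> sqi g -> sqi (fun x => f x + g x).
Proof.
move=> sf sg; have Ifg := sqiM_intg sf sg; case: sf sg => [mf If] [mg Ig].
split; first exact: measurable_funD.
have := intgD (intgD If Ig) (intgZ 2 Ifg); congr intg; apply/funext => x; ring.
Qed.

Lemma sqiM f g : bdd f -> sqi g -> sqi (fun x => f x * g x).
Proof.
move=> [mf [M HM]] [mg Ig]; split; first exact: measurable_funM.
apply: (@intg_le _ (fun x => M ^+ 2 * g x ^+ 2)).
- by apply: measurable_funX; exact: measurable_funM.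
- exact: intgZ.
- move=> x cx; rewrite exprMn normrM !ger0_norm ?sqr_ge0 // ler_wpM2r ?sqr_ge0 //.
  by rewrite -(real_normK (num_real _)) ler_sqr ?nnegrE //; [exact: HM|exact: (le_trans _ (HM _ cx))].
Qed.

Lemma sqiZ (c : R) g : sqi g -> sqi (fun x => c * g x).
Proof. by apply: sqiM; apply: bdd_cst. Qed.

Lemma sqiN g : sqi g -> sqi (fun x => - g x).
Proof. by move=> /(sqiZ (-1)); under eq_fun do rewrite mulN1r. Qed.

Lemma sqiB f g : sqi f -> sqi g -> sqi (fun x => f x - g x).
Proof. by move=> sf sg; apply: sqiD => //; apply: sqiN. Qed.

Lemma avgD f g : intg f -> intg g -> avg (fun x => f x + g x) = avg f + avg g.
Proof. by move=> If Ig; rewrite /avg RintegralD // mulrDr. Qed.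

Lemma avgZ (c : R) f : intg f -> avg (fun x => c * f x) = c * avg f.
Proof. by move=> If; rewrite /avg RintegralZl // mulrCA. Qed.

Lemma avg_cst (c : R) : avg (fun=> c) = c.
Proof.
rewrite /avg Rintegral_cst //.
transitivity ((L ^+ 2)^-1 * (c * fine (L ^+ 2)%:E)).
  by congr (_ * (_ * fine _)); exact: leb2_cell.
rewrite /= mulrC mulfK //.
by rewrite expf_neq0 // gt_eqF.
Qed.

Lemma avg_ge0 f : (forall x, cell L x -> 0 <= f x) -> 0 <= avg f.
Proof.
by move=> H; rewrite mulr_ge0 ?invr_ge0 ?sqr_ge0 //; apply: Rintegral_ge0.
Qed.

Lemma avg_le f g : intg f -> intg g -> (forall x, cell L x -> f x <= g x) ->
  avg f <= avg g.
Proof.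
move=> If Ig H; rewrite ler_wpM2l ?invr_ge0 ?sqr_ge0 //.
exact: le_Rintegral.
Qed.

Lemma eq_avg f g : (forall x, cell L x -> f x = g x) -> avg f = avg g.
Proof.
by move=> H; rewrite /avg; congr (_ * _); apply: eq_Rintegral => x /set_mem /H.
Qed.

Lemma intg_sum (I : Type) (s : seq I) (F : I -> R * R -> R) :
  (forall i, intg (F i)) -> intg (fun x => \sum_(i <- s) F i x).
Proof.
move=> H; elim: s => [|i s IH].
  by under eq_fun do rewrite big_nil; apply: bdd_intg; apply: bdd_cst.
by under eq_fun do rewrite big_cons; apply: intgD.
Qed.

Lemma avg_sum (I : Type) (s : seq I) (F : I -> R * R -> R) :
  (forall i, intg (F i)) -> avg (fun x => \sum_(i <- s) F i x) = \sum_(i <- s) avg (F i).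
Proof.
move=> H; elim: s => [|i s IH].
  by under eq_fun do rewrite big_nil; rewrite big_nil avg_cst.
under eq_fun do rewrite big_cons; rewrite big_cons avgD ?IH //; exact: intg_sum.
Qed.

Lemma closed_cell_compact : compact (`[0, L]%classic `*` `[0, L]%classic : set (R * R)).
Proof. by apply: compact_setX; apply: segment_compact. Qed.

Lemma continuous_bdd f : continuous f -> bdd f.
Proof.
move=> cf; split; first by apply: measurable_funTS; exact: continuous_measurable2.
have : compact (f @` (`[0, L]%classic `*` `[0, L]%classic)).
  apply: continuous_compact; last exact: closed_cell_compact.
  exact: continuous_subspaceT.
move=> /compact_bounded[M [_ HM]]; exists (M + 1) => x [/= x1 x2].
apply: (HM (M + 1)); first by rewrite ltrDl.
exists x => //; split => /=; [move: x1|move: x2]; rewrite !in_itv /= => /andP[-> /ltW ->] //.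
Qed.

End cell_integral.

(** * Averages of derivatives vanish *)

Section divergence.
Context {R : realType} (L : R) (L0 : 0 < L).
Implicit Types (f g : R * R -> R).
Local Notation T1 := (measurableTypeR R).
Local Notation T2 := (measurableTypeR R * measurableTypeR R)%type.
Local Notation mu := (@lebesgue_measure R).

Lemma integral_periodic_derive (F f : R -> R) : continuous f ->
  (forall x, is_derive x (1 : R) F (f x)) -> F L = F 0 ->
  (\int[mu]_(x in `[0%R, L[) (f x)%:E = 0)%E.
Proof.
move=> cf dF FL.
have cF : continuous F.
  move=> x; apply: differentiable_continuous; apply/derivable1_diffP.
  by have [] := dF x.
rewrite integral_itv_bndo_bndc; last first.
  apply: measurable_funTS; apply/measurable_EFinP; exact: continuous_measurable_fun.
rewrite (@continuous_FTC2 R f F) //.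
- by rewrite FL subee.
- exact: continuous_subspaceT.
- split => [x _||]; first by have [] := dF x.
  + by apply: cvg_at_right_filter; apply: cF.
  + by apply: cvg_at_left_filter; apply: cF.
- by move=> x _; rewrite derive1E; have [_] := dF x.
Qed.

Lemma intg_patch f : intg L f -> leb2.-integrable [set: T2] ((EFin \o f) \_ (cell L)).
Proof.
by move=> If; apply/integrable_restrict => //; rewrite ?setTI //; exact: measurable_cell.
Qed.

(** By Fubini the first variable is integrated first; the fundamental theorem of calculus leaves two
    boundary terms, which cancel by periodicity. *)
Lemma avg_d1 f : smooth f -> periodic_on L setT f -> avg L (d1 f) = 0.
Proof.
move=> sf pf; have sdf := smooth_derive (1, 0) sf.
have Id : intg L (d1 f) by apply: bdd_intg => //; exact/continuous_bdd/smooth_continuous.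
rewrite /avg /Rintegral integral_mkcond.
have E := integral21_prod_meas1 (intg_patch Id).
rewrite [X in fine X](_ : _ = 0%E) ?mulr0 //.
etransitivity; first by symmetry; exact: E.
apply: integral0_eq => y _; rewrite /fubini_G.
case: (boolP (0 <= y < L)) => yL; last first.
  apply: integral0_eq => x _; rewrite patchE; case: ifPn => //.
  by rewrite inE => -[_ /=]; rewrite in_itv /= (negbTE yL).
transitivity (\int[mu]_(x in `[0%R, L[) (d1 f (x, y))%:E)%E.
  rewrite [RHS]integral_mkcond; apply: eq_integral => x _.
  rewrite !patchE; congr (if _ then _ else _); apply/idP/idP.
    by rewrite !inE => -[].
  by rewrite !inE => xL; split => //=; rewrite in_itv.
apply: (@integral_periodic_derive (fun x => f (x, y))).
- move=> x; apply: (@continuous_comp _ _ _ (fun x => (x, y)) (d1 f)).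
    exact: (@cvg_pair R R R (nbhs x) (nbhs x) (nbhs y) _ _ _ id (cst y) cvg_id (cvg_cst _)).
  exact: (smooth_continuous sdf).
- move=> x; have /is_derive_lineP H := smooth_is_derive (x, y) (1, 0) sf.
  apply/is_derive_lineP; move: H; congr is_derive.
  apply/funext => t; congr f; apply: injective_projections => /=;
    by rewrite /GRing.scale /= ?mulr0 ?add0r.
- have := pf (1, 0) (0, y) I; rewrite /lattice /= mul1r mul0r.
  by move=> <-; congr f; apply: injective_projections; rewrite /= ?addr0 ?add0r.
Qed.

Lemma avg_d2 f : smooth f -> periodic_on L setT f -> avg L (d2 f) = 0.
Proof.
move=> sf pf; have sdf := smooth_derive (0, 1) sf.
have Id : intg L (d2 f) by apply: bdd_intg => //; exact/continuous_bdd/smooth_continuous.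
rewrite /avg /Rintegral integral_mkcond.
have E := integral12_prod_meas1 (intg_patch Id).
rewrite [X in fine X](_ : _ = 0%E) ?mulr0 //.
etransitivity; first by symmetry; exact: E.
apply: integral0_eq => x _; rewrite /fubini_F.
case: (boolP (0 <= x < L)) => xL; last first.
  apply: integral0_eq => y _; rewrite patchE; case: ifPn => //.
  by rewrite inE => -[/= + _]; rewrite in_itv /= (negbTE xL).
transitivity (\int[mu]_(y in `[0%R, L[) (d2 f (x, y))%:E)%E.
  rewrite [RHS]integral_mkcond; apply: eq_integral => y _.
  rewrite !patchE; congr (if _ then _ else _); apply/idP/idP.
    by rewrite !inE => -[].
  by rewrite !inE => yL; split => //=; rewrite in_itv.
apply: (@integral_periodic_derive (fun y => f (x, y))).
- move=> y; apply: (@continuous_comp _ _ _ (fun y => (x, y)) (d2 f)).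
    exact: (@cvg_pair R R R (nbhs y) (nbhs x) (nbhs y) _ _ _ (cst x) id (cvg_cst _) cvg_id).
  exact: (smooth_continuous sdf).
- move=> y; have /is_derive_lineP H := smooth_is_derive (x, y) (0, 1) sf.
  apply/is_derive_lineP; move: H; congr is_derive.
  apply/funext => t; congr f; apply: injective_projections => /=;
    by rewrite /GRing.scale /= ?mulr0 ?add0r.
- have := pf (0, 1) (x, 0) I; rewrite /lattice /= mul1r mul0r.
  by move=> <-; congr f; apply: injective_projections; rewrite /= ?addr0 ?add0r.
Qed.

End divergence.

(** * Fourier coefficients *)

Section fourier.
Context {R : realType} (L : R) (L0 : 0 < L).
Local Notation Re := (@complex.Re R).
Local Notation Im := (@complex.Im R).
Implicit Types (f g : R * R -> R[i]) (xi eta : int * int) (F : seq (int * int)).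

Definition sqn (z : R[i]) : R := Re z ^+ 2 + Im z ^+ 2.

Lemma ReD (a b : R[i]) : Re (a + b) = Re a + Re b.
Proof. by case: a; case: b. Qed.

Lemma ImD (a b : R[i]) : Im (a + b) = Im a + Im b.
Proof. by case: a; case: b. Qed.

Lemma ReM (a b : R[i]) : Re (a * b) = Re a * Re b - Im a * Im b.
Proof. by case: a; case: b. Qed.

Lemma ImM (a b : R[i]) : Im (a * b) = Re a * Im b + Im a * Re b.
Proof. by case: a; case: b. Qed.

Lemma Re_conj (a : R[i]) : Re (conjc a) = Re a. Proof. by case: a. Qed.
Lemma Im_conj (a : R[i]) : Im (conjc a) = - Im a. Proof. by case: a. Qed.

Lemma ReN (a : R[i]) : Re (- a) = - Re a. Proof. by case: a. Qed.
Lemma ImN (a : R[i]) : Im (- a) = - Im a. Proof. by case: a. Qed.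

Lemma complex_ext (a b : R[i]) : Re a = Re b -> Im a = Im b -> a = b.
Proof. by case: a; case: b => ? ? ? ? /= -> ->. Qed.

Definition ReIm := (ReD, ImD, ReM, ImM, ReN, ImN, Re_conj, Im_conj).

Lemma Re_sum (I : Type) (s : seq I) (F : I -> R[i]) :
  Re (\sum_(i <- s) F i) = \sum_(i <- s) Re (F i).
Proof. by elim: s => [|i s IH]; rewrite ?big_nil // !big_cons ReD IH. Qed.

Lemma Im_sum (I : Type) (s : seq I) (F : I -> R[i]) :
  Im (\sum_(i <- s) F i) = \sum_(i <- s) Im (F i).
Proof. by elim: s => [|i s IH]; rewrite ?big_nil // !big_cons ImD IH. Qed.

Lemma sqn_ge0 z : 0 <= sqn z.
Proof. by rewrite addr_ge0 ?sqr_ge0. Qed.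

Lemma sqnM a b : sqn (a * b) = sqn a * sqn b.
Proof. by rewrite /sqn !ReIm; ring. Qed.

Lemma sqn_real (r : R) : sqn r%:C%C = r ^+ 2.
Proof. by rewrite /sqn /= expr0n addr0. Qed.

Lemma sqnN a : sqn (- a) = sqn a.
Proof. by rewrite /sqn !ReIm; ring. Qed.

Lemma sqnE a : sqn a = Re (a * conjc a).
Proof. by rewrite /sqn !ReIm; ring. Qed.

Lemma sqnD_le a b : sqn (a + b) <= 2 * sqn a + 2 * sqn b.
Proof.
rewrite /sqn !ReIm; have := sqr_ge0 (Re a - Re b); have := sqr_ge0 (Im a - Im b).
by move=> ? ?; nra.
Qed.

Lemma sqnB_le a b : sqn (a - b) <= 2 * sqn a + 2 * sqn b.
Proof. by rewrite -(sqnN b); apply: sqnD_le. Qed.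

(** Young's inequality with a free weight [t], to be chosen small when the second term has to be
    absorbed. *)
Lemma ReM_conj_le a b (t : R) : 0 < t -> Re (a * conjc b) <= t^-1 * sqn a + t * sqn b.
Proof.
move=> t0; rewrite -(ler_pM2l t0).
have -> : t * (t^-1 * sqn a + t * sqn b) = sqn a + t * (t * sqn b).
  by field; rewrite gt_eqF.
rewrite /sqn !ReIm.
have := sqr_ge0 (Re a - t * Re b); have := sqr_ge0 (Im a - t * Im b).
have := sqr_ge0 (Re a); have := sqr_ge0 (t * Re b).
have := sqr_ge0 (Im a); have := sqr_ge0 (t * Im b).
by move=> ? ? ? ? ? ?; nra.
Qed.

Definition cbdd f := bdd L (Re \o f) /\ bdd L (Im \o f).
Definition csqi f := sqi L (Re \o f) /\ sqi L (Im \o f).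
Definition cintg f := intg L (Re \o f) /\ intg L (Im \o f).
Definition cavg f : R[i] := (avg L (Re \o f) +i* avg L (Im \o f))%C.

Lemma cbdd_csqi f : cbdd f -> csqi f.
Proof. by move=> [? ?]; split; apply: bdd_sqi. Qed.

Lemma csqi_cintg f : csqi f -> cintg f.
Proof. by move=> [? ?]; split; apply: sqi_intg. Qed.

Lemma cbdd_cst c : cbdd (fun=> c).
Proof. by split; apply: bdd_cst. Qed.

Lemma cbdd_real (h : R * R -> R) : bdd L h -> cbdd (fun x => (h x)%:C%C).
Proof. by move=> ?; split => //; apply: bdd_cst. Qed.

Lemma csqi_real (h : R * R -> R) : sqi L h -> csqi (fun x => (h x)%:C%C).
Proof. by move=> ?; split => //; apply: bdd_sqi => //; apply: bdd_cst. Qed.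

Lemma cbddD f g : cbdd f -> cbdd g -> cbdd (fun x => f x + g x).
Proof.
move=> [f1 f2] [g1 g2]; split.
  by have := bddD f1 g1; congr bdd; apply/funext => x /=; rewrite ReD.
by have := bddD f2 g2; congr bdd; apply/funext => x /=; rewrite ImD.
Qed.

Lemma csqiD f g : csqi f -> csqi g -> csqi (fun x => f x + g x).
Proof.
move=> [f1 f2] [g1 g2]; split.
  by have := sqiD f1 g1; congr sqi; apply/funext => x /=; rewrite ReD.
by have := sqiD f2 g2; congr sqi; apply/funext => x /=; rewrite ImD.
Qed.

Lemma cbddM f g : cbdd f -> cbdd g -> cbdd (fun x => f x * g x).
Proof.
move=> [f1 f2] [g1 g2]; split.
  have := bddB (bddM f1 g1) (bddM f2 g2); congr bdd.
  by apply/funext => x /=; rewrite ReM.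
have := bddD (bddM f1 g2) (bddM f2 g1); congr bdd.
by apply/funext => x /=; rewrite ImM.
Qed.

Lemma csqiM f g : cbdd f -> csqi g -> csqi (fun x => f x * g x).
Proof.
move=> [f1 f2] [g1 g2]; split.
  have := sqiB (sqiM f1 g1) (sqiM f2 g2); congr sqi.
  by apply/funext => x /=; rewrite ReM.
have := sqiD (sqiM f1 g2) (sqiM f2 g1); congr sqi.
by apply/funext => x /=; rewrite ImM.
Qed.

Lemma csqiMr f g : csqi f -> cbdd g -> csqi (fun x => f x * g x).
Proof. by move=> sf bg; under eq_fun do rewrite mulrC; apply: csqiM. Qed.

Lemma csqi_cintgM f g : csqi f -> csqi g -> cintg (fun x => f x * g x).
Proof.
move=> [f1 f2] [g1 g2]; split.
  have := intgD (sqiM_intg f1 g1) (intgZ (-1) (sqiM_intg f2 g2)); congr intg.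
  by apply/funext => x /=; rewrite ReM mulN1r.
have := intgD (sqiM_intg f1 g2) (sqiM_intg f2 g1); congr intg.
by apply/funext => x /=; rewrite ImM.
Qed.

Lemma csqi_conj f : csqi f -> csqi (fun x => conjc (f x)).
Proof.
move=> [f1 f2]; split; first by move: f1; congr sqi; apply/funext => x /=; rewrite Re_conj.
by have := sqiN f2; congr sqi; apply/funext => x /=; rewrite Im_conj.
Qed.

Lemma csqiZ c f : csqi f -> csqi (fun x => c * f x).
Proof. by apply: csqiM; apply: cbdd_cst. Qed.

Lemma csqiB f g : csqi f -> csqi g -> csqi (fun x => f x - g x).
Proof.
move=> sf /(csqiZ (-1)) sg; have := csqiD sf sg; congr csqi.
by apply/funext => x; rewrite mulN1r.
Qed.

Lemma cbdd_sum (I : Type) (s : seq I) (G : I -> R * R -> R[i]) :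
  (forall i, cbdd (G i)) -> cbdd (fun x => \sum_(i <- s) G i x).
Proof.
move=> H; elim: s => [|i s IH].
  by under eq_fun do rewrite big_nil; apply: cbdd_cst.
by under eq_fun do rewrite big_cons; apply: cbddD.
Qed.

Lemma cintgZ c f : cintg f -> cintg (fun x => c * f x).
Proof.
move=> [f1 f2]; split.
  have := intgD (intgZ (Re c) f1) (intgZ (- Im c) f2); congr intg.
  by apply/funext => x /=; rewrite ReM mulNr.
have := intgD (intgZ (Re c) f2) (intgZ (Im c) f1); congr intg.
by apply/funext => x /=; rewrite ImM.
Qed.

Lemma sqn_intg f : csqi f -> intg L (fun x => sqn (f x)).
Proof. by move=> [[_ f1] [_ f2]]; apply: intgD. Qed.

Lemma weight_intg (rho : R * R -> R) f : bdd L rho -> csqi f ->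
  intg L (fun x => rho x * sqn (f x)).
Proof.
move=> br sf; have [H _] := csqi_cintgM (csqiM (cbdd_real br) sf) (csqi_conj sf).
move: H; congr intg; apply/funext => x /=.
by rewrite !ReIm /sqn /=; ring.
Qed.

Lemma cavgD f g : cintg f -> cintg g -> cavg (fun x => f x + g x) = cavg f + cavg g.
Proof.
move=> [f1 f2] [g1 g2]; apply: complex_ext; rewrite ReIm /=.
  by rewrite -avgD //; apply: eq_avg => x _ /=; rewrite ReD.
by rewrite -avgD //; apply: eq_avg => x _ /=; rewrite ImD.
Qed.

Lemma cavgZ c f : cintg f -> cavg (fun x => c * f x) = c * cavg f.
Proof.
move=> [f1 f2]; apply: complex_ext; rewrite ReIm /=.
  rewrite -!avgZ // -mulN1r -avgZ ?intgZ //.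
  rewrite -avgD; [|exact: intgZ|by apply: intgZ; apply: intgZ].
  by apply: eq_avg => x _ /=; rewrite ReM mulN1r.
rewrite -!avgZ // -avgD; [|exact: intgZ|exact: intgZ].
by apply: eq_avg => x _ /=; rewrite ImM.
Qed.

Lemma cavg_sum (I : Type) (s : seq I) (G : I -> R * R -> R[i]) :
  (forall i, cintg (G i)) ->
  cavg (fun x => \sum_(i <- s) G i x) = \sum_(i <- s) cavg (G i).
Proof.
move=> H; have [H1 H2] : (forall i, intg L (Re \o G i)) /\ (forall i, intg L (Im \o G i)).
  by split=> i; case: (H i).
apply: complex_ext; rewrite ?Re_sum ?Im_sum /= -avg_sum //.
  by apply: eq_avg => x _ /=; rewrite Re_sum.
by apply: eq_avg => x _ /=; rewrite Im_sum.
Qed.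

Lemma eq_cavg f g : (forall x, cell L x -> f x = g x) -> cavg f = cavg g.
Proof. by move=> H; congr Complex; apply: eq_avg => x /H /= ->. Qed.

Definition kap : R := 2 * pi / L.
Definition phase xi (x : R * R) : R := kap * (xi.1%:~R * x.1 + xi.2%:~R * x.2).
Definition ee xi (x : R * R) : R[i] := (cos (phase xi x) +i* sin (phase xi x))%C.

Lemma kap_gt0 : 0 < kap.
Proof. by rewrite divr_gt0 // mulr_gt0 // pi_gt0. Qed.

Lemma phaseD xi eta x : phase (xi + eta) x = phase xi x + phase eta x.
Proof. by rewrite /phase /= !intrD; ring. Qed.

Lemma phaseN xi x : phase (- xi) x = - phase xi x.
Proof. by rewrite /phase /= !intrN; ring. Qed.

Lemma smooth_phase xi : smooth (phase xi).
Proof.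
have := smooth_linear (kap * xi.1%:~R) (kap * xi.2%:~R); congr smooth.
by apply/funext => x; rewrite /phase; ring.
Qed.

Lemma eeD xi eta x : ee (xi + eta) x = ee xi x * ee eta x.
Proof.
by apply: complex_ext; rewrite ReIm /= phaseD ?cosD ?sinD //; ring.
Qed.

Lemma ee0 x : ee 0 x = 1.
Proof. by rewrite /ee /phase /= !mul0r addr0 mulr0 cos0 sin0. Qed.

Lemma conj_ee xi x : conjc (ee xi x) = ee (- xi) x.
Proof. by apply: complex_ext; rewrite ReIm /= phaseN ?cosN ?sinN. Qed.

Lemma sqn_ee xi x : sqn (ee xi x) = 1.
Proof. exact: cos2Dsin2. Qed.

Lemma smooth_Re_ee xi : smooth (Re \o ee xi).
Proof. exact: (smooth_cos (smooth_phase xi)). Qed.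

Lemma smooth_Im_ee xi : smooth (Im \o ee xi).
Proof. exact: (smooth_sin (smooth_phase xi)). Qed.

Lemma cbdd_ee xi : cbdd (ee xi).
Proof.
by split; apply: continuous_bdd; apply: smooth_continuous;
  [exact: smooth_Re_ee|exact: smooth_Im_ee].
Qed.

Lemma phase_lattice xi k x : exists m : int,
  phase xi (x + lattice L k) = phase xi x + m%:~R * (2 * pi).
Proof.
exists (xi.1 * k.1 + xi.2 * k.2); rewrite /phase /lattice /kap /=.
by rewrite intrD !intrM; field; rewrite gt_eqF.
Qed.

Lemma periodic_intmul (f : R -> R) (T : R) (m : int) t : periodic f T -> f (t + m%:~R * T) = f t.
Proof.
move=> pf; case: m => n; first by rewrite -pmulrn mulr_natl; apply: periodicn.
rewrite NegzE intrN mulNr -pmulrn mulr_natl -{2}(subrK (T *+ n.+1) t).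
by rewrite (periodicn pf).
Qed.

Lemma ee_lattice xi k x : ee xi (x + lattice L k) = ee xi x.
Proof.
have [m Hm] := phase_lattice xi k x; rewrite /ee Hm.
have -> : 2 * pi = pi *+ 2 :> R by rewrite mulr_natl.
by rewrite periodic_intmul ?periodic_intmul //; [exact: sinD2pi|exact: cosD2pi].
Qed.

Lemma is_derive_phase xi x v : is_derive x v (phase xi)
  (kap * (xi.1%:~R * v.1 + xi.2%:~R * v.2)).
Proof.
apply/is_derive_lineP => /=.
have -> : (fun t : R => phase xi (t *: v + x)) =
   (fun t : R => (kap * (xi.1%:~R * v.1 + xi.2%:~R * v.2)) * t + phase xi x).
  by apply/funext => t; rewrite /phase /= /GRing.scale /=; ring.
by apply: is_derive_eq; rewrite /GRing.scale /= ; ring.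
Qed.

Lemma is_derive_Re_ee xi x v : is_derive x v (Re \o ee xi)
  (- (kap * (xi.1%:~R * v.1 + xi.2%:~R * v.2)) * Im (ee xi x)).
Proof.
have := is_derive_comp1 (is_derive_cos (phase xi x)) (is_derive_phase xi x v).
by congr is_derive; rewrite /=; ring.
Qed.

Lemma is_derive_Im_ee xi x v : is_derive x v (Im \o ee xi)
  (kap * (xi.1%:~R * v.1 + xi.2%:~R * v.2) * Re (ee xi x)).
Proof.
have := is_derive_comp1 (is_derive_sin (phase xi x)) (is_derive_phase xi x v).
by congr is_derive; rewrite /=; ring.
Qed.

Lemma d1_Re_ee xi x : d1 (Re \o ee xi) x = - (kap * xi.1%:~R) * Im (ee xi x).
Proof. by rewrite /d1; have [_ ->] := is_derive_Re_ee xi x (1, 0); rewrite /= mulr0 addr0 mulr1. Qed.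

Lemma d2_Re_ee xi x : d2 (Re \o ee xi) x = - (kap * xi.2%:~R) * Im (ee xi x).
Proof. by rewrite /d2; have [_ ->] := is_derive_Re_ee xi x (0, 1); rewrite /= mulr0 add0r mulr1. Qed.

Lemma d1_Im_ee xi x : d1 (Im \o ee xi) x = kap * xi.1%:~R * Re (ee xi x).
Proof. by rewrite /d1; have [_ ->] := is_derive_Im_ee xi x (1, 0); rewrite /= mulr0 addr0 mulr1. Qed.

Lemma d2_Im_ee xi x : d2 (Im \o ee xi) x = kap * xi.2%:~R * Re (ee xi x).
Proof. by rewrite /d2; have [_ ->] := is_derive_Im_ee xi x (0, 1); rewrite /= mulr0 add0r mulr1. Qed.

(** The average of a derivative is 0, and a derivative of a character exchanges its real and
    imaginary parts up to the factor [kap] times a component of [xi]; one of the two components is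
    nonzero. *)
Lemma cavg_ee xi : cavg (ee xi) = (xi == 0)%:R.
Proof.
have [->|xi0] := eqVneq xi 0.
  rewrite (@eq_cavg _ (fun=> 1)) => [|x _]; last by rewrite ee0.
  by apply: complex_ext => /=; rewrite avg_cst.
have pRe : periodic_on L setT (Re \o ee xi) by move=> k x _; rewrite /comp ee_lattice.
have pIm : periodic_on L setT (Im \o ee xi) by move=> k x _; rewrite /comp ee_lattice.
have [bRe bIm] := cbdd_ee xi.
have H (z : int) (d : (R * R -> R) -> R * R -> R) :
    (forall h, smooth h -> periodic_on L setT h -> avg L (d h) = 0) ->
    (forall x, d (Re \o ee xi) x = - (kap * z%:~R) * Im (ee xi x)) ->
    (forall x, d (Im \o ee xi) x = kap * z%:~R * Re (ee xi x)) ->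
    z != 0 -> cavg (ee xi) = 0.
  move=> Hd H1 H2 z0.
  have kz : kap * z%:~R != 0 by rewrite mulf_neq0 ?intr_eq0 // gt_eqF ?kap_gt0.
  apply: complex_ext => /=.
    have := Hd _ (smooth_Im_ee xi) pIm; rewrite (eq_avg (fun x _ => H2 x)).
    rewrite avgZ; last exact: bdd_intg.
    by move/eqP; rewrite mulf_eq0 (negbTE kz) => /eqP.
  have := Hd _ (smooth_Re_ee xi) pRe; rewrite (eq_avg (fun x _ => H1 x)).
  rewrite avgZ; last exact: bdd_intg.
  by move/eqP; rewrite mulf_eq0 oppr_eq0 (negbTE kz) => /eqP.
have [x1|x1] := eqVneq xi.1 0.
  apply: (H xi.2 (@d2 R)); first exact: avg_d2.
  - exact: d2_Re_ee.
  - exact: d2_Im_ee.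
  - by apply: contra xi0 => /eqP x2; case: xi {pRe pIm bRe bIm H} x1 x2 => a b /= -> ->.
apply: (H xi.1 (@d1 R)) => //; first exact: avg_d1.
- exact: d1_Re_ee.
- exact: d1_Im_ee.
Qed.

Definition hat f xi : R[i] := cavg (fun x => f x * ee (- xi) x).
Definition trig F (c : int * int -> R[i]) (x : R * R) : R[i] :=
  \sum_(xi <- F) c xi * ee xi x.

Lemma cbdd_trig F c : cbdd (trig F c).
Proof. by apply: cbdd_sum => xi; apply: cbddM; [exact: cbdd_cst|exact: cbdd_ee]. Qed.

Lemma conj_trig F c x :
  conjc (trig F c x) = \sum_(xi <- F) conjc (c xi) * ee (- xi) x.
Proof.
rewrite /trig rmorph_sum; apply: eq_bigr => xi _.
change (conjc (c xi * ee xi x) = conjc (c xi) * ee (- xi) x).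
by rewrite -conj_ee; apply: complex_ext; rewrite !ReIm; ring.
Qed.

Lemma hat_cintg f xi : csqi f -> cintg (fun x => f x * ee (- xi) x).
Proof. by move=> sf; apply: csqi_cintg; apply: csqiMr => //; apply: cbdd_ee. Qed.

Lemma hatD f g xi : csqi f -> csqi g -> hat (fun x => f x + g x) xi = hat f xi + hat g xi.
Proof.
move=> sf sg; rewrite /hat -cavgD; [|exact: hat_cintg|exact: hat_cintg].
by apply: eq_cavg => x _; rewrite mulrDl.
Qed.

Lemma hatZ c f xi : csqi f -> hat (fun x => c * f x) xi = c * hat f xi.
Proof.
move=> sf; rewrite /hat -cavgZ; last exact: hat_cintg.
by apply: eq_cavg => x _; rewrite mulrA.
Qed.

Lemma hatB f g xi : csqi f -> csqi g -> hat (fun x => f x - g x) xi = hat f xi - hat g xi.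
Proof.
move=> sf sg; rewrite -mulN1r -hatZ // -hatD //; last exact: csqiZ.
by apply: eq_cavg => x _; rewrite mulN1r.
Qed.

Lemma eq_hat f g xi : (forall x, cell L x -> f x = g x) -> hat f xi = hat g xi.
Proof. by move=> H; apply: eq_cavg => x /H ->. Qed.

Lemma hat_mul_trig (h : R * R -> R) F c xi : bdd L h ->
  hat (fun x => (h x)%:C%C * trig F c x) xi =
  \sum_(eta <- F) c eta * hat (fun x => (h x)%:C%C) (xi - eta).
Proof.
move=> bh.
have ch eta : cintg (fun x => (h x)%:C%C * ee (- (xi - eta)) x).
  by apply: hat_cintg; apply: cbdd_csqi; exact: cbdd_real.
rewrite /hat; under eq_bigr => eta _ do rewrite -(cavgZ _ (ch eta)).
rewrite -cavg_sum => [|eta]; last exact: cintgZ.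
apply: eq_cavg => x _; rewrite /trig mulr_sumr mulr_suml.
apply: eq_bigr => eta _; rewrite opprB addrC eeD; ring.
Qed.

Lemma hat1 xi : hat (fun=> 1) xi = (xi == 0)%:R.
Proof.
have := cavg_ee (- xi); rewrite oppr_eq0 => <-.
by apply: eq_cavg => x _; rewrite mul1r.
Qed.

Lemma hat_trig F c xi : uniq F -> hat (trig F c) xi = if xi \in F then c xi else 0.
Proof.
move=> uF; have := hat_mul_trig F c xi (bdd_cst L 1).
rewrite (@eq_hat _ (trig F c)) => [->|x _]; last by rewrite mul1r.
under eq_bigr => eta _ do rewrite hat1 subr_eq0 mulr_natr.
case: ifPn => xiF.
  rewrite (bigD1_seq xi) //= eqxx mulr1n big1 ?addr0 // => eta ne.
  by rewrite eq_sym (negbTE ne).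
rewrite big_seq big1 // => eta etaF; case: eqP => // E.
by move: xiF; rewrite E etaF.
Qed.

(** Only the conjugate factor of |T|^2 is expanded. Since the coefficients of rho T involve those of
    rho at differences of frequencies, the formula shows which frequencies a given weight
    couples. *)
Lemma weight_trig (rho : R * R -> R) F c : bdd L rho ->
  avg L (fun x => rho x * sqn (trig F c x)) =
  \sum_(xi <- F) Re (hat (fun x => (rho x)%:C%C * trig F c x) xi * conjc (c xi)).
Proof.
move=> br; rewrite -Re_sum.
have H xi : cintg (fun x => (rho x)%:C%C * trig F c x * ee (- xi) x).
  by apply: hat_cintg; apply: csqiM; [exact: cbdd_real|apply: cbdd_csqi; exact: cbdd_trig].
under eq_bigr => xi _ do rewrite mulrC -(cavgZ _ (H xi)).
rewrite -cavg_sum => [/=|xi]; last exact: cintgZ.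
apply: eq_avg => x _ /=.
have -> : \sum_(xi <- F) conjc (c xi) * ((rho x)%:C%C * trig F c x * ee (- xi) x) =
   (rho x)%:C%C * (trig F c x * conjc (trig F c x)).
  rewrite conj_trig; move: (trig F c x) => T; rewrite !mulr_sumr.
  apply: eq_bigr => xi _; ring.
by rewrite ReM /= mul0r subr0 -sqnE.
Qed.

Lemma avg_sqn_trig F c : uniq F -> avg L (sqn \o trig F c) = \sum_(xi <- F) sqn (c xi).
Proof.
move=> uF; transitivity (avg L (fun x => 1 * sqn (trig F c x))).
  by apply: eq_avg => x _ /=; rewrite mul1r.
rewrite weight_trig; last exact: bdd_cst.
rewrite [LHS]big_seq [RHS]big_seq; apply: eq_bigr => xi xiF.
by rewrite (@eq_hat _ (trig F c)) => [|x _]; rewrite ?mul1r // hat_trig // xiF -sqnE.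
Qed.

Lemma bessel f F : csqi f -> uniq F -> \sum_(xi <- F) sqn (hat f xi) <= avg L (sqn \o f).
Proof.
move=> sf uF; set c := hat f.
have sT : csqi (trig F c) by apply: cbdd_csqi; apply: cbdd_trig.
have sfT := csqi_cintgM sf (csqi_conj sT).
have H : 0 <= avg L (fun x => sqn (f x - trig F c x)).
  by apply: avg_ge0 => // x _; apply: sqn_ge0.
have E : avg L (fun x => sqn (f x - trig F c x)) =
    avg L (sqn \o f) + avg L (sqn \o trig F c) - 2 * Re (cavg (fun x => f x * conjc (trig F c x))).
  rewrite /= -avgD; [|exact: sqn_intg|exact: sqn_intg].
  rewrite -mulNr -avgZ; last by case: sfT.
  rewrite -avgD; last 2 first.
  - by apply: intgD; exact: sqn_intg.
  - by apply: intgZ; case: sfT.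
  by apply: eq_avg => x _ /=; rewrite /sqn !ReIm; ring.
have E2 : cavg (fun x => f x * conjc (trig F c x)) = \sum_(xi <- F) c xi * conjc (c xi).
  under eq_bigr => xi _ do rewrite mulrC -(cavgZ _ (hat_cintg xi sf)).
  rewrite -cavg_sum => [|xi]; last by apply: cintgZ; exact: hat_cintg.
  apply: eq_cavg => x _; rewrite conj_trig mulr_sumr.
  apply: eq_bigr => xi _; ring.
move: H; rewrite E E2 avg_sqn_trig // Re_sum.
under [X in _ - 2 * X]eq_bigr => xi _ do rewrite -sqnE.
by rewrite mulr_natl mulr2n opprD addrACA subrr addr0 subr_ge0.
Qed.

End fourier.

(** * Density of trigonometric polynomials *)

Section density.
Context {R : realType} (L : R) (L0 : 0 < L).
Local Notation T1 := (measurableTypeR R).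
Local Notation T2 := (measurableTypeR R * measurableTypeR R)%type.
Implicit Types (f g : R * R -> R[i]) (h p q : R * R -> R) (E : set (R * R)).

(** Repeated frequencies are allowed, so that sums and products are operations on lists;
    [trigp_trig] collects them. *)
Definition trigp f := exists s : seq ((int * int) * R[i]),
  f = fun x => \sum_(a <- s) a.2 * ee L a.1 x.

Lemma trigp_cst c : trigp (fun=> c).
Proof. by exists [:: (0, c)]; apply/funext => x; rewrite big_seq1 /= ee0 mulr1. Qed.

Lemma trigpD f g : trigp f -> trigp g -> trigp (fun x => f x + g x).
Proof. by move=> [s ->] [t ->]; exists (s ++ t); apply/funext => x; rewrite big_cat. Qed.

Lemma trigpM f g : trigp f -> trigp g -> trigp (fun x => f x * g x).
Proof.
move=> [s ->] [t ->]; exists [seq (a.1 + b.1, a.2 * b.2) | a <- s, b <- t].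
apply/funext => x; rewrite big_allpairs_dep /= big_distrlr /=.
by apply: eq_bigr => a _; apply: eq_bigr => b _; rewrite eeD; ring.
Qed.

Lemma trigp_ee xi : trigp (ee L xi).
Proof. by exists [:: (xi, 1)]; apply/funext => x; rewrite big_seq1 /= mul1r. Qed.

Lemma trigp_trig f : trigp f -> exists (F : seq (int * int)) c,
  uniq F /\ f = trig L F c.
Proof.
move=> [s ->]; exists (undup (map fst s)), (fun xi => \sum_(a <- s | a.1 == xi) a.2).
split; first exact: undup_uniq.
apply/funext => x; rewrite /trig; under [RHS]eq_bigr => xi _ do rewrite mulr_suml.
rewrite (exchange_big_dep xpredT) //= big_seq [RHS]big_seq; apply: eq_bigr => a ain.
rewrite -big_filter; have -> : [seq i <- undup [seq i.1 | i <- s] | a.1 == i] = [:: a.1].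
  rewrite (@eq_filter _ _ (pred1 a.1)) => [|b]; last by rewrite /= eq_sym.
  by rewrite filter_pred1_uniq ?undup_uniq // mem_undup map_f.
by rewrite big_seq1.
Qed.

Definition rtrigp p := trigp (fun x => (p x)%:C%C).

Lemma rtrigp_cst c : rtrigp (fun=> c). Proof. exact: trigp_cst. Qed.

Lemma rtrigpD p q : rtrigp p -> rtrigp q -> rtrigp (fun x => p x + q x).
Proof.
move=> tp tq; have := trigpD tp tq; congr trigp; apply/funext => x.
by apply: complex_ext; rewrite ReIm /= ?addr0.
Qed.

Lemma rtrigpM p q : rtrigp p -> rtrigp q -> rtrigp (fun x => p x * q x).
Proof.
move=> tp tq; have := trigpM tp tq; congr trigp; apply/funext => x.
by apply: complex_ext; rewrite ReIm /= ?mulr0 ?mul0r ?addr0 ?subr0.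
Qed.

Lemma rtrigpB p q : rtrigp p -> rtrigp q -> rtrigp (fun x => p x - q x).
Proof.
move=> tp tq; have := rtrigpD tp (rtrigpM (rtrigp_cst (-1)) tq).
by congr rtrigp; apply/funext => x; rewrite mulN1r.
Qed.

Lemma rtrigpX p n : rtrigp p -> rtrigp (fun x => p x ^+ n).
Proof.
move=> tf; elim: n => [|n IH]; first by under eq_fun do rewrite expr0; apply: rtrigp_cst.
by under eq_fun do rewrite exprS; apply: rtrigpM.
Qed.

Lemma rtrigp_cos xi (t : R) : rtrigp (fun x => cos (phase L xi x + t)).
Proof.
pose c : R[i] := (cos t +i* sin t)%C / 2; pose d : R[i] := (cos t -i* sin t)%C / 2.
have := trigpD (trigpM (trigp_cst c) (trigp_ee xi)) (trigpM (trigp_cst d) (trigp_ee (- xi))).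
congr trigp; apply/funext => x; rewrite -conj_ee.
have -> : c * ee L xi x + d * conjc (ee L xi x) =
   ((cos t +i* sin t)%C * ee L xi x + (cos t -i* sin t)%C * conjc (ee L xi x)) / 2.
  by rewrite /c /d; ring.
have -> : (cos (phase L xi x + t))%:C%C = (2 * (cos (phase L xi x + t))%:C%C) / 2 :> R[i].
  by rewrite mulrC mulKf // pnatr_eq0.
congr (_ / _); apply: complex_ext; rewrite /ee cosD !ReIm /=; ring.
Qed.

Lemma rtrigp_bdd p : rtrigp p -> bdd L p.
Proof.
move=> /trigp_trig[F [c [uF E]]]; have [+ _] := cbdd_trig L F c.
by rewrite -E.
Qed.

(* 1 - (1 - t^n)^(2^n) converges on [0, 1] to the indicator of t > 1/2. *)
Definition step_poly n (t : R) : R := 1 - (1 - t ^+ n) ^+ (2 ^ n).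

Lemma step_poly01 n t : 0 <= t <= 1 -> 0 <= step_poly n t <= 1.
Proof.
move=> /andP[t0 t1].
have a0 : 0 <= 1 - t ^+ n by rewrite subr_ge0 exprn_ile1.
have a1 : 1 - t ^+ n <= 1 by rewrite lerBlDr lerDl exprn_ge0.
by rewrite /step_poly subr_ge0 exprn_ile1 //= lerBlDr lerDl exprn_ge0.
Qed.

Lemma bernoulli (y : R) m : 0 <= y <= 1 -> 1 - m%:R * y <= (1 - y) ^+ m.
Proof.
move=> /andP[y0 y1]; elim: m => [|m IH]; first by rewrite mul0r subr0 expr0.
rewrite exprS -natr1.
have : (1 - y) * (1 - m%:R * y) <= (1 - y) * (1 - y) ^+ m by rewrite ler_wpM2l // subr_ge0.
apply: le_trans; have : 0 <= m%:R * (y * y) by rewrite !mulr_ge0.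
by move: (m%:R : R) => k; lra.
Qed.

Lemma bernoulli2 (y : R) m : 0 <= y <= 1 -> (1 - y) ^+ m * (1 + m%:R * y) <= 1.
Proof.
move=> /andP[y0 y1]; elim: m => [|m IH]; first by rewrite mul0r addr0 expr0 mulr1.
apply: le_trans IH; rewrite exprS mulrAC mulrC; apply: ler_wpM2l.
  by rewrite exprn_ge0 // subr_ge0.
rewrite -natr1; have : 0 <= m%:R * (y * y) by rewrite !mulr_ge0.
have := mulr_ge0 y0 y0; by move: (m%:R : R) => k; lra.
Qed.

Lemma step_poly_lt n t : 0 <= t <= 1 -> step_poly n t <= (2 * t) ^+ n.
Proof.
move=> /andP[t0 t1]; rewrite /step_poly lerBlDr addrC -lerBlDr.
have := @bernoulli (t ^+ n) (2 ^ n)%N.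
by rewrite exprn_ge0 //= exprn_ile1 // natrX -exprMn; apply.
Qed.

Lemma step_poly_gt n t : 0 < t <= 1 -> 1 - step_poly n t <= ((2 * t) ^+ n)^-1.
Proof.
move=> /andP[t0 t1]; rewrite /step_poly subKr.
have tn : 0 <= t ^+ n <= 1 by rewrite exprn_ge0 ?exprn_ile1 // ltW.
have := @bernoulli2 (t ^+ n) (2 ^ n)%N tn; rewrite natrX -exprMn => H.
have P : 0 < (2 * t) ^+ n by rewrite exprn_gt0 // mulr_gt0.
rewrite -[leRHS]mul1r ler_pdivlMr //; apply: le_trans H; apply: ler_wpM2l.
  by rewrite exprn_ge0 // subr_ge0 exprn_ile1 // ltW.
by rewrite lerDr.
Qed.

Lemma step_poly_cvg (t : R) : 0 <= t <= 1 -> t != 2^-1 ->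
  step_poly n t @[n --> \oo] --> (if 2^-1 < t then 1 else 0 : R).
Proof.
move=> t01 tne; have [t0 t1] := andP t01; case: ltP => th.
  have L1 : ((2 * t) ^+ n)^-1 @[n --> \oo] --> (0 : R).
    under eq_fun do rewrite -exprVn.
    apply: cvg_expr; rewrite ger0_norm ?invr_ge0 ?mulr_ge0 // invf_lt1 ?mulr_gt0 //; lra.
  have : 1 - step_poly n t @[n --> \oo] --> (0 : R).
    apply: (@squeeze_cvgr _ _ _ _ (fun=> 0) (fun n => ((2 * t) ^+ n)^-1)) => //.
      near=> n; rewrite subr_ge0; case/andP: (step_poly01 n t01) => _ -> /=.
      by apply: step_poly_gt; apply/andP; split=> //; lra.
    exact: cvg_cst.
  move=> H; have : 1 - (1 - step_poly n t) @[n --> \oo] --> (1 - 0 : R).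
    by apply: cvgB => //; exact: cvg_cst.
  have -> : (fun n => 1 - (1 - step_poly n t)) = (fun n => step_poly n t).
    by apply/funext => n; rewrite subKr.
  by rewrite subr0.
apply: (@squeeze_cvgr _ _ _ _ (fun=> 0) (fun n => (2 * t) ^+ n)).
- by near=> n; case/andP: (step_poly01 n t01) => -> _ /=; apply: step_poly_lt.
- exact: cvg_cst.
- by apply: cvg_expr; rewrite ger0_norm ?mulr_ge0 //; lra.
Unshelve. all: by end_near. Qed.

Lemma rtrigp_step p n : rtrigp p -> rtrigp (fun x => step_poly n (p x)).
Proof.
move=> tp; apply: rtrigpB; first exact: rtrigp_cst.
by apply: rtrigpX; apply: rtrigpB; [exact: rtrigp_cst|exact: rtrigpX].
Qed.

End density.

(** * Sets whose indicators are limits of trigonometric polynomials *)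

Section density2.
Context {R : realType} (L : R) (L0 : 0 < L).
Local Notation T1 := (measurableTypeR R).
Local Notation T2 := (measurableTypeR R * measurableTypeR R)%type.
Implicit Types (f : R * R -> R[i]) (h p q : R * R -> R) (E : set (R * R)).

Lemma avg_dominated (u : nat -> R * R -> R) (g : R * R -> R) :
  (forall n, measurable_fun (cell L) (u n : T2 -> R)) -> intg L g ->
  (forall n x, cell L x -> `|u n x| <= g x) ->
  {ae leb2, forall x : T2, cell L x -> u n x @[n --> \oo] --> (0 : R)} ->
  forall eps, 0 < eps -> exists n, avg L (fun x => `|u n x|) <= eps.
Proof.
move=> mu_ Ig dom ae eps eps0.
have m0 : measurable_fun (cell L : set T2) (cst 0%E : T2 -> \bar R) by exact: measurable_cst.
have mE n : measurable_fun (cell L : set T2) (EFin \o (u n : T2 -> R)).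
  by apply/measurable_EFinP; exact: mu_.
have aeE : {ae leb2, forall x : T2, cell L x -> (u n x)%:E @[n --> \oo] --> (0%E : \bar R)}.
  case: ae => N [mN N0 HN]; exists N; split => // x /= Hx; apply: HN => /= Hx2; apply: Hx.
  by move=> cx; apply: cvg_EFin; [exact: nearW|exact: Hx2].
have aeD : {ae leb2, forall x : T2, forall n, cell L x -> (`|(u n x)%:E| <= (g x)%:E)%E}.
  by apply: aeW => x n cx; rewrite lee_fin dom.
have [_ H _] := dominated_convergence (measurable_cell L) mE m0 aeE Ig aeD.
have E0 : 0 < eps * L ^+ 2 by rewrite mulr_gt0 // exprn_gt0.
have /fine_cvgP[Hfin Hc] := H.
have /cvgrPdist_le /(_ _ E0) Hn := Hc.
have [n _ Hn2] := Hn.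
exists n; have := Hn2 n (leqnn n); rewrite /= sub0r normrN => Hle.
rewrite /avg mulrC ler_pdivrMr ?exprn_gt0 //; apply: le_trans Hle.
rewrite /Rintegral; apply: le_trans (ler_norm _).
rewrite le_eqVlt; apply/orP; left; apply/eqP; congr fine.
by apply: eq_integral => x _ /=; rewrite subr0.
Qed.

(** Density is obtained by a measure-theoretic route: these sets are closed under complements,
    intersections and countable unions, and contain the half-strips, hence every measurable set.
    Values in [0, 1] make products stable and later turn L^1 closeness into L^2 closeness. *)
Definition appr E := forall eps, 0 < eps -> exists p,
  [/\ rtrigp L p, (forall x, 0 <= p x <= 1) & avg L (fun x => `|p x - \1_E x|) <= eps].

Lemma indic01 E x : 0 <= (\1_E x : R) <= 1.
Proof. by rewrite indicE; case: (_ \in _); rewrite /= ?lexx ler01. Qed.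

Lemma indic_bdd E : measurable (E : set T2) -> bdd L (\1_E : R * R -> R).
Proof.
move=> mE; split; first by apply: measurable_funTS; exact: measurable_indic.
by exists 1 => x _; rewrite ger0_norm; case/andP: (indic01 E x).
Qed.

Lemma bdd_norm h : bdd L h -> bdd L (fun x => `|h x|).
Proof.
move=> [mh [M HM]]; split; first by apply: measurableT_comp => //; exact: measurable_normr.
by exists M => x cx; rewrite normr_id; apply: HM.
Qed.

Lemma dist_indic_intg p E : rtrigp L p -> measurable (E : set T2) ->
  intg L (fun x => `|p x - \1_E x|).
Proof.
move=> tp mE; apply: (bdd_intg L0); apply: bdd_norm; apply: bddB; first exact: rtrigp_bdd.
exact: indic_bdd.
Qed.

Lemma appr0 : appr set0.
Proof.
move=> eps eps0; exists (fun=> 0); split; first exact: rtrigp_cst.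
  by move=> x; rewrite lexx ler01.
rewrite (@eq_avg _ _ _ (fun=> 0)); first by rewrite avg_cst // ltW.
by move=> x _; rewrite indicE in_set0 subr0 normr0.
Qed.

Lemma apprC E : appr E -> appr (~` E).
Proof.
move=> H eps eps0; have [p [tp p01 Hp]] := H _ eps0.
exists (fun x => 1 - p x); split.
- by apply: rtrigpB => //; exact: rtrigp_cst.
- by move=> x; have /andP[? ?] := p01 x; apply/andP; split; lra.
- rewrite (@eq_avg _ _ _ (fun x => `|p x - \1_E x|)) // => x _.
  rewrite !indicE in_setC; case: (_ \in _); rewrite /= distrC; congr `|_|; ring.
Qed.

Lemma apprI E G : measurable (E : set T2) -> measurable (G : set T2) ->
  appr E -> appr G -> appr (E `&` G).
Proof.
move=> mE mG HE HG eps eps0; have e2 : 0 < eps / 2 by rewrite divr_gt0.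
have [p [tp p01 Hp]] := HE _ e2; have [q [tq q01 Hq]] := HG _ e2.
have Ip := dist_indic_intg tp mE; have Iq := dist_indic_intg tq mG.
exists (fun x => p x * q x); split; first exact: rtrigpM.
  move=> x; have /andP[? ?] := p01 x; have /andP[? ?] := q01 x.
  by rewrite mulr_ge0 //= mulr_ile1.
apply: (@le_trans _ _ (avg L (fun x => `|p x - \1_E x| + `|q x - \1_G x|))).
  apply: avg_le => //; [apply: dist_indic_intg; [exact: rtrigpM|exact: measurableI]|exact: intgD|].
  move=> x _; rewrite indicI /=.
  have -> : p x * q x - \1_E x * \1_G x = (p x - \1_E x) * q x + \1_E x * (q x - \1_G x) by ring.
  apply: le_trans (ler_normD _ _) _; rewrite !normrM.
  have /andP[q0 q1] := q01 x; have /andP[i0 i1] := indic01 E x.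
  by apply: lerD; [rewrite ler_piMr // ger0_norm|rewrite ler_piMl // ger0_norm].
by rewrite avgD // (splitr eps) lerD.
Qed.

Lemma appr_bigcup (E : nat -> set (R * R)) :
  (forall n, measurable (E n : set T2)) -> (forall n, appr (E n)) -> appr (\bigcup_n E n).
Proof.
move=> mE HE.
pose A n := \big[setU/set0]_(i < n) E i.
have mA n : measurable (A n : set T2) by apply: bigsetU_measurable.
have HA n : appr (A n).
  elim: n => [|n IH]; first by rewrite /A big_ord0; exact: appr0.
  rewrite /A big_ord_recr /= -[_ `|` _]setCK; apply: apprC; rewrite setCU.
  by apply: apprI; [exact: (measurableC (mA n))|exact: (measurableC (mE n))|exact: apprC|exact: apprC].
have mB : measurable (\bigcup_n E n : set T2) by apply: bigcupT_measurable.
move=> eps eps0; have e2 : 0 < eps / 2 by rewrite divr_gt0.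
have [n Hn] : exists n, avg L (fun x => `|\1_(A n) x - \1_(\bigcup_n E n) x : R|) <= eps / 2.
  apply: (@avg_dominated _ (fun=> 1)) => //.
  - by move=> n; have [] := bddB (indic_bdd (mA n)) (indic_bdd mB).
  - exact/bdd_intg/bdd_cst.
  - move=> n x _; have /andP[? ?] := indic01 (A n) x.
    have /andP[? ?] := indic01 (\bigcup_n E n) x.
    by rewrite ler_norml; apply/andP; split; lra.
  - apply: aeW => x _; case: (pselect ((\bigcup_n E n) x)) => [[m _ Em]|nE].
      apply: cvg_near_cst; exists m.+1 => // n /= mn.
      have Ax : A n x by rewrite /A -bigcup_mkord; exists m.
      have Bx : (\bigcup_n E n) x by exists m.
      by rewrite !indicE (mem_set Ax) (mem_set Bx) subrr.
    apply: cvg_near_cst; apply: nearW => n.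
    have nA : ~ A n x by rewrite /A -bigcup_mkord => -[m _ Em]; apply: nE; exists m.
    by rewrite !indicE (memNset nA) (memNset nE) subrr.
have [p [tp p01 Hp]] := HA n _ e2.
exists p; split => //; rewrite (splitr eps); apply: le_trans (lerD Hp Hn).
have I1 := dist_indic_intg tp (mA n).
have I2 : intg L (fun x => `|\1_(A n) x - \1_(\bigcup_n E n) x : R|).
  by apply: (bdd_intg L0); apply: bdd_norm; apply: bddB; apply: indic_bdd.
rewrite -avgD //; apply: avg_le => //; [exact: dist_indic_intg|exact: intgD|].
by move=> x _; rewrite -[p x - _](subrKA (\1_(A n) x)); apply: ler_normD.
Qed.

Lemma leb2_null_fst (c : R) : leb2 [set x : T2 | x.1 = c] = 0%E.
Proof.
have -> : [set x : T2 | x.1 = c] = [set c] `*` setT.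
  by apply/seteqP; split => [x /= ->|x /= []].
etransitivity.
  exact: (product_measure1E lebesgue_measure lebesgue_measure (measurable_set1 c) measurableT).
transitivity (0 * lebesgue_measure [set: R])%E; last by rewrite mul0e.
by congr (_ * _)%E; exact: lebesgue_measure_set1.
Qed.

Lemma leb2_null_snd (c : R) : leb2 [set x : T2 | x.2 = c] = 0%E.
Proof.
have -> : [set x : T2 | x.2 = c] = setT `*` [set c].
  by apply/seteqP; split => [x /= ->|x /= []].
etransitivity.
  exact: (product_measure1E lebesgue_measure lebesgue_measure measurableT (measurable_set1 c)).
transitivity (lebesgue_measure [set: R] * 0)%E; last by rewrite mule0.
by congr (_ * _)%E; exact: lebesgue_measure_set1.
Qed.

(* The trigonometric polynomial 2 sin(pi (y - a) / L) sin(pi y / L) has the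
   sign of y - a on ]0, L[. *)
Lemma ray_sign (a y : R) : 0 <= a < L -> 0 < y < L -> y != a ->
  let t := 2^-1 + (cos (pi * a / L) - cos (2 * pi / L * y - pi * a / L)) / 4 in
  [/\ 0 <= t <= 1, t != 2^-1 & (2^-1 < t) = (a < y)].
Proof.
move=> /andP[a0 aL] /andP[y0 yL] ya t.
have Et : cos (pi * a / L) - cos (2 * pi / L * y - pi * a / L) =
    2 * (sin (pi * (y - a) / L) * sin (pi * y / L)).
  have -> : 2 * pi / L * y - pi * a / L = pi * y / L + pi * (y - a) / L by field; rewrite gt_eqF.
  have -> : pi * a / L = pi * y / L - pi * (y - a) / L by field; rewrite gt_eqF.
  rewrite cosB cosD; ring.
have sy : 0 < sin (pi * y / L).
  apply: sin_gt0_pi; rewrite divr_gt0 ?mulr_gt0 ?pi_gt0 //=.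
  by rewrite ltr_pdivrMr // ltr_pM2l // pi_gt0.
have b1 := cos_le1 (pi * a / L); have b2 := cos_geN1 (pi * a / L).
have b3 := cos_le1 (2 * pi / L * y - pi * a / L).
have b4 := cos_geN1 (2 * pi / L * y - pi * a / L).
have t01 : 0 <= t <= 1 by rewrite /t; apply/andP; split; lra.
have [lt|gt] : a < y \/ y < a by apply/orP; rewrite -neq_lt eq_sym.
  have sa : 0 < sin (pi * (y - a) / L).
    apply: sin_gt0_pi; rewrite divr_gt0 ?mulr_gt0 ?pi_gt0 ?subr_gt0 //=.
    rewrite ltr_pdivrMr // ltr_pM2l ?pi_gt0 //; lra.
  have P : 0 < sin (pi * (y - a) / L) * sin (pi * y / L) by rewrite mulr_gt0.
  have tg : 2^-1 < t by rewrite /t Et; lra.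
  by split => //; [rewrite gt_eqF|rewrite tg lt].
have sa : 0 < sin (pi * (a - y) / L).
  apply: sin_gt0_pi; rewrite divr_gt0 ?mulr_gt0 ?pi_gt0 ?subr_gt0 //=.
  rewrite ltr_pdivrMr // ltr_pM2l ?pi_gt0 //; lra.
have P : 0 < sin (pi * (a - y) / L) * sin (pi * y / L) by rewrite mulr_gt0.
have E2 : sin (pi * (y - a) / L) = - sin (pi * (a - y) / L).
  by rewrite -sinN; congr sin; ring.
have tg : t < 2^-1 by rewrite /t Et E2; lra.
by split => //; [rewrite lt_eqF|rewrite !ltNge ltW // (ltW gt)].
Qed.

End density2.

Import HBNNSimple.

(** * From half-strips to all square integrable functions *)

Section density3.
Context {R : realType} (L : R) (L0 : 0 < L).
Local Notation T1 := (measurableTypeR R).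
Local Notation T2 := (measurableTypeR R * measurableTypeR R)%type.
Implicit Types (f : R * R -> R[i]) (h p q : R * R -> R) (E : set (R * R)).

Lemma appr_step E p : rtrigp L p -> measurable (E : set T2) ->
  (forall x, 0 <= p x <= 1) ->
  {ae leb2, forall x : T2, cell L x -> p x != 2^-1 /\ (E x <-> 2^-1 < p x)} ->
  appr L E.
Proof.
move=> tp mE p01 ae eps eps0.
have [n Hn] : exists n, avg L (fun x => `|step_poly n (p x) - \1_E x|) <= eps.
  apply: (@avg_dominated _ _ L0 _ (fun=> 1)) => //.
  - move=> n; have [H _] := bddB (rtrigp_bdd (rtrigp_step n tp)) (indic_bdd L mE).
    exact: H.
  - exact/(bdd_intg L0)/bdd_cst.
  - move=> n x _; have /andP[? ?] := step_poly01 n (p01 x).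
    have /andP[? ?] := indic01 E x; by rewrite ler_norml; apply/andP; split; lra.
  - case: ae => N [mN N0 HN]; exists N; split => // x /= Hx; apply: HN => /= Hx2; apply: Hx.
    move=> cx; have [ne iff] := Hx2 cx.
    have := step_poly_cvg (p01 x) ne.
    have -> : (if 2^-1 < p x then 1 else 0) = \1_E x :> R.
      rewrite indicE; case: ifPn => [/iff Ex|nE]; first by rewrite mem_set.
      by rewrite memNset // => /iff; rewrite (negbTE nE).
    move=> H; rewrite -[X in _ --> X](subrr (\1_E x)).
    by apply: cvgB => //; exact: cvg_cst.
exists (fun x => step_poly n (p x)); split => //; first exact: rtrigp_step.
by move=> x; apply: step_poly01.
Qed.

Lemma rtrigp_ray xi (a : R) : rtrigp L (fun x : R * R =>
  2^-1 + (cos (pi * a / L) - cos (phase L xi x - pi * a / L)) / 4).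
Proof.
apply: rtrigpD; first exact: rtrigp_cst.
apply: rtrigpM; last exact: rtrigp_cst.
by apply: rtrigpB; [exact: rtrigp_cst|exact: rtrigp_cos].
Qed.

Lemma appr_ext E (G : set (R * R)) : (forall x, cell L x -> E x <-> G x) -> appr L E -> appr L G.
Proof.
move=> EG H eps eps0; have [p [tp p01 Hp]] := H _ eps0; exists p; split => //.
rewrite (@eq_avg _ _ _ (fun x => `|p x - \1_E x|)) // => x cx.
rewrite !indicE; suff -> : (x \in E) = (x \in G) by [].
by apply/idP/idP; rewrite !inE => /EG; apply.
Qed.

(** Here [pr] stands for either coordinate and [xi] for the unit frequency in that direction; the
    set is the half-strip of the points whose coordinate exceeds [a]. *)
Lemma appr_ray (pr : T2 -> T1) xi (a : R) : measurable_fun setT pr ->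
  (forall x, cell L x -> 0 <= pr x < L) ->
  (forall c, leb2 [set x : T2 | pr x = c] = 0%E) ->
  (forall x, phase L xi x = 2 * pi / L * pr x) ->
  appr L (pr @^-1` `]a, +oo[%classic).
Proof.
move=> mpr cpr npr phx.
have mE : measurable (pr @^-1` `]a, +oo[%classic).
  by rewrite -[X in measurable X]setTI; apply: mpr => //; apply: measurable_itv.
have inr x : (pr @^-1` `]a, +oo[%classic) x <-> a < pr x by rewrite /= in_itv /= andbT.
have [a0|a0] := ltP a 0.
  apply: (@appr_ext (~` set0)); last by apply: apprC; exact: appr0.
  move=> x /cpr /andP[p0 _]; split => [_|_ []].
  by apply/inr; exact: lt_le_trans p0.
have [aL|aL] := leP L a.
  apply: (@appr_ext set0); last exact: appr0.
  move=> x /cpr /andP[_ pL]; split => // /inr ax.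
  by have := le_lt_trans aL (lt_trans ax pL); rewrite ltxx.
have a0L : 0 <= a < L by rewrite a0.
apply: appr_step (rtrigp_ray xi a) mE _ _.
  move=> x.
  have b1 := cos_le1 (pi * a / L); have b2 := cos_geN1 (pi * a / L).
  have b3 := cos_le1 (phase L xi x - pi * a / L).
  have b4 := cos_geN1 (phase L xi x - pi * a / L).
  by apply/andP; split; lra.
have mset c : measurable ([set x : T2 | pr x = c]).
  rewrite [X in measurable X](_ : _ = setT `&` pr @^-1` [set c]); last by rewrite setTI.
  by apply: mpr => //; exact: measurable_set1.
(* On these two null lines the polynomial of [rtrigp_ray] equals 1/2, where the step polynomials
   converge neither to 0 nor to 1. *)
exists ([set x : T2 | pr x = 0] `|` [set x : T2 | pr x = a]); split.
- by apply: measurableU; exact: mset.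
- by etransitivity; [exact: (measureU0 (mset 0) (mset a) (npr a))|exact: npr].
move=> x /= Hx; apply: contrapT => /not_orP[n0 na]; apply: Hx => cx.
have /andP[p0 pL] := cpr x cx.
have pp : 0 < pr x < L by rewrite pL andbT lt_def p0 andbT; apply/eqP.
have pa : pr x != a by apply/eqP.
have [_ ne E] := ray_sign L0 a0L pp pa.
by rewrite phx; split => //; rewrite E; exact: inr.
Qed.

Lemma appr_preimage (pr : T2 -> T1) xi (B : set T1) : measurable_fun setT pr ->
  (forall x, cell L x -> 0 <= pr x < L) ->
  (forall c, leb2 [set x : T2 | pr x = c] = 0%E) ->
  (forall x, phase L xi x = 2 * pi / L * pr x) ->
  measurable B -> appr L (pr @^-1` B).
Proof.
move=> mpr cpr npr phx mB.
have mpre (C : set T1) : measurable C -> measurable (pr @^-1` C).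
  by move=> mC; rewrite -[X in measurable X]setTI; apply: mpr.
have mB' := mB; rewrite [measurable](RGenOInfty.measurableE R) in mB'.
pose G := [set C : set T1 | measurable C /\ appr L (pr @^-1` C)].
suff GG : <<s (@RGenOInfty.G R) >> `<=` G by case: (GG B mB').
apply: smallest_sub.
  split => [|C [mC HC]|C HC].
  - by split; [exact: measurable0|rewrite preimage_set0; exact: appr0].
  - by rewrite setTD; split; [exact: measurableC|rewrite preimage_setC; exact: apprC].
  - split; first by apply: bigcupT_measurable => n; case: (HC n).
    rewrite preimage_bigcup; apply: appr_bigcup => // n; case: (HC n) => // mC _.
    exact: mpre.
move=> _ [a ->]; split; first exact: measurable_itv.
exact: appr_ray phx.
Qed.

Lemma appr_measurable E : measurable (E : set T2) -> appr L E.
Proof.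
move=> mE.
have H1 (B : set T1) : measurable B -> appr L (fst @^-1` B).
  apply: (@appr_preimage fst (1, 0)); first exact: measurable_fst.
  - by move=> x [/= + _]; rewrite in_itv.
  - exact: leb2_null_fst.
  - by move=> x; rewrite /phase /= mul1r mul0r addr0.
have H2 (B : set T1) : measurable B -> appr L (snd @^-1` B).
  apply: (@appr_preimage snd (0, 1)); first exact: measurable_snd.
  - by move=> x [/= _]; rewrite in_itv.
  - exact: leb2_null_snd.
  - by move=> x; rewrite /phase /= mul1r mul0r add0r.
have mE' := mE; rewrite measurable_prod_measurableType in mE'.
pose G := [set C : set T2 | measurable C /\ appr L C].
suff GG : <<s [set A `*` B | A in (measurable : set (set T1)) & B in (measurable : set (set T1))] >> `<=` G.
  by case: (GG E mE').
apply: smallest_sub.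
    split => [|C [mC HC]|C HC].
    - by split; [exact: measurable0|exact: appr0].
    - by rewrite setTD; split; [exact: measurableC|exact: apprC].
    - split; first by apply: bigcupT_measurable => n; case: (HC n).
      by apply: appr_bigcup => // n; case: (HC n).
move=> _ [A mA [B mB <-]]; split; first exact: measurableX.
rewrite [_ `*` _](_ : _ = fst @^-1` A `&` snd @^-1` B) //.
apply: apprI => //; [| |exact: H1|exact: H2].
- by rewrite -[X in measurable X]setTI; apply: (@measurable_fst _ _ T1 T1).
- by rewrite -[X in measurable X]setTI; apply: (@measurable_snd _ _ T1 T1).
Qed.

Definition L2trig h := sqi L h /\
  forall eps, 0 < eps -> exists2 p, rtrigp L p & avg L (fun x => (h x - p x) ^+ 2) <= eps.

Lemma L2trig_indic E : measurable (E : set T2) -> L2trig \1_E.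
Proof.
move=> mE; split; first by apply: (bdd_sqi L0); exact: indic_bdd.
move=> eps eps0; have [p [tp p01 Hp]] := appr_measurable mE eps0.
exists p => //; apply: le_trans Hp; apply: avg_le => //.
- by have [_ H] := bdd_sqi L0 (bddB (indic_bdd L mE) (rtrigp_bdd tp)).
- exact: dist_indic_intg.
- move=> x _; rewrite distrC -(real_normK (num_real _)) expr2 ler_piMr //.
  have /andP[? ?] := indic01 E x; have /andP[? ?] := p01 x.
  by rewrite ler_norml; apply/andP; split; lra.
Qed.

Lemma sqrD_le (a b : R) : (a + b) ^+ 2 <= 2 * a ^+ 2 + 2 * b ^+ 2.
Proof. by have := sqr_ge0 (a - b); lra. Qed.

Lemma L2trigD h g : L2trig h -> L2trig g -> L2trig (fun x => h x + g x).
Proof.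
move=> [sh Hh] [sg Hg]; split; first exact: sqiD.
move=> eps eps0; have e4 : 0 < eps / 4 by rewrite divr_gt0.
have [p tp Hp] := Hh _ e4; have [q tq Hq] := Hg _ e4.
have sp := bdd_sqi L0 (rtrigp_bdd tp); have sq := bdd_sqi L0 (rtrigp_bdd tq).
have [_ I1] := sqiB sh sp; have [_ I2] := sqiB sg sq.
exists (fun x => p x + q x); first exact: rtrigpD.
apply: (@le_trans _ _ (avg L (fun x => 2 * (h x - p x) ^+ 2 + 2 * (g x - q x) ^+ 2))).
  apply: avg_le => //.
  - by have [_] := sqiB (sqiD sh sg) (sqiD sp sq).
  - by apply: intgD; apply: intgZ.
  - move=> x _; rewrite (_ : h x + g x - (p x + q x) = (h x - p x) + (g x - q x)) ?sqrD_le //.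
    by ring.
rewrite avgD; [|exact: intgZ|exact: intgZ].
by rewrite !avgZ //; lra.
Qed.

Lemma L2trigZ (c : R) h : L2trig h -> L2trig (fun x => c * h x).
Proof.
move=> [sh Hh]; split; first exact: sqiZ.
move=> eps eps0; have e4 : 0 < eps / (1 + c ^+ 2) by rewrite divr_gt0 // ltr_wpDr ?sqr_ge0.
have [p tp Hp] := Hh _ e4; have sp := bdd_sqi L0 (rtrigp_bdd tp).
have [_ I1] := sqiB sh sp.
exists (fun x => c * p x); first by apply: rtrigpM => //; exact: rtrigp_cst.
rewrite (@eq_avg _ _ _ (fun x => c ^+ 2 * (h x - p x) ^+ 2)) => [|x _]; last by ring.
rewrite avgZ //.
have c1 : 0 < 1 + c ^+ 2 by rewrite ltr_wpDr ?sqr_ge0.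
apply: (@le_trans _ _ ((1 + c ^+ 2) * (eps / (1 + c ^+ 2)))).
  by apply: ler_pM; rewrite ?sqr_ge0 // ?lerDr //; apply: avg_ge0 => // x _; apply: sqr_ge0.
by rewrite mulrC divfK // gt_eqF.
Qed.

Lemma L2trig_closed h : sqi L h ->
  (forall eps, 0 < eps -> exists2 g, L2trig g & avg L (fun x => (h x - g x) ^+ 2) <= eps) ->
  L2trig h.
Proof.
move=> sh H; split => // eps eps0; have e4 : 0 < eps / 4 by rewrite divr_gt0.
have [g [sg Hg] Hhg] := H _ e4; have [p tp Hp] := Hg _ e4.
have sp := bdd_sqi L0 (rtrigp_bdd tp).
have [_ I1] := sqiB sg sp; have [_ I2] := sqiB sh sg.
exists p => //.
apply: (@le_trans _ _ (avg L (fun x => 2 * (h x - g x) ^+ 2 + 2 * (g x - p x) ^+ 2))).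
  apply: avg_le => //.
  - by have [_] := sqiB sh sp.
  - by apply: intgD; apply: intgZ.
  - by move=> x _; rewrite -(subrKA (g x)) sqrD_le.
rewrite avgD; [|exact: intgZ|exact: intgZ].
by rewrite !avgZ //; lra.
Qed.

Lemma L2trig_sum (I : Type) (s : seq I) (G : I -> R * R -> R) :
  (forall i, L2trig (G i)) -> L2trig (fun x => \sum_(i <- s) G i x).
Proof.
move=> H; elim: s => [|i s IH].
  under eq_fun do rewrite big_nil.
  have := L2trig_indic measurable0; congr L2trig.
  by apply/funext => x; rewrite indicE in_set0.
by under eq_fun do rewrite big_cons; apply: L2trigD.
Qed.

Lemma L2trig_nnsfun (g : {nnsfun T2 >-> R}) : L2trig (g : T2 -> R).
Proof.
have -> : (g : T2 -> R) = fun x => \sum_(i < size (finmap.enum_fset (fset_set (range g))))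
     (finmap.enum_fset (fset_set (range g)))`_i *
       \1_(g @^-1` [set (finmap.enum_fset (fset_set (range g)))`_i]) x.
  by apply/funext => x; rewrite -fimfunEord.
apply: L2trig_sum => i; apply: L2trigZ; apply: L2trig_indic.
exact: measurable_funPTI.
Qed.

Lemma L2trig_ge0 h : sqi L h -> (forall x, cell L x -> 0 <= h x) -> L2trig h.
Proof.
move=> sh h0; apply: L2trig_closed => // eps eps0; have [mh Ih] := sh.
have mE : measurable_fun (cell L : set T2) (EFin \o (h : T2 -> R)) by apply/measurable_EFinP.
have h0E (x : T2) : cell L x -> (0%:E <= (EFin \o h) x)%E by move=> /h0; rewrite lee_fin.
have [g [nd cg]] := approximation (measurable_cell L) mE h0E.
have gh n x : cell L x -> 0 <= g n x <= h x.
  move=> cx; rewrite fun_ge0 /=; have := cg x cx => /fine_cvgP[_ Hc].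
  rewrite -(cvg_lim (@Rhausdorff R) Hc).
  apply: limr_ge; first by apply/cvg_ex; exists (h x).
  by exists n => // m /= nm; have /lefP := nd _ _ nm; apply.
have sg n := (L2trig_nnsfun (g n)).
have [n Hn] : exists n, avg L (fun x => `|(h x - g n x) ^+ 2|) <= eps.
  apply: (@avg_dominated _ _ L0 _ (fun x => h x ^+ 2)) => //.
  - move=> n; apply: measurable_funX; apply: measurable_funB => //.
    by case: (sg n) => -[].
  - move=> n x cx; have /andP[g0 gx] := gh n x cx.
    by rewrite ger0_norm ?sqr_ge0 // ler_sqr ?nnegrE ?subr_ge0 ?(le_trans g0 gx) // gerBl.
  - apply: aeW => x cx; have := cg x cx => /fine_cvgP[_ Hc].
    have : h x - g n x @[n --> \oo] --> (0 : R).
      by rewrite -[X in _ --> X](subrr (h x)); apply: cvgB => //; exact: cvg_cst.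
    move=> H; rewrite -[X in _ --> X](mulr0 (0 : R)).
    by under eq_fun do rewrite expr2; apply: cvgM.
exists (g n) => //; apply: le_trans Hn; rewrite le_eqVlt; apply/orP; left; apply/eqP.
by apply: eq_avg => x _; rewrite ger0_norm ?sqr_ge0.
Qed.

Lemma L2trig_sqi h : sqi L h -> L2trig h.
Proof.
move=> sh; have [mh Ih] := sh.
have mabs : measurable_fun (cell L : set T2) (fun x : T2 => `|h x|).
  by apply: measurableT_comp => //; exact: measurable_normr.
have sabs : sqi L (fun x => `|h x|).
  split => //; move: Ih; congr intg; apply/funext => x; by rewrite real_normK ?num_real.
have s1 := L2trig_ge0 sabs (fun x _ => normr_ge0 (h x)).
(* [h] is the difference of the nonnegative functions h + |h| and |h|. *)
have s2 : L2trig (fun x => h x + `|h x|).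
  apply: L2trig_ge0; first exact: sqiD.
  by move=> x _; have := ler_norm (- h x); rewrite normrN; lra.
have := L2trigD s2 (L2trigZ (-1) s1); congr L2trig.
by apply/funext => x; rewrite mulN1r addrK.
Qed.

Lemma trig_dense h : sqi L h -> forall eps, 0 < eps -> exists F c,
  uniq F /\ avg L (fun x => sqn ((h x)%:C%C - trig L F c x)) <= eps.
Proof.
move=> /L2trig_sqi[_ H] eps eps0; have [p tp Hp] := H _ eps0.
have [F [c [uF E]]] := trigp_trig tp.
exists F, c; split => //; apply: le_trans Hp; rewrite le_eqVlt; apply/orP; left; apply/eqP.
apply: eq_avg => x _; rewrite -E /sqn !ReIm /=; ring.
Qed.

End density3.

(** * The weak equation *)

Section weak_equation.
Context {R : realType} (L : R) (L0 : 0 < L) (O : set (R * R)) (oO : open O).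
Local Notation T2 := (measurableTypeR R * measurableTypeR R)%type.
Local Notation S := (billiard O).
Implicit Types (u f g h phi psi : R * R -> R).

Lemma measurable_billiard : measurable (S : set T2).
Proof. by apply: measurableC; exact: open_measurable2. Qed.

Lemma periodic_derive phi v : periodic_on L setT phi ->
  periodic_on L setT (fun x => 'D_v phi x).
Proof.
move=> pphi k x _; rewrite /derive.
have -> // : (fun t => t^-1 *: ((phi \o shift (x + lattice L k)) (t *: v) - phi (x + lattice L k))) =
  (fun t => t^-1 *: ((phi \o shift x) (t *: v) - phi x)).
by apply/funext => t /=; rewrite /shift /= addrA !pphi.
Qed.

Lemma test_smooth phi : test_function L O phi -> smooth phi.
Proof. by case. Qed.

Lemma test_eq0 phi x : test_function L O phi -> ~ S x -> phi x = 0.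
Proof.
move=> [_ _ H] nS; apply/eqP; apply: contrapT => /negP ne; apply: nS.
by apply: interior_subset; apply: H; apply: subset_closure.
Qed.

Lemma test_derive phi v : test_function L O phi -> test_function L O (fun x => 'D_v phi x).
Proof.
move=> [pphi sphi H]; split; [exact: periodic_derive|exact: smooth_derive|].
apply: subset_trans H.
rewrite [X in _ `<=` X](iffLR (closure_id _) (@closed_closure _ [set x | phi x != 0])).
apply: closureS => x /= ne; apply: contrapT => nc.
have : nbhs x (~` closure [set x | phi x != 0]).
  by apply: open_nbhs_nbhs; split => //; rewrite openC; exact: closed_closure.
move=> N; move/eqP: ne; apply.
have E : \near x, phi x = 0.
  apply: filterS N => y ny; apply/eqP; apply: contrapT => /negP ne; apply: ny.
  exact: subset_closure.
by rewrite (near_eq_derive v E) derive_cst.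
Qed.

Lemma tint_avg (A : set (R * R)) h : tint L A h = L ^+ 2 * avg L (h \_ A).
Proof.
rewrite /tint Rintegral_mkcondl /avg mulrA divff ?mul1r //.
by rewrite expf_neq0 // gt_eqF.
Qed.

Lemma tint_supp h : (forall x, ~ S x -> h x = 0) -> tint L S h = L ^+ 2 * avg L h.
Proof.
move=> H; rewrite tint_avg; congr (_ * _); apply: eq_avg => x _.
by rewrite patchE; case: ifPn => // /negP; rewrite inE => /H ->.
Qed.

Lemma L2_sqi u : L2 L O u -> sqi L (u \_ S).
Proof.
move=> [_ mu_ Iu]; split.
  have := (measurable_restrict (u : T2 -> R) measurable_billiard (measurable_cell L)).1.
  by rewrite setIC; apply.
have := (integrable_restrict leb2 measurable_billiard (measurable_cell L)
  (EFin \o (fun x => u x ^+ 2))).1.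
rewrite setIC => /(_ Iu); congr (_.-integrable _ _); apply/funext => x /=.
by rewrite !patchE; case: ifP => //=; rewrite expr0n.
Qed.

Lemma bdd_L2 h : continuous h -> periodic_on L setT h -> L2 L O h.
Proof.
move=> ch ph; split; first by move=> k x _; exact: ph.
  have [mh _] := continuous_bdd L ch; apply: measurable_funS mh; first exact: measurable_cell.
  exact: subIsetr.
apply: (integrableS (measurable_cell L)); last by have [_] := bdd_sqi L0 (continuous_bdd L ch).
- by apply: measurableI; [exact: measurable_billiard|exact: measurable_cell].
- exact: subIsetr.
Qed.

Lemma test_L2 phi : test_function L O phi -> L2 L O phi.
Proof. by move=> [pp sp _]; apply: bdd_L2 => //; exact: smooth_continuous. Qed.

Lemma test_periodic phi : test_function L O phi -> periodic_on L setT phi.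
Proof. by case. Qed.

Lemma test_bdd phi : test_function L O phi -> bdd L phi.
Proof. by move=> /test_smooth /smooth_continuous; apply: continuous_bdd. Qed.

Lemma derive_mul phi psi v x : smooth phi -> smooth psi ->
  'D_v (fun x => phi x * psi x) x = phi x * 'D_v psi x + 'D_v phi x * psi x.
Proof.
move=> sp sq; rewrite -[RHS](_ : phi x *: 'D_v psi x + psi x *: 'D_v phi x = _).
  by apply: (@deriveM _ _ phi psi); exact: smooth_derivable.
by rewrite /GRing.scale /= [psi x * _]mulrC.
Qed.

Lemma test_parts phi psi v :
  (forall h, smooth h -> periodic_on L setT h -> avg L (fun x => 'D_v h x) = 0) ->
  test_function L O phi -> test_function L O psi ->
  tint L S (fun x => phi x * 'D_v psi x) = - tint L S (fun x => 'D_v phi x * psi x).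
Proof.
move=> Hd tp tq.
have dp := test_derive v tp; have dq := test_derive v tq.
rewrite !tint_supp; [|by move=> x /(test_eq0 dp) ->; rewrite mul0r
                     |by move=> x /(test_eq0 tp) ->; rewrite mul0r].
have := Hd _ (smoothM (test_smooth tp) (test_smooth tq)).
have pm : periodic_on L setT (fun x => phi x * psi x).
  by move=> k x _; rewrite (test_periodic tp) // (test_periodic tq).
move=> /(_ pm).
rewrite (eq_avg (g := fun x => phi x * 'D_v psi x + 'D_v phi x * psi x)); last first.
  by move=> x _; apply: derive_mul; exact: test_smooth.
have I1 : intg L (fun x => phi x * 'D_v psi x).
  by apply: (bdd_intg L0); apply: bddM; exact: test_bdd.
have I2 : intg L (fun x => 'D_v phi x * psi x).
  by apply: (bdd_intg L0); apply: bddM; exact: test_bdd.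
rewrite avgD // => H.
by rewrite -mulrN; congr (_ * _); apply/eqP; rewrite -addr_eq0 H.
Qed.

Lemma test_H1 phi : test_function L O phi -> H1 L O phi (d1 phi) (d2 phi).
Proof.
move=> tp; split; [exact: test_L2|exact/test_L2/test_derive|exact/test_L2/test_derive|].
move=> psi tq; split; apply: test_parts => //.
- exact: avg_d1.
- exact: avg_d2.
Qed.

Lemma test_form_domain bc phi : test_function L O phi ->
  form_domain bc L O phi (d1 phi) (d2 phi).
Proof.
move=> tp; case: bc; last exact: test_H1.
split; first exact: test_H1.
move=> eps eps0; exists phi => //; rewrite tint_avg (eq_avg (g := fun=> 0)).
  by rewrite avg_cst // mulr0.
by move=> x _; rewrite patchE !subrr expr0n /= !addr0; case: ifP.
Qed.

Lemma form_domain_H1 bc u g1 g2 : form_domain bc L O u g1 g2 -> H1 L O u g1 g2.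
Proof. by case: bc => //= -[]. Qed.

Lemma tint_mul_test u phi : tint L S (fun x => u x * phi x) =
  L ^+ 2 * avg L (fun x => (u \_ S) x * phi x).
Proof.
rewrite tint_avg; congr (_ * _); apply: eq_avg => x _.
by rewrite !patchE; case: ifP => //=; rewrite mul0r.
Qed.

Lemma green_identity (lam a b c a' b' e : R) : a = - a' -> b = - b' -> a' + b' = - e ->
  e = - lam * c -> a + b + lam * c = 0.
Proof. by move=> -> -> Hab He; lra. Qed.

Lemma avg_ae_mul (h h' k : R * R -> R) : sqi L (h \_ S) -> sqi L (h' \_ S) -> sqi L k ->
  {ae leb2, forall x, (S `&` cell L) x -> h x = h' x} ->
  avg L (fun x => (h \_ S) x * k x) = avg L (fun x => (h' \_ S) x * k x).
Proof.
move=> sh sh' [mk _] ae; rewrite /avg; congr (_ * _); rewrite /Rintegral; congr fine.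
have mE g : sqi L g -> measurable_fun (cell L : set T2) (EFin \o (fun x : T2 => g x * k x)).
  by move=> [mg _]; apply/measurable_EFinP; exact: measurable_funM.
apply: (ae_eq_integral _ _ (measurable_cell L) (mE _ sh) (mE _ sh')).
case: ae => N [mN N0 HN]; exists N; split => // x /= Hx; apply: HN => /= Hx2; apply: Hx.
by move=> cx; congr EFin; rewrite !patchE; case: ifPn => //; rewrite inE => Sx; rewrite Hx2.
Qed.

(** Each function lies in the form domain and may be tested against the other: both sides come from
    the same integral of the product of the gradients. *)
Lemma laplacian_symmetric bc u f v g : laplacian_real bc L O u f -> laplacian_real bc L O v g ->
  avg L (fun x => (f \_ S) x * (v \_ S) x) = avg L (fun x => (g \_ S) x * (u \_ S) x).
Proof.
move=> [_ [g1 [g2 [Du Hu]]]] [_ [h1 [h2 [Dv Hv]]]].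
have L2n : L ^+ 2 != 0 by rewrite expf_neq0 // gt_eqF.
have : tint L S (fun x => f x * v x) = tint L S (fun x => g x * u x).
  apply: oppr_inj; rewrite -(Hu _ _ _ Dv) -(Hv _ _ _ Du); congr tint.
  by apply/funext => x; rewrite [g1 x * _]mulrC [g2 x * _]mulrC.
rewrite !tint_avg => /(mulfI L2n) E; rewrite -[LHS](eq_avg (f := (fun x => f x * v x) \_ S)).
  by rewrite E; apply: eq_avg => x _; rewrite !patchE; case: ifP; rewrite ?mul0r.
by move=> x _; rewrite !patchE; case: ifP; rewrite ?mul0r.
Qed.

(* Only the distributional equation in the interior of S survives from the
   definition of the Laplacian. *)
Lemma eigen_weak bc (lam : R) u f phi : laplacian_real bc L O u f ->
  {ae leb2, forall x, (S `&` cell L) x -> - f x = lam * u x} ->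
  test_function L O phi ->
  avg L (fun x => (u \_ S) x * (d1 (d1 phi) x + d2 (d2 phi) x + lam * phi x)) = 0.
Proof.
move=> [Lf [g1 [g2 [Du Heq]]]] ae tp.
have [Lu Lg1 Lg2 wg] := form_domain_H1 Du.
have t1 := test_derive (1, 0) tp; have t2 := test_derive (0, 1) tp.
have [W1 _] := wg _ t1; have [_ W2] := wg _ t2.
have E := Heq _ _ _ (test_form_domain bc tp).
have L2n : L ^+ 2 != 0 by rewrite expf_neq0 // gt_eqF.
have sU := L2_sqi Lu; have sF := L2_sqi Lf; have sG1 := L2_sqi Lg1; have sG2 := L2_sqi Lg2.
have bt psi : test_function L O psi -> sqi L psi by move=> tpsi; apply: (bdd_sqi L0); exact: test_bdd.
have t11 := test_derive (1, 0) t1; have t22 := test_derive (0, 1) t2.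
have {}E : avg L (fun x => (g1 \_ S) x * d1 phi x) + avg L (fun x => (g2 \_ S) x * d2 phi x) =
   - avg L (fun x => (f \_ S) x * phi x).
  move: E; rewrite tint_mul_test tint_avg -mulrN => /(mulfI L2n) <-.
  rewrite -avgD; [|exact: sqiM_intg sG1 (bt _ t1)|exact: sqiM_intg sG2 (bt _ t2)].
  by apply: eq_avg => x _; rewrite !patchE; case: ifP => //=; rewrite !mul0r addr0.
move: W1; rewrite !tint_mul_test -mulrN => /(mulfI L2n) W1.
move: W2; rewrite !tint_mul_test -mulrN => /(mulfI L2n) W2.
have Ef : avg L (fun x => (f \_ S) x * phi x) = - lam * avg L (fun x => (u \_ S) x * phi x).
  have sU' : sqi L ((fun x => - lam * u x) \_ S).
    have := sqiM (bdd_cst L (- lam)) sU; congr sqi; apply/funext => x.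
    by rewrite !patchE; case: ifP; rewrite ?mulr0.
  rewrite (@avg_ae_mul f (fun x => - lam * u x) phi) //; last 2 first.
  - exact: bt.
  - case: ae => N [mN N0 HN]; exists N; split => // x Hx; apply: HN => /= H; apply: Hx => Sx.
    by rewrite -[LHS]opprK H // mulNr.
  rewrite -avgZ; last exact: sqiM_intg sU (bt _ tp).
  by apply: eq_avg => x _; rewrite !patchE; case: ifP => _; [rewrite mulrA|rewrite !mul0r mulr0].
rewrite (eq_avg (g := fun x => (u \_ S) x * d1 (d1 phi) x + (u \_ S) x * d2 (d2 phi) x +
    lam * ((u \_ S) x * phi x))); last by move=> x _; ring.
have I1 : intg L (fun x => (u \_ S) x * d1 (d1 phi) x) := sqiM_intg sU (bt _ t11).
have I2 : intg L (fun x => (u \_ S) x * d2 (d2 phi) x) := sqiM_intg sU (bt _ t22).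
have I3 := sqiM_intg sU (bt _ tp).
rewrite (avgD (intgD I1 I2) (intgZ lam I3)) (avgD I1 I2) (avgZ lam I3).
have W1' : avg L (fun x => (u \_ S) x * d1 (d1 phi) x) =
  - avg L (fun x => (g1 \_ S) x * d1 phi x) := W1.
have W2' : avg L (fun x => (u \_ S) x * d2 (d2 phi) x) =
  - avg L (fun x => (g2 \_ S) x * d2 phi x) := W2.
exact: green_identity W1' W2' E Ef.
Qed.

End weak_equation.

(** * The cutoff relation between Fourier coefficients *)

Section cutoff.
Context {R : realType} (L : R) (L0 : 0 < L).
Local Notation Re := (@complex.Re R).
Local Notation Im := (@complex.Im R).
Local Notation kap := (kap L).
Implicit Types (a h U : R * R -> R) (xi k : int * int) (B : nat -> R -> R).

Definition dotz xi k : int := xi.1 * k.1 + xi.2 * k.2.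
(** It is constant on the lines of direction [k] and so labels them; [dotz xi k] is the coordinate
    along such a line. *)
Definition detz xi k : int := xi.1 * k.2 - xi.2 * k.1.

Lemma lagrange_identity xi k :
  dotz xi xi * dotz k k = dotz xi k ^+ 2 + detz xi k ^+ 2.
Proof. by rewrite /dotz /detz; ring. Qed.

Definition Lap h x := d1 (d1 h) x + d2 (d2 h) x.

Lemma d1M h g x : smooth h -> smooth g ->
  d1 (fun x => h x * g x) x = h x * d1 g x + d1 h x * g x.
Proof. exact: derive_mul. Qed.

Lemma d2M h g x : smooth h -> smooth g ->
  d2 (fun x => h x * g x) x = h x * d2 g x + d2 h x * g x.
Proof. exact: derive_mul. Qed.

Lemma d_ext (v : R * R) h g x : h =1 g -> 'D_v h x = 'D_v g x.
Proof. by move=> /funext ->. Qed.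

Lemma dD (v : R * R) h g x : smooth h -> smooth g ->
  'D_v (fun x => h x + g x) x = 'D_v h x + 'D_v g x.
Proof. by move=> sh sg; apply: (@deriveD _ _ _ h g); exact: smooth_derivable. Qed.

Lemma dZ (v : R * R) (c : R) h x : smooth h -> 'D_v (fun x => c * h x) x = c * 'D_v h x.
Proof. by move=> sh; apply: (@deriveZ _ _ _ h); exact: smooth_derivable. Qed.

Lemma d_d_mul (v : R * R) h g x : smooth h -> smooth g ->
  'D_v ('D_v (fun x => h x * g x)) x =
  h x * 'D_v ('D_v g) x + 2 * ('D_v h x * 'D_v g x) + 'D_v ('D_v h) x * g x.
Proof.
move=> sh sg; have sdh := smooth_derive v sh; have sdg := smooth_derive v sg.
rewrite (@d_ext v _ (fun x => h x * 'D_v g x + 'D_v h x * g x)) => [|y]; last exact: derive_mul.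
rewrite dD; [|exact: smoothM|exact: smoothM].
by rewrite !derive_mul // mulr_natl mulr2n !addrA.
Qed.

Lemma dd_Re_ee1 xi x : d1 (d1 (Re \o ee L xi)) x = - (kap * xi.1%:~R) ^+ 2 * Re (ee L xi x).
Proof.
rewrite /d1 (@d_ext _ _ (fun x => - (kap * xi.1%:~R) * (Im \o ee L xi) x)) => [|y]; last exact: d1_Re_ee.
rewrite dZ; last exact: smooth_Im_ee.
by rewrite -/(d1 _ _) d1_Im_ee; ring.
Qed.

Lemma dd_Re_ee2 xi x : d2 (d2 (Re \o ee L xi)) x = - (kap * xi.2%:~R) ^+ 2 * Re (ee L xi x).
Proof.
rewrite /d2 (@d_ext _ _ (fun x => - (kap * xi.2%:~R) * (Im \o ee L xi) x)) => [|y]; last exact: d2_Re_ee.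
rewrite dZ; last exact: smooth_Im_ee.
by rewrite -/(d2 _ _) d2_Im_ee; ring.
Qed.

Lemma dd_Im_ee1 xi x : d1 (d1 (Im \o ee L xi)) x = - (kap * xi.1%:~R) ^+ 2 * Im (ee L xi x).
Proof.
rewrite /d1 (@d_ext _ _ (fun x => (kap * xi.1%:~R) * (Re \o ee L xi) x)) => [|y]; last exact: d1_Im_ee.
rewrite dZ; last exact: smooth_Re_ee.
by rewrite -/(d1 _ _) d1_Re_ee; ring.
Qed.

Lemma dd_Im_ee2 xi x : d2 (d2 (Im \o ee L xi)) x = - (kap * xi.2%:~R) ^+ 2 * Im (ee L xi x).
Proof.
rewrite /d2 (@d_ext _ _ (fun x => (kap * xi.2%:~R) * (Re \o ee L xi) x)) => [|y]; last exact: d2_Im_ee.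
rewrite dZ; last exact: smooth_Re_ee.
by rewrite -/(d2 _ _) d2_Re_ee; ring.
Qed.

Lemma Lap_mul_Re a xi x : smooth a -> Lap (fun x => a x * Re (ee L xi x)) x =
  Lap a x * Re (ee L xi x) - 2 * kap * (xi.1%:~R * d1 a x + xi.2%:~R * d2 a x) * Im (ee L xi x)
  - (kap ^+ 2 * (xi.1%:~R ^+ 2 + xi.2%:~R ^+ 2)) * (a x * Re (ee L xi x)).
Proof.
move=> sa; rewrite /Lap.
have -> : d1 (d1 (fun x => a x * Re (ee L xi x))) x = a x * d1 (d1 (Re \o ee L xi)) x +
   2 * (d1 a x * d1 (Re \o ee L xi) x) + d1 (d1 a) x * Re (ee L xi x).
  exact: (d_d_mul (1, 0) x sa (smooth_Re_ee L xi)).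
have -> : d2 (d2 (fun x => a x * Re (ee L xi x))) x = a x * d2 (d2 (Re \o ee L xi)) x +
   2 * (d2 a x * d2 (Re \o ee L xi) x) + d2 (d2 a) x * Re (ee L xi x).
  exact: (d_d_mul (0, 1) x sa (smooth_Re_ee L xi)).
rewrite dd_Re_ee1 dd_Re_ee2 d1_Re_ee d2_Re_ee.
move: (Re _) (Im _) (d1 a x) (d2 a x) (d1 (d1 a) x) (d2 (d2 a) x) (a x) => r i p q p2 q2 a0.
by move: (xi.1%:~R : R) (xi.2%:~R : R) kap => x1 x2 kk; ring.
Qed.

Lemma Lap_mul_Im a xi x : smooth a -> Lap (fun x => a x * Im (ee L xi x)) x =
  Lap a x * Im (ee L xi x) + 2 * kap * (xi.1%:~R * d1 a x + xi.2%:~R * d2 a x) * Re (ee L xi x)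
  - (kap ^+ 2 * (xi.1%:~R ^+ 2 + xi.2%:~R ^+ 2)) * (a x * Im (ee L xi x)).
Proof.
move=> sa; rewrite /Lap.
have -> : d1 (d1 (fun x => a x * Im (ee L xi x))) x = a x * d1 (d1 (Im \o ee L xi)) x +
   2 * (d1 a x * d1 (Im \o ee L xi) x) + d1 (d1 a) x * Im (ee L xi x).
  exact: (d_d_mul (1, 0) x sa (smooth_Im_ee L xi)).
have -> : d2 (d2 (fun x => a x * Im (ee L xi x))) x = a x * d2 (d2 (Im \o ee L xi)) x +
   2 * (d2 a x * d2 (Im \o ee L xi) x) + d2 (d2 a) x * Im (ee L xi x).
  exact: (d_d_mul (0, 1) x sa (smooth_Im_ee L xi)).
rewrite dd_Im_ee1 dd_Im_ee2 d1_Im_ee d2_Im_ee.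
move: (Re _) (Im _) (d1 a x) (d2 a x) (d1 (d1 a) x) (d2 (d2 a) x) (a x) => r i p q p2 q2 a0.
by move: (xi.1%:~R : R) (xi.2%:~R : R) kap => x1 x2 kk; ring.
Qed.

Definition weak_solution (O : set (R * R)) (lam : R) U := sqi L U /\
  forall phi, test_function L O phi -> avg L (fun x => U x * (Lap phi x + lam * phi x)) = 0.

Lemma test_mul_ee O a xi : test_function L O a ->
  test_function L O (fun x => a x * Re (ee L xi x)) /\
  test_function L O (fun x => a x * Im (ee L xi x)).
Proof.
move=> [pa sa H]; split; split.
- by move=> k x _; rewrite pa // ee_lattice.
- exact: smoothM (smooth_Re_ee L xi).
- apply: subset_trans H; apply: closureS => x /=.
  by apply: contraNN => /eqP ->; rewrite mul0r.
- by move=> k x _; rewrite pa // ee_lattice.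
- exact: smoothM (smooth_Im_ee L xi).
- apply: subset_trans H; apply: closureS => x /=.
  by apply: contraNN => /eqP ->; rewrite mul0r.
Qed.

Definition hatM h U xi := hat L (fun x => (h x)%:C%C * (U x)%:C%C) xi.

Definition normz xi : R := xi.1%:~R ^+ 2 + xi.2%:~R ^+ 2.

Lemma csqi_mul h U : bdd L h -> sqi L U -> csqi L (fun x => (h x)%:C%C * (U x)%:C%C).
Proof. by move=> bh sU; apply: csqiM; [exact: cbdd_real|exact: csqi_real]. Qed.

Lemma smooth_bdd h : smooth h -> bdd L h.
Proof. by move=> /smooth_continuous; apply: continuous_bdd. Qed.

Lemma smooth_Lap h : smooth h -> smooth (Lap h).
Proof. by move=> sh; apply: smoothD; do 2! apply: smooth_derive. Qed.

(** The equation is tested against [a] times the character of [- xi]. In the Leibniz rule the terms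
    are Lap a, twice the product of the gradients, where the gradient of the character brings the
    factor - i [kap] [xi], and [a] times the eigenvalue of the character. *)
Lemma cutoff_eq O lam U a xi : weak_solution O lam U -> test_function L O a ->
  hatM (Lap a) U xi +
  (0 +i* (- (2 * kap * xi.1%:~R)))%C * hatM (d1 a) U xi +
  (0 +i* (- (2 * kap * xi.2%:~R)))%C * hatM (d2 a) U xi +
  (lam - kap ^+ 2 * normz xi)%:C%C * hatM a U xi = 0.
Proof.
move=> [sU W] ta; have [tr ti] := test_mul_ee (- xi) ta; have [pa sa _] := ta.
have s0 := csqi_mul (smooth_bdd sa) sU.
have s1 : csqi L (fun x => (d1 a x)%:C%C * (U x)%:C%C).
  exact: csqi_mul (smooth_bdd (smooth_derive (1, 0) sa)) sU.
have s2 : csqi L (fun x => (d2 a x)%:C%C * (U x)%:C%C).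
  exact: csqi_mul (smooth_bdd (smooth_derive (0, 1) sa)) sU.
have sL := csqi_mul (smooth_bdd (smooth_Lap sa)) sU.
set A := (lam - _)%:C%C; set B := (0 +i* - (2 * kap * xi.1%:~R))%C.
set C := (0 +i* - (2 * kap * xi.2%:~R))%C.
rewrite /hatM -(hatZ L0 A xi s0) -(hatZ L0 B xi s1) -(hatZ L0 C xi s2).
have sB := csqiZ B s1; have sC := csqiZ C s2; have sA := csqiZ A s0.
have sLB := csqiD sL sB; have sLBC := csqiD sLB sC.
rewrite -(hatD L0 xi sL sB) -(hatD L0 xi sLB sC) -(hatD L0 xi sLBC sA).
apply: complex_ext => /=.
  rewrite -[RHS](W _ tr); apply: eq_avg => x _; rewrite Lap_mul_Re //= /normz.
  rewrite !intrN.
  move: (cos _) (sin _) (Lap a x) (U x) (a x) (d1 a x) (d2 a x) => r i p u v v1 v2.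
  by move: (xi.1%:~R : R) (xi.2%:~R : R) kap => x1 x2 kk; ring.
rewrite -[RHS](W _ ti); apply: eq_avg => x _; rewrite Lap_mul_Im //= /normz.
rewrite !intrN.
move: (cos _) (sin _) (Lap a x) (U x) (a x) (d1 a x) (d2 a x) => r i p u v v1 v2.
by move: (xi.1%:~R : R) (xi.2%:~R : R) kap => x1 x2 kk; ring.
Qed.

End cutoff.

(** * Functions of one linear form *)

Section strip.
Context {R : realType} (L : R) (L0 : 0 < L).
Local Notation Re := (@complex.Re R).
Local Notation Im := (@complex.Im R).
Local Notation kap := (kap L).
Implicit Types (h U : R * R -> R) (xi k : int * int) (A : nat -> R -> R).

Definition lin k (x : R * R) : R := k.1%:~R * x.1 + k.2%:~R * x.2.
(** The m-th derivative of the profile [A 0], as a function on the plane that depends on k.x only;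
    the sequence [A] is meant to satisfy [derivatives]. *)
Definition kfun A k m (x : R * R) : R := A m (lin k x).

Lemma derivatives_shift A m : derivatives A -> derivatives (fun n => A (m + n)%N).
Proof. by move=> dA n t; have := dA (m + n)%N t; rewrite addnS. Qed.

Lemma smooth_kfun A k m : derivatives A -> smooth (kfun A k m).
Proof.
move=> /(derivatives_shift m) dA.
have := smooth_comp dA (smooth_linear k.1%:~R k.2%:~R).
by rewrite addn0.
Qed.

Lemma lin_lattice k j x : lin k (x + lattice L j) = lin k x + (dotz k j)%:~R * L.
Proof. by rewrite /lin /lattice /dotz /= intrD !intrM; ring. Qed.

Lemma kfun_periodic A k m : (forall m, periodic (A m) L) ->
  periodic_on L setT (kfun A k m).
Proof. by move=> pA j x _; rewrite /kfun lin_lattice periodic_intmul. Qed.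

Lemma is_derive_lin k (x v : R * R) : is_derive x v (lin k) (lin k v).
Proof.
apply/is_derive_lineP => /=.
have -> : (fun t : R => lin k (t *: v + x)) = (fun t : R => lin k v * t + lin k x).
  by apply/funext => t; rewrite /lin /= /GRing.scale /=; ring.
by apply: is_derive_eq; rewrite /GRing.scale /= ; ring.
Qed.

Lemma d1_kfun A k m x : derivatives A -> d1 (kfun A k m) x = k.1%:~R * kfun A k m.+1 x.
Proof.
move=> dA; rewrite /d1.
have [_ ->] := is_derive_comp1 (dA m (lin k x)) (is_derive_lin k x (1, 0)).
by rewrite /lin /= mulr1 mulr0 addr0 mulrC.
Qed.

Lemma d2_kfun A k m x : derivatives A -> d2 (kfun A k m) x = k.2%:~R * kfun A k m.+1 x.
Proof.
move=> dA; rewrite /d2.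
have [_ ->] := is_derive_comp1 (dA m (lin k x)) (is_derive_lin k x (0, 1)).
by rewrite /lin /= mulr1 mulr0 add0r mulrC.
Qed.

Lemma Lap_kfun A k x : derivatives A -> Lap (kfun A k 0) x = normz k * kfun A k 2 x.
Proof.
move=> dA; rewrite /Lap /normz.
have -> : d1 (d1 (kfun A k 0)) x = k.1%:~R * d1 (kfun A k 1) x.
  rewrite {1}/d1 (@d_ext _ _ _ (fun x => k.1%:~R * kfun A k 1 x)) => [|y]; last exact: d1_kfun.
  by rewrite dZ //; exact: smooth_kfun.
have -> : d2 (d2 (kfun A k 0)) x = k.2%:~R * d2 (kfun A k 1) x.
  rewrite {1}/d2 (@d_ext _ _ _ (fun x => k.2%:~R * kfun A k 1 x)) => [|y]; last exact: d2_kfun.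
  by rewrite dZ //; exact: smooth_kfun.
rewrite d1_kfun // d2_kfun //; ring.
Qed.

(** A function g of k.x has only frequencies parallel to [k]. The averages of the two partial
    derivatives of g times a character vanish, so [zeta] times the coefficient of g is proportional
    to [k] times that of g'. Eliminating the latter leaves [detz zeta k] times the coefficient of
    g. *)
Lemma hat_kfun0 A k m zeta : derivatives A -> (forall m, periodic (A m) L) ->
  detz zeta k != 0 -> hat L (fun x => (kfun A k m x)%:C%C) zeta = 0.
Proof.
move=> dA pA dn; pose g := kfun A k m.
have sg : smooth g by exact: smooth_kfun.
have pg : periodic_on L setT g by exact: kfun_periodic.
have pe (f : R[i] -> R) : periodic_on L setT (fun x => g x * f (ee L (- zeta) x)).
  by move=> j x _; rewrite pg // ee_lattice.
have eq1 := avg_d1 L0 (smoothM sg (smooth_Re_ee L (- zeta))) (pe Re).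
have eq2 := avg_d2 L0 (smoothM sg (smooth_Re_ee L (- zeta))) (pe Re).
have eq3 := avg_d1 L0 (smoothM sg (smooth_Im_ee L (- zeta))) (pe Im).
have eq4 := avg_d2 L0 (smoothM sg (smooth_Im_ee L (- zeta))) (pe Im).
have sg' : smooth (kfun A k m.+1) by exact: smooth_kfun.
have lc (al be : R) p q : smooth p -> smooth q ->
    avg L (fun x => al * p x + be * q x) = al * avg L p + be * avg L q.
  move=> sp sq; have Ip := bdd_intg L0 (smooth_bdd L sp); have Iq := bdd_intg L0 (smooth_bdd L sq).
  by rewrite (avgD (intgZ al Ip) (intgZ be Iq)) !avgZ.
pose gR x := g x * (Re \o ee L (- zeta)) x; pose gI x := g x * (Im \o ee L (- zeta)) x.
pose hR x := kfun A k m.+1 x * (Re \o ee L (- zeta)) x.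
pose hI x := kfun A k m.+1 x * (Im \o ee L (- zeta)) x.
have sgR : smooth gR by apply: smoothM => //; exact: smooth_Re_ee.
have sgI : smooth gI by apply: smoothM => //; exact: smooth_Im_ee.
have shR : smooth hR by apply: smoothM => //; exact: smooth_Re_ee.
have shI : smooth hI by apply: smoothM => //; exact: smooth_Im_ee.
have {}eq1 : (kap * zeta.1%:~R) * avg L gI + k.1%:~R * avg L hR = 0.
  rewrite -lc // -[RHS]eq1; apply: eq_avg => x _; rewrite d1M //; last exact: smooth_Re_ee.
  by rewrite d1_Re_ee d1_kfun // /gI /hR /= intrN; ring.
have {}eq2 : (kap * zeta.2%:~R) * avg L gI + k.2%:~R * avg L hR = 0.
  rewrite -lc // -[RHS]eq2; apply: eq_avg => x _; rewrite d2M //; last exact: smooth_Re_ee.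
  by rewrite d2_Re_ee d2_kfun // /gI /hR /= intrN; ring.
have {}eq3 : - (kap * zeta.1%:~R) * avg L gR + k.1%:~R * avg L hI = 0.
  rewrite -lc // -[RHS]eq3; apply: eq_avg => x _; rewrite d1M //; last exact: smooth_Im_ee.
  by rewrite d1_Im_ee d1_kfun // /gR /hI /= intrN; ring.
have {}eq4 : - (kap * zeta.2%:~R) * avg L gR + k.2%:~R * avg L hI = 0.
  rewrite -lc // -[RHS]eq4; apply: eq_avg => x _; rewrite d2M //; last exact: smooth_Im_ee.
  by rewrite d2_Im_ee d2_kfun // /gR /hI /= intrN; ring.
have D : kap * (detz zeta k)%:~R != 0.
  by rewrite mulf_neq0 ?intr_eq0 // gt_eqF // kap_gt0.
have EI : avg L gI = 0.
  apply: (mulfI D); rewrite mulr0 /detz intrB !intrM.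
  transitivity (k.2%:~R * (kap * zeta.1%:~R * avg L gI + k.1%:~R * avg L hR) -
    k.1%:~R * (kap * zeta.2%:~R * avg L gI + k.2%:~R * avg L hR)); last by rewrite eq1 eq2 !mulr0 subr0.
  ring.
have ER : avg L gR = 0.
  apply: (mulfI D); rewrite mulr0 /detz intrB !intrM.
  transitivity (k.1%:~R * (- (kap * zeta.2%:~R) * avg L gR + k.2%:~R * avg L hI) -
    k.2%:~R * (- (kap * zeta.1%:~R) * avg L gR + k.1%:~R * avg L hI)); last by rewrite eq3 eq4 !mulr0 subr0.
  ring.
apply: complex_ext => /=; [rewrite -[RHS]ER|rewrite -[RHS]EI]; apply: eq_avg => x _;
  by rewrite /gR /gI /g /=; ring.
Qed.

(* Since (d/ds - sig)^2 maps A 0 to strip2, replacing d/ds by d/ds - sig shifts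
   the frequency by an imaginary amount; this removes the resonances of
   d^2/ds^2 + mu for mu >= 0. *)
Definition strip1 (sig : R) A k x := kfun A k 1 x - sig * kfun A k 0 x.
Definition strip2 (sig : R) A k x :=
  kfun A k 2 x - 2 * sig * kfun A k 1 x + sig ^+ 2 * kfun A k 0 x.

(** [D] is the squared modulus of (s - i q)^2 + mu, the symbol after the shift. With s = K and mu >=
    - K^2 / 4 its real part is at least K^2 / 2 when q^2 <= K^2 / 4, and otherwise its imaginary
    part 2 q s is large. The shift would create a zero at q = 0 for mu = - K^2; for such negative mu
    the unshifted symbol mu - q^2 has no zero. *)
Lemma denominator_bound (K s mu q : R) : 0 < K ->
  (s = K /\ - K ^+ 2 / 4 <= mu) \/ (s = 0 /\ mu <= - K ^+ 2 / 4) ->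
  let D := (s ^+ 2 + mu - q ^+ 2) ^+ 2 + 4 * q ^+ 2 * s ^+ 2 in
  [/\ 0 < D, 4 * K ^+ 2 * (s ^+ 2 + q ^+ 2) <= 16 * D & K ^+ 2 * K ^+ 2 <= 16 * D].
Proof.
move=> K0 H D.
suff [H1 H2] : 4 * K ^+ 2 * (s ^+ 2 + q ^+ 2) <= 16 * D /\ K ^+ 2 * K ^+ 2 <= 16 * D.
  split => //; have : 0 < K ^+ 2 * K ^+ 2 by rewrite mulr_gt0 ?exprn_gt0.
  by move: H2; lra.
have q0 := sqr_ge0 q; have k0 : 0 < K ^+ 2 by rewrite exprn_gt0.
rewrite {}/D; case: H => -[-> Hmu].
  move: (K ^+ 2) (q ^+ 2) k0 q0 Hmu => k p k0 p0 Hmu.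
  have kp : 0 <= k * p by rewrite mulr_ge0 // ltW.
  have [pk|pk] := leP p (k / 4).
    have H : k / 2 <= k + mu - p by lra.
    have H2 : (k / 2) * (k / 2) <= (k + mu - p) ^+ 2.
      by rewrite expr2; apply: ler_pM => //; lra.
    by split; nra.
  have H : k * (k / 4) <= k * p by rewrite ler_pM2l // ltW.
  have := sqr_ge0 (k + mu - p); by split; nra.
rewrite expr0n /= !mulr0 addr0 add0r.
move: (K ^+ 2) (q ^+ 2) k0 q0 Hmu => k p k0 p0 Hmu.
have kp : 0 <= k * p by rewrite mulr_ge0 // ltW.
have H2 : (k / 4 + p) * (k / 4 + p) <= (mu - p) ^+ 2.
  rewrite -sqrrN expr2; apply: ler_pM; lra.
have pp : 0 <= p * p by rewrite mulr_ge0.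
by split; nra.
Qed.

Lemma hatM_lin U (f g : R * R -> R) (c : R) xi : bdd L f -> bdd L g -> sqi L U ->
  hatM L (fun x => f x + c * g x) U xi = hatM L f U xi + c%:C%C * hatM L g U xi.
Proof.
move=> bf bg sU; have sf := csqi_mul L0 bf sU; have sg := csqi_mul L0 bg sU.
rewrite /hatM -(hatZ L0 _ _ sg) -(hatD L0 _ sf (csqiZ _ sg)).
apply: eq_hat => x _; apply: complex_ext; rewrite !ReIm /=; ring.
Qed.

(** Where the profile is a multiple of exp(sig s), both [strip1] and [strip2] vanish. The
    coefficients of the cutoff times U are thus controlled by the transition regions of the
    profile. *)
Lemma strip_coef O lam U A k sig xi : weak_solution L O lam U ->
  derivatives A -> test_function L O (kfun A k 0) -> k != 0 ->
  let mu := lam * normz k - kap ^+ 2 * (detz xi k)%:~R ^+ 2 in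
  (sig = 1 /\ - normz k ^+ 2 / 4 <= mu) \/ (sig = 0 /\ mu <= - normz k ^+ 2 / 4) ->
  sqn (hatM L (kfun A k 0) U xi) <=
    32 * (sqn (hatM L (strip1 sig A k) U xi) + sqn (hatM L (strip2 sig A k) U xi)).
Proof.
move=> ws dA ta k0 mu Hmu; have [sU _] := ws.
have K0 : 0 < normz k :> R.
  rewrite lt_def addr_ge0 ?sqr_ge0 // andbT paddr_eq0 ?sqr_ge0 //.
  rewrite !sqrf_eq0 !intr_eq0; apply: contra k0 => /andP[/eqP a /eqP b].
  by case: k a b {mu Hmu ta} => ? ? /= -> ->.
have b0 := smooth_bdd L (smooth_kfun k 0 dA).
have b1 := smooth_bdd L (smooth_kfun k 1 dA).
have b2 := smooth_bdd L (smooth_kfun k 2 dA).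
set H0 := hatM L _ U xi; set H1 := hatM L (strip1 _ _ _) U xi; set H2 := hatM L (strip2 _ _ _) U xi.
have E1 : hatM L (kfun A k 1) U xi = H1 + sig%:C%C * H0.
  rewrite /H1 (_ : strip1 sig A k = fun x => kfun A k 1 x + (- sig) * kfun A k 0 x).
    by rewrite hatM_lin // rmorphN /= mulNr subrK.
  by apply/funext => x; rewrite /strip1 mulNr.
have E2 : hatM L (kfun A k 2) U xi = H2 + (2 * sig)%:C%C * hatM L (kfun A k 1) U xi - (sig ^+ 2)%:C%C * H0.
  rewrite /H2 (_ : strip2 sig A k = fun x => (kfun A k 2 x + (- (2 * sig)) * kfun A k 1 x) + sig ^+ 2 * kfun A k 0 x).
    rewrite hatM_lin //; last by apply: bddD => //; exact: bddZ.
    rewrite hatM_lin // -/H0 rmorphN /= mulNr; ring.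
  by apply/funext => x; rewrite /strip2 mulNr.
have := cutoff_eq L0 xi ws ta.
have -> : hatM L (Lap (kfun A k 0)) U xi = (normz k)%:C%C * hatM L (kfun A k 2) U xi.
  rewrite -(hatZ L0 _ _ (csqi_mul L0 b2 sU)); apply: eq_hat => x _; rewrite Lap_kfun //.
  by apply: complex_ext; rewrite !ReIm /=; ring.
have -> : hatM L (d1 (kfun A k 0)) U xi = (k.1%:~R : R)%:C%C * hatM L (kfun A k 1) U xi.
  rewrite -(hatZ L0 _ _ (csqi_mul L0 b1 sU)); apply: eq_hat => x _; rewrite d1_kfun //.
  by apply: complex_ext; rewrite !ReIm /=; ring.
have -> : hatM L (d2 (kfun A k 0)) U xi = (k.2%:~R : R)%:C%C * hatM L (kfun A k 1) U xi.
  rewrite -(hatZ L0 _ _ (csqi_mul L0 b1 sU)); apply: eq_hat => x _; rewrite d2_kfun //.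
  by apply: complex_ext; rewrite !ReIm /=; ring.
rewrite E2 E1 -/H0.
pose q : R := kap * (dotz xi k)%:~R; pose s := sig * normz k.
have [|D0 B1 B2] := @denominator_bound (normz k) s mu q K0.
  by rewrite /s; case: Hmu => -[-> ?]; [left|right]; rewrite ?mul1r ?mul0r.
(* After multiplication by |k|^2 the Lagrange identity splits kap^2 |xi|^2 |k|^2 into q^2 and a part
   that depends only on the line and is contained in [mu]. *)
move=> /(congr1 (fun z => (normz k)%:C%C * z)); rewrite mulr0 => E.
have {E} : ((s ^+ 2 + mu - q ^+ 2) +i* (- (2 * q * s)))%C * H0 =
    (- (2 * s * normz k) +i* (2 * q * normz k))%C * H1 + (- (normz k ^+ 2))%:C%C * H2.
  apply/eqP; rewrite -subr_eq0 -[X in _ == X]E; apply/eqP.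
  rewrite /s /q /mu /normz /dotz /detz !(intrD, intrN, intrM).
  move: (H0) (H1) (H2) => z0 z1 z2.
  move: (lam) (kap) (xi.1%:~R : R) (xi.2%:~R : R) (k.1%:~R : R) (k.2%:~R : R) => la kk x1 x2 k1 k2.
  case: z0 => h0 h0'; case: z1 => h1 h1'; case: z2 => h2 h2'.
  by apply: complex_ext; rewrite !ReIm /=; ring.
move=> /(congr1 (@sqn R)); rewrite sqnM => E.
set D := sqn _ in E; have ED : D = (s ^+ 2 + mu - q ^+ 2) ^+ 2 + 4 * q ^+ 2 * s ^+ 2.
  by rewrite /D /sqn /=; ring.
rewrite -ED in D0 B1 B2.
rewrite -(ler_pM2l D0) E; apply: le_trans (sqnD_le _ _) _.
rewrite !sqnM sqn_real.
have -> : sqn (- (2 * s * normz k) +i* (2 * q * normz k))%C = 4 * normz k ^+ 2 * (s ^+ 2 + q ^+ 2).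
  by rewrite /sqn /=; ring.
have -> : (- normz k ^+ 2) ^+ 2 = normz k ^+ 2 * normz k ^+ 2 :> R by ring.
have G1 := ler_wpM2r (sqn_ge0 H1) B1; have G2 := ler_wpM2r (sqn_ge0 H2) B2.
by move: G1 G2; clear; lra.
Qed.

End strip.

(** * Observability on one line of frequencies *)

Section strip_estimate.
Context {R : realType} (L : R) (L0 : 0 < L).
Local Notation Re := (@complex.Re R).
Local Notation Im := (@complex.Im R).
Local Notation kap := (kap L).
Implicit Types (h U : R * R -> R) (xi k : int * int) (A : nat -> R -> R) (F : seq (int * int)).

Definition dshift (sig : R) A m t := A m.+1 t - sig * A m t.

Lemma derivatives_dshift sig A : derivatives A -> derivatives (dshift sig A).
Proof.
move=> dA m t.
have := @is_deriveD _ _ _ (A m.+1) (fun t => - sig * A m t) t 1 _ _ (dA m.+1 t)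
  (@is_deriveZ _ _ _ (A m) (- sig) t 1 _ (dA m t)).
rewrite /dshift; congr is_derive; last by rewrite /GRing.scale /= mulNr.
by apply/funext => y; rewrite -[RHS]/(_ + _) -mulNr.
Qed.

Lemma periodic_dshift sig A : (forall m, periodic (A m) L) ->
  forall m, periodic (dshift sig A m) L.
Proof. by move=> pA m t; rewrite /dshift !pA. Qed.

Lemma strip1E sig A k : strip1 sig A k = kfun (dshift sig A) k 0.
Proof. by []. Qed.

Lemma strip2E sig A k : strip2 sig A k = kfun (dshift sig (dshift sig A)) k 0.
Proof. by apply/funext => x; rewrite /strip2 /kfun /dshift; ring. Qed.

Definition line F k (c0 : int) := [seq xi <- F | detz xi k == c0].

Lemma hat_line h F c k c0 xi : bdd L h ->
  (forall zeta, detz zeta k != 0 -> hat L (fun x => (h x)%:C%C) zeta = 0) ->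
  detz xi k = c0 ->
  hat L (fun x => (h x)%:C%C * trig L F c x) xi =
  hat L (fun x => (h x)%:C%C * trig L (line F k c0) c x) xi.
Proof.
move=> bh Hh Hxi; rewrite !hat_mul_trig // big_filter [RHS]big_mkcond /=.
apply: eq_bigr => eta _; case: ifPn => // ne; rewrite Hh ?mulr0 //.
have -> : detz (xi - eta) k = detz xi k - detz eta k by rewrite /detz /=; ring.
by rewrite Hxi subr_eq0 eq_sym.
Qed.

(** The equation holds for U, whereas the decomposition into lines is made on a trigonometric
    approximant. The difference is kept as an explicit error: [hat_err] is additive over disjoint
    lists of frequencies and bounded by Bessel. *)
Definition resid U F (c : int * int -> R[i]) x : R[i] := (U x)%:C%C - trig L F c x.

Definition hat_err h (r : R * R -> R[i]) (G : seq (int * int)) :=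
  \sum_(xi <- G) sqn (hat L (fun x => (h x)%:C%C * r x) xi).

Lemma hat_split h U F c xi : bdd L h -> sqi L U ->
  hatM L h U xi = hat L (fun x => (h x)%:C%C * trig L F c x) xi +
    hat L (fun x => (h x)%:C%C * resid U F c x) xi.
Proof.
move=> bh sU; have sT : csqi L (trig L F c) by apply: cbdd_csqi => //; exact: cbdd_trig.
rewrite -hatD //; last 2 first.
- by apply: csqiM => //; exact: cbdd_real.
- by apply: csqiM; [exact: cbdd_real|apply: csqiB => //; exact: csqi_real].
by apply: eq_hat => x _; rewrite /resid; ring.
Qed.

Lemma bessel_weight h F c (G : seq (int * int)) : bdd L h -> uniq G ->
  \sum_(xi <- G) sqn (hat L (fun x => (h x)%:C%C * trig L F c x) xi) <=
  avg L (fun x => h x ^+ 2 * sqn (trig L F c x)).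
Proof.
move=> bh uG; have sT : csqi L (trig L F c) by apply: cbdd_csqi => //; exact: cbdd_trig.
apply: le_trans (bessel L0 (csqiM (cbdd_real bh) sT) uG) _.
by rewrite le_eqVlt; apply/orP; left; apply/eqP; apply: eq_avg => x _ /=; rewrite sqnM sqn_real.
Qed.

Lemma sqnD_le_mul (x y z : R[i]) : x = y + z -> sqn x <= 2 * sqn y + 2 * sqn z.
Proof. by move=> ->; exact: sqnD_le. Qed.

(** S is the mass on the line, W the observed mass, T0 the mass of the coefficients of the cutoff
    times the polynomial, and T1, T2 those for [strip1] and [strip2]. The term M (2 M)^-1 S is half
    of S and is absorbed. *)
Lemma strip_numeric (M S W E0 E1 E2 T0 T1 T2 : R) : 1 <= M -> 0 <= W ->
  0 <= E0 -> 0 <= E1 -> 0 <= E2 ->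
  T1 <= M * W -> T2 <= M * W ->
  T0 <= 2 * (32 * ((2 * T1 + 2 * E1) + (2 * T2 + 2 * E2))) + 2 * E0 ->
  S <= M * (2 * M * T0 + (2 * M)^-1 * S) + M * W ->
  S <= 1100 * M ^+ 3 * (W + (E0 + E1 + E2)).
Proof.
move=> M1 W0 e0 e1 e2 H1 H2 H0 HS.
have M0 : 0 < M by lra.
have E : M * (2 * M * T0 + (2 * M)^-1 * S) = 2 * M ^+ 2 * T0 + S / 2 by field; rewrite gt_eqF.
rewrite E in HS.
have T0b : T0 <= 256 * (M * W) + 128 * (E0 + E1 + E2) by lra.
have m2 : 1 <= M ^+ 2 by rewrite expr_ge1 // ltW.
have mm : M ^+ 2 * T0 <= M ^+ 2 * (256 * (M * W) + 128 * (E0 + E1 + E2)).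
  by rewrite ler_wpM2l // exprn_ge0 // ltW.
have P1 : M * W <= M ^+ 3 * W.
  by rewrite ler_wpM2r // exprS ler_peMr // ltW.
have P2 : M ^+ 2 * (E0 + E1 + E2) <= M ^+ 3 * (E0 + E1 + E2).
  by rewrite ler_wpM2r ?addr_ge0 // [M ^+ 3]exprS ler_peMl // exprn_ge0 // ltW.
have P3 : 0 <= M ^+ 3 * W by rewrite mulr_ge0 // exprn_ge0 // ltW.
have P4 : 0 <= M ^+ 3 * (E0 + E1 + E2) by rewrite mulr_ge0 ?addr_ge0 // exprn_ge0 // ltW.
have E3 : M ^+ 2 * (256 * (M * W) + 128 * (E0 + E1 + E2)) =
   256 * (M ^+ 3 * W) + 128 * (M ^+ 2 * (E0 + E1 + E2)) by ring.
have E4 : 1100 * M ^+ 3 * (W + (E0 + E1 + E2)) = 1100 * (M ^+ 3 * W) + 1100 * (M ^+ 3 * (E0 + E1 + E2)) by ring.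
rewrite E3 in mm; rewrite E4.
have HS' : S <= 2 * (M ^+ 2 * T0) + S / 2 + M * W by rewrite mulrA.
move: HS' mm P1 P2 P3 P4; clear.
move: (M ^+ 3 * W) (M ^+ 3 * _) (M ^+ 2 * T0) (M ^+ 2 * _) (M * W) => a b d e f; lra.
Qed.

(** The mass is split by 1 <= M (a + w), where a is the profile. The part with w is observed; the
    part with a is a pairing with the coefficients [c], estimated through [strip_coef]. All
    coefficients on the line share the same [mu], and multiplication by functions of k.x does not
    leave the line. *)
Lemma strip_line O lam U A k sig c0 (w : R * R -> R) M F c :
  weak_solution L O lam U -> derivatives A -> (forall m, periodic (A m) L) ->
  test_function L O (kfun A k 0) -> k != 0 ->
  let mu := lam * normz k - kap ^+ 2 * (c0%:~R) ^+ 2 in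
  (sig = 1 /\ - normz k ^+ 2 / 4 <= mu) \/ (sig = 0 /\ mu <= - normz k ^+ 2 / 4) ->
  bdd L w -> 1 <= M -> (forall x, 0 <= kfun A k 0 x) -> (forall x, 0 <= w x) ->
  (forall x, 1 <= M * (kfun A k 0 x + w x)) ->
  (forall x, strip1 sig A k x ^+ 2 <= M * w x) ->
  (forall x, strip2 sig A k x ^+ 2 <= M * w x) -> uniq F ->
  \sum_(xi <- line F k c0) sqn (c xi) <= 1100 * M ^+ 3 *
    (avg L (fun x => w x * sqn (trig L (line F k c0) c x)) +
     (hat_err (kfun A k 0) (resid U F c) (line F k c0) +
      hat_err (strip1 sig A k) (resid U F c) (line F k c0) +
      hat_err (strip2 sig A k) (resid U F c) (line F k c0))).
Proof.
move=> ws dA pA ta k0 mu Hmu bw M1 a0 w0 Haw H1 H2 uF.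
pose r := resid U F c; pose e h := hat_err h r (line F k c0).
set a := kfun A k 0; set s1 := strip1 sig A k; set s2 := strip2 sig A k.
have [sU _] := ws.
have dA1 := derivatives_dshift sig dA; have dA2 := derivatives_dshift sig dA1.
have pA1 := periodic_dshift sig pA; have pA2 := periodic_dshift sig pA1.
have ba : bdd L a by apply: smooth_bdd; exact: smooth_kfun.
have b1 : bdd L s1 by rewrite /s1 strip1E; apply: smooth_bdd; exact: smooth_kfun.
have b2 : bdd L s2 by rewrite /s2 strip2E; apply: smooth_bdd; exact: smooth_kfun.
have za zeta : detz zeta k != 0 -> hat L (fun x => (a x)%:C%C) zeta = 0 by exact: hat_kfun0.
have z1 zeta : detz zeta k != 0 -> hat L (fun x => (s1 x)%:C%C) zeta = 0.
  by rewrite /s1 strip1E; exact: hat_kfun0.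
have z2 zeta : detz zeta k != 0 -> hat L (fun x => (s2 x)%:C%C) zeta = 0.
  by rewrite /s2 strip2E; exact: hat_kfun0.
set Fl := line F k c0; have uFl : uniq Fl by exact: filter_uniq.
have sT : csqi L (trig L Fl c) by apply: cbdd_csqi => //; exact: cbdd_trig.
pose T h := \sum_(xi <- Fl) sqn (hat L (fun x => (h x)%:C%C * trig L Fl c x) xi).
have inl xi : xi \in Fl -> detz xi k = c0 by rewrite mem_filter => /andP[/eqP].
have W0 : 0 <= avg L (fun x => w x * sqn (trig L Fl c x)).
  by apply: avg_ge0 => // x _; rewrite mulr_ge0 // sqn_ge0.
have e0 h : 0 <= e h by apply: sumr_ge0 => xi _; exact: sqn_ge0.
have TW h : bdd L h -> (forall x, h x ^+ 2 <= M * w x) ->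
    T h <= M * avg L (fun x => w x * sqn (trig L Fl c x)).
  move=> bh Hh; apply: le_trans (bessel_weight _ _ bh uFl) _.
  have Iw := weight_intg bw sT.
  rewrite -avgZ //; apply: avg_le => //; [|exact: intgZ|].
    by apply: weight_intg => //; exact: (bddM bh bh).
  by move=> x _; rewrite mulrA; apply: ler_wpM2r; [exact: sqn_ge0|exact: Hh].
have split h xi : bdd L h -> (forall zeta, detz zeta k != 0 -> hat L (fun x => (h x)%:C%C) zeta = 0) ->
    xi \in Fl -> hatM L h U xi = hat L (fun x => (h x)%:C%C * trig L Fl c x) xi +
    hat L (fun x => (h x)%:C%C * r x) xi.
  by move=> bh zh xil; rewrite (@hat_split h U F c) // (@hat_line h F c k c0) //; exact: inl.
apply: (@strip_numeric M _ _ _ _ _ (T a) (T s1) (T s2)) => //.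
- exact: (e0 a).
- exact: (e0 s1).
- exact: (e0 s2).
- exact: TW.
- exact: TW.
- rewrite /T /e /hat_err !mulr_sumr -!big_split /= !mulr_sumr -big_split /=.
  rewrite [leLHS]big_seq [leRHS]big_seq; apply: ler_sum => xi xil.
  have Ea : hat L (fun x => (a x)%:C%C * trig L Fl c x) xi = hatM L a U xi +
     (- hat L (fun x => (a x)%:C%C * r x) xi) by rewrite split // addrK.
  apply: le_trans (sqnD_le_mul Ea) _; rewrite sqnN lerD2r ler_wpM2l //.
  have Hd : (sig = 1 /\ - normz k ^+ 2 / 4 <= lam * normz k - kap ^+ 2 * (detz xi k)%:~R ^+ 2) \/
     (sig = 0 /\ lam * normz k - kap ^+ 2 * (detz xi k)%:~R ^+ 2 <= - normz k ^+ 2 / 4).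
    by rewrite inl.
  apply: le_trans (strip_coef L0 ws dA ta k0 Hd) _; rewrite ler_wpM2l //.
  by apply: lerD; apply: sqnD_le_mul; exact: split.
- rewrite -[X in X <= _](avg_sqn_trig L0 c uFl).
  have Ia := weight_intg ba sT; have Iw := weight_intg bw sT.
  apply: (@le_trans _ _ (M * avg L (fun x => a x * sqn (trig L Fl c x)) +
      M * avg L (fun x => w x * sqn (trig L Fl c x)))).
    rewrite -!avgZ // -avgD; [|exact: intgZ|exact: intgZ].
    apply: avg_le => //; [exact: sqn_intg|by apply: intgD; exact: intgZ|].
    move=> x _ /=; rewrite -mulrDr -mulrDl mulrA; apply: ler_peMl (Haw x).
    exact: sqn_ge0.
  rewrite lerD2r ler_wpM2l //; first by lra.
  rewrite weight_trig // /T !mulr_sumr -big_split /=.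
  apply: ler_sum => xi _.
  (* This weight in Young's inequality leaves half of the mass of the line, to be absorbed in
     [strip_numeric]. *)
  have M0 : 0 < (2 * M)^-1 by rewrite invr_gt0; lra.
  by have := ReM_conj_le (hat L (fun x => (a x)%:C%C * trig L Fl c x) xi) (c xi) M0; rewrite invrK.
Qed.

End strip_estimate.

(** * Frequencies at which the symbol is large *)

Section decoupling.
Context {R : realType} (L : R) (L0 : 0 < L).
Local Notation Re := (@complex.Re R).
Local Notation Im := (@complex.Im R).
Local Notation kap := (kap L).
Implicit Types (h U rho : R * R -> R) (xi k : int * int) (F G : seq (int * int)).

Lemma bessel_mul h U G : bdd L h -> sqi L U -> uniq G ->
  \sum_(xi <- G) sqn (hatM L h U xi) <= avg L (fun x => h x ^+ 2 * U x ^+ 2).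
Proof.
move=> bh sU uG; apply: le_trans (bessel L0 (csqi_mul L0 bh sU) uG) _.
by rewrite le_eqVlt; apply/orP; left; apply/eqP; apply: eq_avg => x _ /=; rewrite sqnM !sqn_real.
Qed.

Lemma bessel_mul_le h U (w : R * R -> R) (M : R) G : bdd L h -> bdd L w -> sqi L U ->
  (forall x, h x ^+ 2 <= M * w x) -> uniq G ->
  \sum_(xi <- G) sqn (hatM L h U xi) <= M * avg L (fun x => w x * U x ^+ 2).
Proof.
move=> bh bw sU H uG; apply: le_trans (bessel_mul bh sU uG) _.
have I (p : R * R -> R) : bdd L p -> intg L (fun x => p x * U x ^+ 2).
  move=> bp; have := sqiM_intg (sqiM bp sU) sU; congr intg; apply/funext => x; ring.
rewrite -avgZ; last exact: I.
apply: avg_le => //; [exact: (I _ (bddM bh bh))|exact/intgZ/I|].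
by move=> x _; rewrite mulrA ler_wpM2r // sqr_ge0.
Qed.

Lemma tail_numeric (B d e1 e2 : R) (H0 HL H1 H2 : R[i]) :
  HL + (0 +i* (- (2 * e1)))%C * H1 + (0 +i* (- (2 * e2)))%C * H2 + d%:C%C * H0 = 0 ->
  1 + 4 * (e1 ^+ 2 + e2 ^+ 2) <= B * d ^+ 2 ->
  sqn H0 <= 4 * B * (sqn HL + sqn H1 + sqn H2).
Proof.
move=> E HB; have [p1 p2] := (sqr_ge0 e1, sqr_ge0 e2).
have d0 : 0 < d ^+ 2.
  rewrite lt_def sqr_ge0 andbT; apply/eqP => d0; move: HB; rewrite d0 mulr0; lra.
rewrite -(ler_pM2l d0) -sqn_real -sqnM.
have -> : d%:C%C * H0 = - HL + ((0 +i* (2 * e1))%C * H1 + (0 +i* (2 * e2))%C * H2).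
  apply/eqP; rewrite -subr_eq0 -[X in _ == X]E; apply/eqP.
  case: H0 E => ? ? E; case: HL E => ? ? E; case: H1 E => ? ? E; case: H2 E => ? ? E.
  by apply: complex_ext; rewrite !ReIm /=; ring.
apply: le_trans (sqnD_le _ _) _; rewrite sqnN sqn_real.
have S1 := sqnD_le ((0 +i* (2 * e1))%C * H1) ((0 +i* (2 * e2))%C * H2).
rewrite !sqnM in S1; have [q1 q2] : sqn (0 +i* (2 * e1))%C = 4 * e1 ^+ 2 /\ sqn (0 +i* (2 * e2))%C = 4 * e2 ^+ 2.
  by rewrite /sqn /=; split; ring.
rewrite q1 q2 in S1.
have [s0 [s1 s2]] := (sqn_ge0 HL, (sqn_ge0 H1, sqn_ge0 H2)).
move: S1 s0 s1 s2 HB p1 p2; clear.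
set s := sqn (_ + _); move: s (sqn HL) (sqn H1) (sqn H2) (e1 ^+ 2) (e2 ^+ 2) (d ^+ 2) => s a b c u v w S1 a0 b0 c0 HB u0 v0.
have h0 : 0 <= (B * w - (1 + 4 * (u + v))) * (a + b + c).
  by rewrite mulr_ge0 ?subr_ge0 // !addr_ge0.
have := mulr_ge0 u0 a0; have := mulr_ge0 u0 c0; have := mulr_ge0 v0 a0; have := mulr_ge0 v0 b0.
by have := mulr_ge0 u0 b0; have := mulr_ge0 v0 c0; lra.
Qed.

(** U is written as chi U + (1 - chi) U. The second part lives where the weight does; for the first,
    the cutoff relation is divided by lam - kap^2 |xi|^2. The numerators grow like 1 + 4 kap^2
    |xi|^2, which the hypothesis on [G] compares with the square of this divisor. *)
Lemma tail_estimate O (lam : R) U chi (w : R * R -> R) (M B : R) G :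
  weak_solution L O lam U -> test_function L O chi -> bdd L w -> 0 <= M -> 0 <= B ->
  (forall x, (1 - chi x) ^+ 2 <= M * w x) -> (forall x, d1 chi x ^+ 2 <= M * w x) ->
  (forall x, d2 chi x ^+ 2 <= M * w x) -> (forall x, Lap chi x ^+ 2 <= M * w x) ->
  uniq G ->
  (forall xi, xi \in G -> 1 + 4 * (kap ^+ 2 * normz xi) <= B * (lam - kap ^+ 2 * normz xi) ^+ 2) ->
  \sum_(xi <- G) sqn (hatM L (fun=> 1) U xi) <= (24 * B + 2) * M * avg L (fun x => w x * U x ^+ 2).
Proof.
move=> ws tc bw M0 B0 c0 c1 c2 cL uG HG; have [sU _] := ws; have [pc sc _] := tc.
have b0 : bdd L (fun x => 1 - chi x) by apply: bddB; [exact: bdd_cst|exact: smooth_bdd].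
have b1 : bdd L (d1 chi) := smooth_bdd L (smooth_derive (1, 0) sc).
have b2 : bdd L (d2 chi) := smooth_bdd L (smooth_derive (0, 1) sc).
have bL : bdd L (Lap chi) := smooth_bdd L (smooth_Lap sc).
have S0 := bessel_mul_le b0 bw sU c0 uG; have S1 := bessel_mul_le b1 bw sU c1 uG.
have S2 := bessel_mul_le b2 bw sU c2 uG; have SL := bessel_mul_le bL bw sU cL uG.
set N := avg L _ in S0 S1 S2 SL *.
have step : \sum_(xi <- G) sqn (hatM L (fun=> 1) U xi) <=
    8 * B * (\sum_(xi <- G) sqn (hatM L (Lap chi) U xi) + \sum_(xi <- G) sqn (hatM L (d1 chi) U xi)
     + \sum_(xi <- G) sqn (hatM L (d2 chi) U xi)) + 2 * \sum_(xi <- G) sqn (hatM L (fun x => 1 - chi x) U xi).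
  rewrite -!big_split /= !mulr_sumr -big_split /= [leLHS]big_seq [leRHS]big_seq.
  apply: ler_sum => xi xiG.
  have E : hatM L (fun=> 1) U xi = hatM L chi U xi + hatM L (fun x => 1 - chi x) U xi.
    have -> : (fun=> 1) = (fun x => chi x + 1 * (1 - chi x)).
      by apply/funext => x; rewrite mul1r addrC subrK.
    rewrite (hatM_lin L0 1 xi (smooth_bdd L sc) b0 sU) mul1r.
    by congr (_ + hatM _ _ _ _); apply/funext => x; rewrite mul1r addrC subrK.
  apply: le_trans (sqnD_le_mul E) _; rewrite lerD2r.
  have Eq := cutoff_eq L0 xi ws tc.
  have T : sqn (hatM L chi U xi) <= 4 * B * (sqn (hatM L (Lap chi) U xi) + sqn (hatM L (d1 chi) U xi) + sqn (hatM L (d2 chi) U xi)).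
    apply: (@tail_numeric B (lam - kap ^+ 2 * normz xi) (kap * xi.1%:~R) (kap * xi.2%:~R)).
      by rewrite !mulrA in Eq *.
    have -> : (kap * xi.1%:~R) ^+ 2 + (kap * xi.2%:~R) ^+ 2 = kap ^+ 2 * normz xi by rewrite /normz; ring.
      exact: HG.
  by have -> : 8 * B = 2 * (4 * B) by [ring]; rewrite -mulrA ler_wpM2l.
have B8 : 0 <= 8 * B by rewrite mulr_ge0.
apply: le_trans step _; apply: le_trans (lerD (ler_wpM2l B8 (lerD (lerD SL S1) S2)) (ler_wpM2l _ S0)) _ => //.
by rewrite le_eqVlt; apply/orP; left; apply/eqP; clear; ring.
Qed.

End decoupling.

(** * Block decomposition of weighted averages, and translations *)

Section classes.
Context {R : realType} (L : R) (L0 : 0 < L).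
Local Notation Re := (@complex.Re R).
Local Notation Im := (@complex.Im R).
Implicit Types (rho : R * R -> R) (xi k : int * int) (F : seq (int * int)) (c : int * int -> R[i]).

Lemma sum_fibers (T : eqType) (lab : int * int -> T) F (f : int * int -> R) :
  \sum_(l <- undup (map lab F)) \sum_(xi <- [seq xi <- F | lab xi == l]) f xi =
  \sum_(xi <- F) f xi.
Proof.
under eq_bigr do rewrite big_filter.
rewrite (exchange_big_dep xpredT) //= big_seq [RHS]big_seq; apply: eq_bigr => a ain.
rewrite -big_filter; have -> : [seq i <- undup (map lab F) | lab a == i] = [:: lab a].
  rewrite (@eq_filter _ _ (pred1 (lab a))) => [|b]; last by rewrite /= eq_sym.
  by rewrite filter_pred1_uniq ?undup_uniq // mem_undup map_f.
by rewrite big_seq1.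
Qed.

(** In the basis of characters, multiplication by rho has the matrix of the coefficients of rho at
    differences of frequencies; the hypothesis makes it block diagonal with respect to the
    labels. *)
Lemma decouple (T : eqType) (lab : int * int -> T) rho F c : bdd L rho ->
  (forall xi eta, xi \in F -> eta \in F -> lab xi != lab eta ->
     hat L (fun x => (rho x)%:C%C) (xi - eta) = 0) ->
  \sum_(l <- undup (map lab F))
     avg L (fun x => rho x * sqn (trig L [seq xi <- F | lab xi == l] c x)) =
  avg L (fun x => rho x * sqn (trig L F c x)).
Proof.
move=> br H; rewrite (weight_trig L0 _ _ br) -(sum_fibers lab).
apply: eq_bigr => l _; rewrite (weight_trig L0 _ _ br) [LHS]big_seq [RHS]big_seq.
apply: eq_bigr => xi; rewrite mem_filter => /andP[/eqP xil xiF]; congr (Re (_ * _)).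
rewrite !hat_mul_trig // big_filter big_mkcond /= [LHS]big_seq [RHS]big_seq.
by apply: eq_bigr => eta etaF; case: eqP => // ne; rewrite H ?mulr0 // xil eq_sym; apply/eqP.
Qed.

Lemma decouple_points rho F c : bdd L rho -> uniq F ->
  (forall xi eta, xi \in F -> eta \in F -> xi != eta ->
     hat L (fun x => (rho x)%:C%C) (xi - eta) = 0) ->
  avg L (fun x => rho x * sqn (trig L F c x)) = avg L rho * \sum_(xi <- F) sqn (c xi).
Proof.
move=> br uF H; rewrite (weight_trig L0 _ _ br) mulr_sumr [LHS]big_seq [RHS]big_seq.
apply: eq_bigr => xi xiF; rewrite hat_mul_trig // (bigD1_seq xi) //= subrr.
rewrite big_seq_cond big1 ?addr0 => [|eta /andP[etaF ne]]; last by rewrite H ?mulr0 // eq_sym.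
have -> : hat L (fun x => (rho x)%:C%C) 0 = (avg L rho)%:C%C.
  transitivity (cavg L (fun x => (rho x)%:C%C)).
    by apply: eq_cavg => x _; rewrite oppr0 ee0 mulr1.
  by apply: complex_ext => //=; rewrite avg_cst.
rewrite /sqn !ReIm /=; ring.
Qed.

Lemma trigp_trigE F c : trigp L (trig L F c).
Proof.
exists [seq (xi, c xi) | xi <- F]; apply/funext => x.
by rewrite big_map.
Qed.

Lemma rtrigp_sqn_trig F c : rtrigp L (fun x => sqn (trig L F c x)).
Proof.
have tc : trigp L (fun x => conjc (trig L F c x)).
  exists [seq (- xi, conjc (c xi)) | xi <- F]; apply/funext => x.
  by rewrite conj_trig big_map.
have := trigpM (trigp_trigE F c) tc; congr trigp; apply/funext => x.
by apply: complex_ext; rewrite /sqn !ReIm /=; ring.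
Qed.

Lemma ee_add xi x v : ee L xi (x + v) = ee L xi x * ee L xi v.
Proof.
have E : phase L xi (x + v) = phase L xi x + phase L xi v by rewrite /phase /=; ring.
by apply: complex_ext; rewrite ReIm /= E ?cosD ?sinD //; ring.
Qed.

Lemma trig_add F c x v : trig L F c (x + v) = trig L F (fun xi => ee L xi v * c xi) x.
Proof. by apply: eq_bigr => xi _; rewrite ee_add; ring. Qed.

(** For a trigonometric polynomial the average is the coefficient at frequency 0, which a
    translation multiplies by 1. *)
Lemma avg_shift p v : rtrigp L p -> avg L (fun x => p (x + v)) = avg L p.
Proof.
move=> /trigp_trig[F [c [uF E]]].
have H c' : cavg L (trig L F c') = if 0 \in F then c' 0 else 0.
  rewrite -(hat_trig L0 c' _ uF); apply: eq_cavg => x _.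
  by rewrite oppr0 ee0 mulr1.
have E1 : cavg L (fun x => (p (x + v))%:C%C) = cavg L (fun x => (p x)%:C%C).
  have -> : (fun x => (p (x + v))%:C%C) = trig L F (fun xi => ee L xi v * c xi).
    by apply/funext => x; rewrite -trig_add -E.
  rewrite E !H; case: ifP => // _; by rewrite ee0 mul1r.
by have := congr1 Re E1.
Qed.

Lemma rtrigp_shift p v : rtrigp L p -> rtrigp L (fun x => p (x + v)).
Proof.
move=> /trigp_trig[F [c [uF E]]].
have := trigp_trigE F (fun xi => ee L xi v * c xi); congr trigp; apply/funext => x.
by rewrite -trig_add -E.
Qed.

Definition perp k : R * R := (- k.2%:~R, k.1%:~R).

(* On the line [detz xi k = c0] translations along [perp k] multiply all the
   characters by the same unimodular number. *)
Lemma sqn_line_shift F c k (c0 : int) (t : R) (x : R * R) :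
  (forall xi, xi \in F -> detz xi k = c0) ->
  sqn (trig L F c (x + t *: perp k)) = sqn (trig L F c x).
Proof.
move=> H; case: F H => [|xi0 F] H; first by rewrite /trig !big_nil.
rewrite trig_add -[RHS]mul1r -(sqn_ee L xi0 (t *: perp k)) -sqnM; congr sqn.
rewrite /trig mulr_sumr big_seq [RHS]big_seq; apply: eq_bigr => xi xiF.
have -> : ee L xi (t *: perp k) = ee L xi0 (t *: perp k).
  have P zeta : phase L zeta (t *: perp k) = - kap L * t * (detz zeta k)%:~R.
    by rewrite /phase /perp /detz /= /GRing.scale /= intrB !intrM; ring.
  by rewrite /ee !P (H _ xiF) (H _ (mem_head _ _)).
by rewrite mulrA.
Qed.

Lemma avg_line_shift rho F c k (c0 : int) (t : R) : rtrigp L rho ->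
  (forall xi, xi \in F -> detz xi k = c0) ->
  avg L (fun x => rho (x + t *: perp k) * sqn (trig L F c x)) =
  avg L (fun x => rho x * sqn (trig L F c x)).
Proof.
move=> tr H; rewrite -(avg_shift (t *: perp k) (rtrigpM tr (rtrigp_sqn_trig F c))).
by apply: eq_avg => x _; rewrite (sqn_line_shift _ _ _ H).
Qed.

Lemma rtrigp_degree rho : rtrigp L rho -> exists2 D : int, 0 < D &
  forall zeta, D < dotz zeta zeta -> hat L (fun x => (rho x)%:C%C) zeta = 0.
Proof.
move=> /trigp_trig[F [c [uF E]]].
exists (1 + \sum_(xi <- F) dotz xi xi).
  by rewrite ltr_wpDr // sumr_ge0 // => xi _; rewrite addr_ge0 // -expr2 sqr_ge0.
move=> zeta Hz; rewrite E hat_trig //; case: ifPn => // zF; exfalso.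
move: Hz; rewrite ltNge => /negP; apply; rewrite (bigD1_seq zeta) //= addrCA lerDl addr_ge0 //.
by rewrite sumr_ge0 // => xi _; rewrite addr_ge0 // -expr2 sqr_ge0.
Qed.

End classes.

(** * Tangent lattice directions *)

Section lattice_geometry.
Context {R : realType}.
Implicit Types (p q j k a xi : int * int) (m : int) (F : seq (int * int)).

Definition scalez m k : int * int := (m * k.1, m * k.2).

Lemma dotz_ge0 k : 0 <= dotz k k.
Proof. by rewrite addr_ge0 // -expr2 sqr_ge0. Qed.

Lemma dotz_ge1 k : k != 0 -> 1 <= dotz k k.
Proof.
case: k => a b ne; rewrite -gtz0_ge1 lt_def dotz_ge0 andbT /dotz /= -!expr2 paddr_eq0 ?sqr_ge0 //.
by rewrite !sqrf_eq0; apply: contra ne => /andP[/eqP -> /eqP ->].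
Qed.

Lemma normzE k : normz k = (dotz k k)%:~R :> R.
Proof. by rewrite /normz /dotz intrD !intrM -!expr2. Qed.

Lemma coprime_parallel a k : coprimez k.1 k.2 -> detz a k = 0 -> exists m, a = scalez m k.
Proof.
case: a k => a1 a2 [k1 k2] /= /coprimezP[[u v]] /= B; rewrite /detz /= => E.
exists (u * a1 + v * a2); rewrite /scalez /=; congr pair.
  by transitivity (a1 * (u * k1 + v * k2) - v * (a1 * k2 - a2 * k1)); [rewrite B E; ring|ring].
by transitivity (a2 * (u * k1 + v * k2) + u * (a1 * k2 - a2 * k1)); [rewrite B E; ring|ring].
Qed.

Lemma primitive_vector j : j != 0 -> exists k m, [/\ coprimez k.1 k.2, m != 0 & j = scalez m k].
Proof.
case: j => j1 j2 ne; pose g := gcdz j1 j2.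
have g0 : g != 0.
  by apply: contra ne; rewrite /g gcdz_eq0 => /andP[/eqP -> /eqP ->].
case/dvdzP: (dvdz_gcdl j1 j2) => k1 E1; case/dvdzP: (dvdz_gcdr j1 j2) => k2 E2.
exists (k1, k2), g; split => //; last by rewrite /scalez /= [g * _]mulrC [g * k2]mulrC; congr pair.
apply/coprimezP; have [u [v E]] := Bezoutz j1 j2; exists (u, v) => /=.
apply: (mulIf g0); rewrite mul1r; transitivity (u * (k1 * g) + v * (k2 * g)); first by ring.
by rewrite -E1 -E2.
Qed.

Lemma detz_parallel a k j : k != 0 -> detz a k = 0 -> detz k j = 0 -> detz a j = 0.
Proof.
move=> k0 E1 E2; have : dotz k k * detz a j = 0.
  transitivity (dotz a k * detz k j + dotz k j * detz a k); last by rewrite E1 E2 !mulr0 addr0.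
  by rewrite /dotz /detz; ring.
by move/eqP; rewrite mulf_eq0 gt_eqF ?(lt_le_trans ltr01 (dotz_ge1 k0)) // => /eqP.
Qed.

(** The squared form of | |xi|^2 - Lam | <= sqrt(dl Lam). *)
Definition annulus (Lam dl : R) xi := (normz xi - Lam) ^+ 2 <= dl * Lam.

(** As det(p, k)^2 + (p.k)^2 = |p|^2 |k|^2 and |p|^2 is close to Lam on the annulus, this says that
    p.k is small compared with |p| |k|, and it depends on [p] only through the line of direction [k]
    on which it lies. *)
Definition tangent (Lam eta : R) p k := (1 - eta) * Lam * normz k <= (detz p k)%:~R ^+ 2.

(** Here P = |p|^2, n = |q - p|^2, b = p.(q - p) and d = det(p, q - p). Both P and |q|^2 = P + 2 b +
    n are within sqrt(dl Lam) of Lam, which forces b^2 <= 2 dl Lam + D^2 / 2. This is small with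
    respect to Lam, so nearly all of P n is d^2. *)
Lemma tangent_numeric (Lam dl eta D P b n d : R) :
  1 <= dl * Lam -> 6 * dl <= eta -> D ^+ 2 <= eta * Lam -> 0 < dl ->
  1 <= n -> n <= D -> P * n = b ^+ 2 + d ^+ 2 ->
  (P - Lam) ^+ 2 <= dl * Lam -> (P + 2 * b + n - Lam) ^+ 2 <= dl * Lam ->
  (1 - eta) * Lam * n <= d ^+ 2.
Proof.
move=> s1 de DL d0 n1 nD E HP HQ; set s := dl * Lam in s1 HP HQ.
have sP : Lam - P <= s.
  rewrite leNgt; apply/negP => sl.
  have : s * s < (P - Lam) ^+ 2 by rewrite -sqrrN expr2; apply: ltr_pM; lra.
  have : s <= s * s by rewrite ler_peMl //; lra.
  by lra.
have Hb : b ^+ 2 <= 2 * s + D ^+ 2 / 2.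
  have n2 : n ^+ 2 <= D ^+ 2 by rewrite !expr2; apply: ler_pM; lra.
  set x := P - Lam in HP; have E2 : P + 2 * b + n - Lam = x + 2 * b + n by rewrite /x; ring.
  rewrite {}E2 in HQ; move: HP HQ n2; clear => HP HQ n2; have := sqr_ge0 (x + (x + 2 * b + n)).
  have := sqr_ge0 (2 * b + 2 * n); lra.
have L0 : 0 < Lam by rewrite -(pmulr_rgt0 _ d0) -/s; lra.
have dl2 : 6 * s <= eta * Lam by rewrite /s mulrA ler_wpM2r // ltW.
have : n * (Lam - s) <= n * P by rewrite ler_wpM2l; lra.
have : (eta * Lam) <= eta * Lam * n by rewrite ler_peMr //; lra.
have : s <= s * n by rewrite ler_peMr //; lra.
have : s * n * 6 <= eta * Lam * n by rewrite mulrC mulrA ler_wpM2r //; lra.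
lra.
Qed.

(** For two tangent vectors k and k' of squared length at most D, e = det(k, k') satisfies P e = b
    d' - b' d. The scalar products b are of order sqrt(eta Lam D) and the determinants d of order
    sqrt(Lam D), while P >= Lam / 2; altogether e^2 <= 64 eta D^2, which is below 1 by the choice of
    the factor 100. An integer e must then vanish. *)
Lemma parallel_numeric (Lam eta D P n n' b b' d d' e : R) :
  0 < Lam -> 0 < eta -> 1 <= D -> 100 * eta * D ^+ 2 <= 1 -> 0 <= n -> n <= D -> 0 <= n' -> n' <= D ->
  P * n = b ^+ 2 + d ^+ 2 -> P * n' = b' ^+ 2 + d' ^+ 2 -> P * e = b * d' - b' * d ->
  (1 - eta) * Lam <= P <= (1 + eta) * Lam ->
  (1 - eta) * Lam * n <= d ^+ 2 -> (1 - eta) * Lam * n' <= d' ^+ 2 -> e ^+ 2 < 1.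
Proof.
move=> L0 e0 D1 eD n0 nD n0' nD' E E' Ee /andP[P1 P2] T T'.
have D2 : 1 <= D ^+ 2 by rewrite expr_ge1 // (le_trans ler01).
have e1 : 100 * eta <= 1.
  by apply: le_trans eD; rewrite ler_peMr // mulr_ge0 // ltW.
have eL : eta * Lam <= Lam / 100 by rewrite -ler_pdivlMr // mulrAC divff ?gt_eqF // mul1r; lra.
have key (x y c : R) : 0 <= c -> c <= D -> P * c = x ^+ 2 + y ^+ 2 -> (1 - eta) * Lam * c <= y ^+ 2 ->
    x ^+ 2 <= 2 * eta * Lam * D /\ y ^+ 2 <= 2 * Lam * D.
  move=> c0 cD Ec Tc.
  have H : P * c <= (1 + eta) * Lam * c by rewrite ler_wpM2r.
  have H2 : eta * Lam * c <= eta * Lam * D by rewrite ler_wpM2l // mulr_ge0 // ltW.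
  have H3 : Lam * c <= Lam * D by rewrite ler_wpM2l // ltW.
  have H4 : eta * Lam * c <= Lam / 100 * c by rewrite ler_wpM2r.
  have x0 := sqr_ge0 x; have y0 := sqr_ge0 y.
  move: H H2 H3 H4 x0 y0 Ec Tc; clear.
  have -> : (1 + eta) * Lam * c = Lam * c + eta * Lam * c by ring.
  have -> : (1 - eta) * Lam * c = Lam * c - eta * Lam * c by ring.
  have -> : 2 * eta * Lam * D = 2 * (eta * Lam * D) by ring.
  have -> : 2 * Lam * D = 2 * (Lam * D) by ring.
  have -> : Lam / 100 * c = Lam * c / 100 by ring.
  by split; lra.
have [B1 B2] := key _ _ _ n0 nD E T; have [B1' B2'] := key _ _ _ n0' nD' E' T'.
have X : P ^+ 2 * e ^+ 2 <= 16 * eta * Lam ^+ 2 * D ^+ 2.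
  rewrite -exprMn Ee.
  have Y : (b * d') ^+ 2 <= (2 * eta * Lam * D) * (2 * Lam * D).
    by rewrite exprMn; apply: ler_pM; rewrite ?sqr_ge0.
  have Y' : (b' * d) ^+ 2 <= (2 * eta * Lam * D) * (2 * Lam * D).
    by rewrite exprMn; apply: ler_pM; rewrite ?sqr_ge0.
  have := sqr_ge0 (b * d' + b' * d).
  have -> : 16 * eta * Lam ^+ 2 * D ^+ 2 = 4 * ((2 * eta * Lam * D) * (2 * Lam * D)) by ring.
  move: Y Y'; clear; move: (_ * (2 * Lam * D)) (b * d') (b' * d) => c x y; lra.
rewrite ltNge; apply/negP => ge1.
have PL : Lam / 2 <= P by lra.
have P3 : (Lam / 2) ^+ 2 <= P ^+ 2 by rewrite !expr2; apply: ler_pM; lra.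
have : P ^+ 2 <= P ^+ 2 * e ^+ 2 by rewrite ler_peMr // sqr_ge0.
have L2 : 0 < Lam ^+ 2 by rewrite exprn_gt0.
have : 100 * (Lam ^+ 2 * (eta * D ^+ 2)) <= Lam ^+ 2.
  have -> : 100 * (Lam ^+ 2 * (eta * D ^+ 2)) = Lam ^+ 2 * (100 * eta * D ^+ 2) by ring.
  by rewrite ler_piMr // ltW.
have E3 : (Lam / 2) ^+ 2 = Lam ^+ 2 / 4 by field.
have E4 : 16 * eta * Lam ^+ 2 * D ^+ 2 = 16 * (Lam ^+ 2 * (eta * D ^+ 2)) by ring.
rewrite {}E3 in P3; rewrite {}E4 in X.
move: X P3 L2; clear; move: (P ^+ 2) (Lam ^+ 2) (_ * e ^+ 2) (_ * (_ * D ^+ 2)) => x y z w; lra.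
Qed.

(** * Classes of frequencies in the annulus *)

Section labels.
Variables (D : nat) (Lam eta dl : R).
Hypotheses (D0 : (0 < D)%N) (e0 : 0 < eta) (d0 : 0 < dl).
Hypotheses (eD : 100 * eta * D%:R ^+ 2 <= 1) (de : 6 * dl <= eta).
Hypotheses (s1 : 1 <= dl * Lam) (DL : D%:R ^+ 2 <= eta * Lam).

Definition frequency_box : seq (int * int) :=
  let r : seq int := [seq (i%:Z - D%:Z) | i <- iota 0 (2 * D).+1] in
  [seq (x, y) | x <- r, y <- r].

Lemma mem_frequency_box k : dotz k k <= D -> k \in frequency_box.
Proof.
case: k => x y; rewrite /dotz; cbn [fst snd] => H.
have C (u v : int) : u * u + v * v <= D -> u \in [seq (i%:Z - D%:Z) | i <- iota 0 (2 * D).+1].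
  move=> Hxy; have U1 : - D%:Z <= u <= D%:Z.
    by apply/andP; split; rewrite leNgt; apply/negP; clear - Hxy; nia.
  apply/mapP; exists (absz (u + D%:Z)); last by clear -U1; lia.
  by rewrite mem_iota; clear -U1; lia.
by rewrite allpairs_f ?(C x y) // (C y x) // addrC.
Qed.

Definition short_vectors : seq (int * int) :=
  [seq k <- frequency_box | coprimez k.1 k.2 & dotz k k <= D].

Lemma mem_short_vectors k : (k \in short_vectors) = coprimez k.1 k.2 && (dotz k k <= D).
Proof.
rewrite mem_filter -[RHS]andbT; have [/andP[_ H]|//] := boolP (_ && (dotz k k <= D)).
by rewrite mem_frequency_box.
Qed.

Let Lam0 : 0 < Lam.
Proof. by rewrite -(pmulr_rgt0 _ d0) (lt_le_trans ltr01 s1). Qed.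

Lemma annulus_bounds p : annulus Lam dl p -> (1 - eta) * Lam <= normz p <= (1 + eta) * Lam.
Proof.
rewrite /annulus; set x := normz p - Lam; have -> : normz p = x + Lam by rewrite subrK.
have s1' := s1; set s := dl * Lam in s1' *; have se : 6 * s <= eta * Lam by rewrite /s mulrA ler_wpM2r // ltW.
move=> H; have ss : x ^+ 2 <= s ^+ 2 by apply: le_trans H _; rewrite expr2 ler_peMl //; lra.
have : `|x| <= `|s| by rewrite -ler_sqr ?nnegrE ?normr_ge0 // !real_normK ?num_real.
rewrite ler_norml => /andP[]; rewrite ger0_norm; last by lra.
by move=> h1 h2; apply/andP; split; rewrite ?mulrDl ?mulrBl mul1r; lra.
Qed.

Lemma tangent_difference p q : annulus Lam dl p -> annulus Lam dl q -> q != p ->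
  dotz (q - p) (q - p) <= D -> tangent Lam eta p (q - p).
Proof.
rewrite /tangent /annulus !normzE => Ap Aq ne HD.
apply: (@tangent_numeric Lam dl eta D%:R (dotz p p)%:~R (dotz p (q - p))%:~R) => //.
- by rewrite ler1z dotz_ge1 // subr_eq0.
- by rewrite [D%:R]pmulrn ler_int.
- rewrite -intrM lagrange_identity !(intrD, intrM, rmorphXn) //=.
move: Aq; congr (_ ^+ 2 <= _); congr (_ - _).
rewrite /dotz /= !(intrD, intrM, intrN); ring.
Qed.

Lemma tangent_parallel p k j : annulus Lam dl p -> tangent Lam eta p k -> tangent Lam eta p j ->
  dotz k k <= D -> dotz j j <= D -> detz k j = 0.
Proof.
move=> /annulus_bounds Ap Tk Tj Hk Hj.
have : ((detz k j)%:~R : R) ^+ 2 < 1.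
  rewrite /tangent !normzE in Tk Tj Ap.
  apply: (@parallel_numeric Lam eta D%:R (dotz p p)%:~R (dotz k k)%:~R (dotz j j)%:~R
    (dotz p k)%:~R (dotz p j)%:~R (detz p k)%:~R (detz p j)%:~R) => //.
  - by rewrite ler1n.
  - by rewrite ler0z dotz_ge0.
  - by rewrite [D%:R]pmulrn ler_int.
  - by rewrite ler0z dotz_ge0.
  - by rewrite [D%:R]pmulrn ler_int.
  - by rewrite -intrM lagrange_identity !(intrD, intrM, rmorphXn).
  - by rewrite -intrM lagrange_identity !(intrD, intrM, rmorphXn).
  - by rewrite -!intrM -intrB; congr (_%:~R); rewrite /dotz /detz /=; ring.
rewrite -rmorphXn /= ltrz1 => H; apply/eqP; rewrite -sqrf_eq0; apply/eqP.
by move: (sqr_ge0 (detz k j)) H; clear; move: (_ ^+ 2); lia.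
Qed.

(* The short direction tangent at [p] to the circle of squared radius [Lam], which
   is unique up to sign, and the line through [p] in that direction; the last
   component separates the points without such a direction. *)
Definition label p : (int * int) * int * (int * int) :=
  if ohead [seq k <- short_vectors | tangent Lam eta p k] is Some k
  then (k, detz p k, 0) else (0, 0, p).

Lemma tangent_eq p q k : detz p k = detz q k -> tangent Lam eta p k = tangent Lam eta q k.
Proof. by rewrite /tangent => ->. Qed.

Lemma coprimez_neq0 k : coprimez k.1 k.2 -> k != 0.
Proof. by apply: contraTN => /eqP ->. Qed.

Lemma detzB p q k : detz (p - q) k = detz p k - detz q k.
Proof. by rewrite /detz /=; ring. Qed.

(** The label uses the first tangent vector in the list, which may differ from [k], so points of one
    line must have the same tangent short vectors. Any such vector is parallel to [k], hence has the
    same determinant with [p] and with [q]. *)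
Lemma tangent_transfer p q k : annulus Lam dl p -> annulus Lam dl q ->
  k \in short_vectors -> tangent Lam eta p k -> detz p k = detz q k ->
  {in short_vectors, tangent Lam eta p =1 tangent Lam eta q}.
Proof.
move=> Ap Aq; rewrite mem_short_vectors => /andP[ck kD] Tp E j.
rewrite mem_short_vectors => /andP[_ jD].
have Tq : tangent Lam eta q k by rewrite -(tangent_eq E).
have k0 := coprimez_neq0 ck.
have D0' : detz (p - q) k = 0 by rewrite detzB E subrr.
suff H : detz k j = 0 -> detz p j = detz q j.
  apply/idP/idP => T.
    by rewrite -(tangent_eq (H (tangent_parallel Ap Tp T kD jD))).
  by rewrite (tangent_eq (H (tangent_parallel Aq Tq T kD jD))).
by move=> /(detz_parallel k0 D0'); rewrite detzB => /eqP; rewrite subr_eq0 => /eqP.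
Qed.

Lemma label_tangent p q k : annulus Lam dl p -> annulus Lam dl q ->
  k \in short_vectors -> tangent Lam eta p k -> detz p k = detz q k -> label p = label q.
Proof.
move=> Ap Aq kS Tp E; have TT := tangent_transfer Ap Aq kS Tp E; rewrite /label.
rewrite -(eq_in_filter TT).
have : k \in [seq k <- short_vectors | tangent Lam eta p k] by rewrite mem_filter Tp.
case Ef: [seq _ <- _ | _] => [|j s] //= _.
have : j \in [seq k <- short_vectors | tangent Lam eta p k] by rewrite Ef mem_head.
rewrite mem_filter => /andP[Tj]; rewrite mem_short_vectors => /andP[_ jD].
move: kS; rewrite mem_short_vectors => /andP[ck kD].
congr (_, _, _); apply/eqP; rewrite -subr_eq0 -detzB; apply/eqP.
apply: (detz_parallel (coprimez_neq0 ck)); last exact: (tangent_parallel Ap).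
by rewrite detzB E subrr.
Qed.

(** The difference is tangent by [tangent_difference]; its primitive direction is no longer than the
    difference, and tangency is invariant under scaling. *)
Lemma label_near p q : annulus Lam dl p -> annulus Lam dl q -> dotz (q - p) (q - p) <= D ->
  label p = label q.
Proof.
move=> Ap Aq HD; have [->//|ne] := eqVneq q p.
have T := tangent_difference Ap Aq ne HD.
have [k [m [ck m0 E]]] : exists k m, [/\ coprimez k.1 k.2, m != 0 & q - p = scalez m k].
  by apply: primitive_vector; rewrite subr_eq0.
have nE : normz (scalez m k) = m%:~R ^+ 2 * normz k :> R by rewrite /normz /= !intrM; ring.
have dE : detz p (scalez m k) = m * detz p k by rewrite /detz /=; ring.
have m2 : 0 < (m%:~R : R) ^+ 2 by rewrite exprn_even_gt0 //= intr_eq0.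
apply: (@label_tangent p q k) => //.
- rewrite mem_short_vectors ck /=; apply: le_trans HD; rewrite E.
  have -> : dotz (scalez m k) (scalez m k) = m ^+ 2 * dotz k k by rewrite /dotz /=; ring.
  by rewrite ler_peMl ?dotz_ge0 // -gtz0_ge1 exprn_even_gt0.
- move: T; rewrite /tangent E nE dE intrM exprMn.
  by rewrite mulrCA ler_pM2l.
- apply/eqP; rewrite eq_sym -subr_eq0 -detzB E; apply/eqP; rewrite /detz /=; ring.
Qed.

(** A class that is not a single point is the whole intersection of [F] with a line; this exact
    equality is what the strip estimate on [line F k c0] requires. *)
Lemma label_class F p : {in F, forall xi, annulus Lam dl xi} -> p \in F ->
  (forall xi, xi \in F -> label xi = label p -> xi = p) \/
  exists2 k, k \in short_vectors &
    [seq xi <- F | label xi == label p] = line F k (detz p k).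
Proof.
move=> HF pF.
have headP xi k : ohead [seq k <- short_vectors | tangent Lam eta xi k] = Some k ->
    tangent Lam eta xi k /\ k \in short_vectors.
  move=> E; have : k \in [seq k <- short_vectors | tangent Lam eta xi k].
    by case: [seq _ <- _ | _] E => //= j s [->]; rewrite mem_head.
  by rewrite mem_filter => /andP.
have nz k : k \in short_vectors -> k != 0.
  by rewrite mem_short_vectors => /andP[/coprimez_neq0].
case Ep: (ohead [seq k <- short_vectors | tangent Lam eta p k]) => [k|]; last first.
  have -> : label p = (0, 0, p) by rewrite /label Ep.
  left => xi _; rewrite /label; case Ex: (ohead _) => [k|]; last by case.
  by case=> k0; have [_ /nz] := headP _ _ Ex; rewrite k0 eqxx.
have [Tk kS] := headP _ _ Ep; right; exists k => //.
apply: eq_in_filter => xi xiF; apply/eqP/eqP => [|E].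
  have -> : label p = (k, detz p k, 0) by rewrite /label Ep.
  rewrite /label; case Ex: (ohead _) => [j|]; first by case=> <-.
  by case=> k0; have := nz _ kS; rewrite -k0 eqxx.
by apply/esym; apply: (@label_tangent p xi k); rewrite ?HF.
Qed.

End labels.

End lattice_geometry.

(** * Coverings and cutoffs *)

Section covering.
Context {R : realType} (L : R) (L0 : 0 < L).
Local Notation kap := (kap L).
HB.instance Definition _ := Pointed.on (R * R)%type.
Implicit Types (x z : R * R) (G P : set (R * R)).

(** After subtraction of the nearest multiple of 2 pi, [t] lies in [-pi, pi], where cos |t|
    decreases as |t| increases. *)
Lemma cos_gap (e : R) : 0 < e ->
  exists2 s : R, 0 < s & forall t, 1 - cos t < s -> exists m : int, `|t - m%:~R * (2 * pi)| < e.
Proof.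
move=> e0; pose e' := Num.min e pi; have p0 := pi_gt0 R.
have e'0 : 0 < e' by rewrite lt_min e0.
have e'p : e' <= pi by rewrite ge_min lexx orbT.
exists (1 - cos e').
  rewrite subr_gt0 -cos0 ltr_cos //; rewrite in_itv /= ?lexx ?(ltW e'0) //=; exact: ltW.
move=> t H; pose m := Num.floor (t / (2 * pi) + 2^-1); exists m.
have p2 : 0 < 2 * pi :> R by rewrite mulr_gt0.
have := floor_itv (t / (2 * pi) + 2^-1); rewrite -/m intrD => /andP[m1 m2].
have T1 : - pi <= t - m%:~R * (2 * pi).
  have : (m%:~R - 2^-1) * (2 * pi) <= t by rewrite -ler_pdivlMr // lerBlDr.
  by rewrite mulrBl; lra.
have T2 : t - m%:~R * (2 * pi) <= pi.
  have : t <= (m%:~R + 2^-1) * (2 * pi) by rewrite -ler_pdivrMr //; lra.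
  by rewrite mulrDl; lra.
rewrite ltrD2l ltrN2 in H; apply: lt_le_trans (_ : e' <= e); last by rewrite ge_min lexx.
have E : cos t = cos `|t - m%:~R * (2 * pi)|.
  have -> : cos `|t - m%:~R * (2 * pi)| = cos (t - m%:~R * (2 * pi)).
    by case: (ger0P (t - m%:~R * (2 * pi))) => // _; rewrite cosN.
  rewrite -mulNr -intrN; have -> : 2 * pi = pi *+ 2 :> R by rewrite mulr_natl.
  by rewrite periodic_intmul //; exact: cosD2pi.
rewrite ltNge; apply/negP => ge; move: H; rewrite E ltNge => /negP; apply.
move: ge; rewrite le_eqVlt => /orP[/eqP ->//|lt]; apply: ltW.
rewrite ltr_cos //; rewrite in_itv /=; rewrite ?(ltW e'0) //.
by rewrite normr_ge0 /= ler_norml T1 T2.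
Qed.

(** A substitute for the squared distance on the circle that is smooth, periodic and itself a
    trigonometric polynomial. The factor 1/4 in [tdist] brings the values to [0, 1], the range on
    which step polynomials are used. *)
Definition gap (s y : R) : R := 1 - cos (kap * (y - s)).
Definition tdist z x : R := (gap z.1 x.1 + gap z.2 x.2) / 4.

Lemma gap_ge0 s y : 0 <= gap s y.
Proof. by rewrite subr_ge0 cos_le1. Qed.

Lemma gap_le2 s y : gap s y <= 2.
Proof. by rewrite /gap; have := cos_geN1 (kap * (y - s)); lra. Qed.

Lemma gap_self s : gap s s = 0.
Proof. by rewrite /gap subrr mulr0 cos0 subrr. Qed.

Lemma gap_periodic s : periodic (gap s) L.
Proof.
move=> y; rewrite /gap; congr (1 - _).
have -> : kap * (y + L - s) = kap * (y - s) + pi *+ 2.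
  by rewrite /kap -mulr_natl; field; rewrite gt_eqF.
exact: cosD2pi.
Qed.

Lemma tdist01 z x : 0 <= tdist z x <= 1.
Proof.
rewrite /tdist; have := (gap_ge0 z.1 x.1, gap_ge0 z.2 x.2); have := (gap_le2 z.1 x.1, gap_le2 z.2 x.2).
by move=> [? ?] [? ?]; apply/andP; split; lra.
Qed.

Lemma tdist_self z : tdist z z = 0.
Proof. by rewrite /tdist !gap_self addr0 mul0r. Qed.

Lemma tdist_lattice z k x : tdist z (x + lattice L k) = tdist z x.
Proof. by rewrite /tdist /lattice /= !periodic_intmul //; exact: gap_periodic. Qed.

Lemma smooth_gap s (a b : R) : smooth (fun x : R * R => gap s (a * x.1 + b * x.2)).
Proof.
have := smoothB (smooth_cst 1) (smooth_cos (smoothB (smooth_linear (kap * a) (kap * b)) (smooth_cst (kap * s)))).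
by congr smooth; apply/funext => x; rewrite /gap; congr (1 - cos _); ring.
Qed.

Lemma smooth_tdist z : smooth (tdist z).
Proof.
have := smoothZ 4^-1 (smoothD (smooth_gap z.1 1 0) (smooth_gap z.2 0 1)).
congr smooth; apply/funext => x; rewrite /tdist mulrC.
by rewrite !mul1r !mul0r addr0 add0r.
Qed.

Lemma rtrigp_tdist z : rtrigp L (tdist z).
Proof.
have H (xi : int * int) (t : R) := rtrigp_cos L xi t.
have := rtrigpM (rtrigp_cst L 4^-1) (rtrigpB (rtrigpB (rtrigp_cst L 2) (H (1, 0) (- kap * z.1))) (H (0, 1) (- kap * z.2))).
congr rtrigp; apply/funext => x; rewrite /tdist /gap /phase /=.
rewrite !mul0r addr0 add0r !mul1r.
have -> : kap * x.1 + - kap * z.1 = kap * (x.1 - z.1) by ring.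
have -> : kap * x.2 + - kap * z.2 = kap * (x.2 - z.2) by ring.
by move: (cos _) (cos _) => u v; field.
Qed.

Lemma gap_small (d : R) : 0 < d -> exists2 s : R, 0 < s &
  forall a y, gap a y < s -> exists m : int, `|y + m%:~R * L - a| < d.
Proof.
move=> d0; have k0 := kap_gt0 L0.
have [s s0 H] := cos_gap (mulr_gt0 k0 d0); exists s => // a y /H[m Hm]; exists (- m).
move: Hm; have -> : kap * (y - a) - m%:~R * (2 * pi) = kap * (y + (- m)%:~R * L - a).
  by rewrite intrN /kap; field; rewrite gt_eqF.
by rewrite normrM gtr0_norm // ltr_pM2l.
Qed.

Lemma open_box G z : open G -> G z -> exists2 d : R, 0 < d &
  forall x, `|x.1 - z.1| < d -> `|x.2 - z.2| < d -> G x.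
Proof.
move=> oG Gz; have : nbhs z G by apply: open_nbhs_nbhs.
move=> /nbhs_ballP[d /= d0 H]; exists d => // x h1 h2; apply: H; split => /=.
  by rewrite /ball /= distrC.
by rewrite /ball /= distrC.
Qed.

Lemma open_tdist G z : open G -> periodic_set L G -> G z ->
  exists2 t : R, 0 < t & forall x, tdist z x < 4 * t -> G x.
Proof.
move=> oG pG /(open_box oG)[d d0 H].
have [s s0 Hs] := gap_small d0; exists (s / 16); first by rewrite divr_gt0.
move=> x; rewrite /tdist => Hx.
have [g1 g2] := (gap_ge0 z.1 x.1, gap_ge0 z.2 x.2).
have [|m1 h1] := Hs z.1 x.1; first by lra.
have [|m2 h2] := Hs z.2 x.2; first by lra.
by apply/(pG (m1, m2)); apply: H.
Qed.

Lemma to_cell x : exists k, cell L (x + lattice L k).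
Proof.
have E (y : R) : exists m : int, 0 <= y + m%:~R * L < L.
  exists (- Num.floor (y / L)); have /andP[] := floor_itv (y / L).
  by rewrite ler_pdivlMr // ltr_pdivrMr // intrD intrN mulrDl mul1r mulNr => ? ?; apply/andP; split; lra.
have [m1 h1] := E x.1; have [m2 h2] := E x.2; exists (m1, m2).
by split; rewrite /= in_itv.
Qed.

(** Compactness is applied to the part of [P] in one closed cell; periodicity of the sets [f z]
    spreads the finite subcover over the plane. *)
Lemma periodic_cover P (f : R * R -> set (R * R)) : closed P -> periodic_set L P ->
  (forall z, P z -> f z z) -> (forall z, open (f z)) -> (forall z, periodic_set L (f z)) ->
  exists s : seq (R * R), (forall z, z \in s -> P z) /\
    (forall x, P x -> exists2 z, z \in s & f z x).
Proof.
move=> cP pP fz of_ pf.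
have K : compact (P `&` (`[0, L]%classic `*` `[0, L]%classic)).
  rewrite setIC; apply: compact_closedI => //; exact: closed_cell_compact.
have K' : @cover_compact (R * R)%type (P `&` (`[0, L]%classic `*` `[0, L]%classic)).
  by rewrite -compact_cover; exact: K.
have [||s sP Hs] := K' (R * R)%type P f.
- by move=> z _; exact: of_.
- by move=> x [Px _]; exists x => //; exact: fz.
exists (finmap.enum_fset s); split; first by move=> z zs; have := sP z zs; rewrite inE.
move=> x Px; have [k [/= c1 c2]] := to_cell x.
have [|z zs fzx] := Hs (x + lattice L k).
  split; first exact/pP.
  by move: c1 c2; rewrite !in_itv /= => /andP[a1 /ltW b1] /andP[a2 /ltW b2]; split => /=;
    rewrite in_itv /= ?a1 ?a2.
by exists z => //; apply/(pf z k).
Qed.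

End covering.

(** * Control polynomials around the obstacle *)

Section control.
Context {R : realType} (L : R) (L0 : 0 < L).
Local Notation T2 := (measurableTypeR R * measurableTypeR R)%type.
Implicit Types (x z : R * R) (G O : set (R * R)) (s : seq ((R * R) * R)) (rho : R * R -> R).

Lemma step_choice (y0 y1 eps : R) : y0 < 2^-1 -> 2^-1 < y1 -> 0 < eps ->
  exists n, forall y, 0 <= y <= 1 ->
    (y <= y0 -> step_poly n y <= eps) /\ (y1 <= y -> 1 - eps <= step_poly n y).
Proof.
move=> h0 h1 e0.
have small (q : R) : 0 <= q -> q < 1 -> \forall n \near \oo, q ^+ n < eps.
  move=> q0 q1; have := @cvg_expr _ q; rewrite ger0_norm // => /(_ q1).
  by move=> /cvgr_lt; apply.
have q1 : (2 * y1)^-1 < 1 by rewrite invf_lt1; lra.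
pose z0 := Num.max y0 0.
have z00 : 0 <= z0 by rewrite le_max lexx orbT.
have z01 : z0 < 2^-1 by rewrite gt_max h0 invr_gt0 ltr0n.
near \oo => n; exists n => y /andP[yge yle]; split => hy.
  apply: le_trans (step_poly_lt n _) _; first by rewrite yge.
  apply: (@le_trans _ _ ((2 * z0) ^+ n)).
    by apply: lerXn2r; rewrite ?nnegrE ?mulr_ge0 // ler_pM2l // le_max hy.
  by apply: ltW; near: n; apply: small; lra.
have y0' : 0 < y by lra.
have : 1 - step_poly n y <= eps; last by lra.
apply: le_trans (step_poly_gt n _) _; first by rewrite y0'.
rewrite -exprVn; apply: (@le_trans _ _ ((2 * y1)^-1 ^+ n)).
  apply: lerXn2r; rewrite ?nnegrE ?invr_ge0 ?mulr_ge0 //; try lra.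
  by rewrite lef_pV2 ?posrE ?mulr_gt0 ?ler_pM2l //; lra.
by apply: ltW; near: n; apply: small => //; rewrite invr_ge0; lra.
Unshelve. all: by end_near. Qed.

(** An affine map sends the midpoint of [a] and [b] to 1/2, and a step polynomial of high degree
    separates the two sides. The slope [be] is small enough for the values to stay in [0, 1]. *)
Lemma threshold_poly (t : R * R -> R) (a b eps : R) : rtrigp L t ->
  (forall x, 0 <= t x <= 1) -> 0 < a -> a < b -> 0 < eps ->
  exists rho, [/\ rtrigp L rho, (forall x, 0 <= rho x <= 1),
    (forall x, t x <= a -> 1 - eps <= rho x) & (forall x, b <= t x -> rho x <= eps)].
Proof.
move=> tt t01 a0 ab e0; pose be := (2 * (1 + a + b))^-1.
have d0 : 0 < 1 + a + b by lra.
have be0 : 0 < be by rewrite invr_gt0 mulr_gt0.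
have beE : be * (1 + a + b) = 2^-1 by rewrite /be; field; rewrite gt_eqF.
pose y x := 2^-1 + be * ((a + b) / 2 - t x).
have y01 x : 0 <= y x <= 1.
  have /andP[t0 t1] := t01 x; rewrite /y.
  have : be * (t x - (a + b) / 2) <= be * (1 + a + b) by rewrite ler_pM2l //; lra.
  have : be * ((a + b) / 2 - t x) <= be * (1 + a + b) by rewrite ler_pM2l //; lra.
  rewrite beE => h1 h2; apply/andP; split; last by lra.
  by have -> : be * ((a + b) / 2 - t x) = - (be * (t x - (a + b) / 2)) by [ring]; lra.
pose g := be * ((b - a) / 2); have g0 : 0 < g by rewrite mulr_gt0 //; lra.
have [|||n Hn] := @step_choice (2^-1 - g) (2^-1 + g) eps; [lra|lra|by []|].
exists (fun x => step_poly n (y x)); split.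
- apply: rtrigp_step; apply: rtrigpD; first exact: rtrigp_cst.
  by apply: rtrigpM; [exact: rtrigp_cst|apply: rtrigpB => //; exact: rtrigp_cst].
- by move=> x; exact: step_poly01.
- move=> x tx; have [_] := Hn _ (y01 x); apply; rewrite /y /g lerD2l ler_pM2l //; lra.
- move=> x tx; have [+ _] := Hn _ (y01 x); apply; rewrite /y /g lerD2l -mulrN ler_pM2l //; lra.
Qed.

(** With r the second component of an entry, the balls of radius r cover the closed obstacle and the
    cutoff vanishes on them; outside all balls of radius 2 r the cutoff is 1, while inside their
    union, the [collar], the control polynomial is at least 1/2. Between 2 r and 4 r this polynomial
    can decrease before [G] is left. *)
Definition good_cover O G s :=
  (forall p, p \in s -> 0 < p.2 /\ forall x, tdist L p.1 x < 4 * p.2 -> G x) /\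
  (forall x, closure O x -> exists2 p, p \in s & tdist L p.1 x < p.2).

Definition collar s : set (R * R) := [set x | exists2 p, p \in s & tdist L p.1 x < 2 * p.2].

Lemma continuous_tdist z : continuous (tdist L z).
Proof. exact/smooth_continuous/smooth_tdist. Qed.

Lemma open_tdist_lt z (t : R) : open [set x | tdist L z x < t].
Proof.
have := @open_comp _ _ (tdist L z) [set y : R | y < t] (fun x _ => @continuous_tdist z x).
by apply; exact: open_lt.
Qed.

Lemma periodic_closure O : periodic_set L O -> periodic_set L (closure O).
Proof.
move=> pO; have H k x : closure O x -> closure O (x + lattice L k).
  move=> cx B NB; have := cx [set y | B (y + lattice L k)].
  case.
    apply: (@continuousD _ _ _ id (fun=> lattice L k) x) => //; first exact: cvg_cst.
  by move=> y [Oy By]; exists (y + lattice L k); split => //; exact/pO.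
move=> k x; split; last exact: H.
move=> /(H (- k)); congr (closure O _); rewrite -addrA; apply/eqP.
rewrite -subr_eq0 addrAC subrr add0r; apply/eqP; rewrite /lattice /= !intrN.
by congr pair; rewrite /= mulNr subrr.
Qed.

Lemma exists_good_cover O G : open G -> periodic_set L G -> periodic_set L O ->
  closure O `<=` G -> O !=set0 -> exists s, good_cover O G s /\ s != [::].
Proof.
move=> oG pG pO cOG [w Ow].
have pc := periodic_closure pO.
have /choice[tau Ht] : forall z : R * R, exists t : R, closure O z -> 0 < t /\
    forall x, tdist L z x < 4 * t -> G x.
  move=> z; have [Oz|nOz] := pselect (closure O z); last by exists 0 => /nOz.
  by have [t t0 H] := open_tdist L0 oG pG (cOG _ Oz); exists t.
have [|||s [sO Hs]] := @periodic_cover R L L0 (closure O) (fun z => [set x | tdist L z x < tau z]) (@closed_closure _ O) pc.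
- by move=> z Oz /=; rewrite tdist_self; have [] := Ht z Oz.
- by move=> z; exact: open_tdist_lt.
- by move=> z k x /=; rewrite tdist_lattice.
exists [seq (z, tau z) | z <- s]; split; first split.
- by move=> p /mapP[z zs ->] /=; apply: Ht; exact: sO.
- by move=> x /Hs[z zs Hz]; exists (z, tau z) => //; exact: map_f.
have [z zs _] := Hs w (subset_closure Ow).
by case: s zs {sO Hs}.
Qed.

Lemma control_poly O G s (eps : R) : good_cover O G s -> 0 < eps ->
  exists rho, [/\ rtrigp L rho, (forall x, 0 <= rho x <= 1),
    (forall x, collar s x -> 2^-1 <= rho x) & (forall x, ~ G x -> rho x <= eps)].
Proof.
move=> [Hs _] e0.
(* The covering property is not inherited by the tail of [s], so the induction is on a statement
   about the balls alone. *)
suff [rho [tr r01 r1 r2]] : exists rho, [/\ rtrigp L rho, (forall x, 0 <= rho x <= 1),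
    (forall x, collar s x -> 2^-1 <= rho x) &
    (forall x, (forall p, p \in s -> 4 * p.2 <= tdist L p.1 x) -> rho x <= eps)].
  exists rho; split => // x nG; apply: r2 => p ps; have [_ H] := Hs p ps.
  by rewrite leNgt; apply/negP => /H.
have {}Hs p : p \in s -> 0 < p.2 by case/Hs.
elim: s eps e0 Hs => [|p s IH] eps e0 Hs.
  exists (fun=> 0); split; [exact: rtrigp_cst|by move=> x; rewrite lexx ler01|by move=> x []|].
  by move=> x _; exact: ltW.
have [||rho [tr r01 r1 r2]] := IH (eps / 2); first by rewrite divr_gt0.
  by move=> q qs; apply: Hs; rewrite inE qs orbT.
have p0 : 0 < p.2 by apply: Hs; rewrite mem_head.
have [|||rho' [tr' r01' r1' r2']] := @threshold_poly (tdist L p.1) (2 * p.2) (4 * p.2) (Num.min (eps / 2) 2^-1)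
  (rtrigp_tdist L p.1) (tdist01 L p.1).
- by rewrite mulr_gt0.
- by rewrite ltr_pM2r // ltr_nat.
- by rewrite lt_min divr_gt0 //= invr_gt0.
(* This is 1 - (1 - rho)(1 - rho'): with values in [0, 1], at least each of the two and at most
   their sum. *)
exists (fun x => rho x + rho' x - rho x * rho' x); split.
- by apply: rtrigpB; [exact: rtrigpD|exact: rtrigpM].
- move=> x; have /andP[a0 a1] := r01 x; have /andP[b0 b1] := r01' x.
  have := mulr_ge0 a0 b0; have h : 0 <= (1 - rho x) * (1 - rho' x) by rewrite mulr_ge0 ?subr_ge0.
  have h2 : rho x * rho' x <= rho x by rewrite ler_piMr.
  by move=> ?; apply/andP; split; lra.
- move=> x [q]; have /andP[a0 a1] := r01 x; have /andP[b0 b1] := r01' x; rewrite inE => /predU1P[->|qs] Hq.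
    have := r1' x (ltW Hq).
    have h : 1 - 2^-1 <= 1 - Num.min (eps / 2) 2^-1 by rewrite lerD2l lerN2 ge_min lexx orbT.
    have h2 : rho x * rho' x <= rho x by rewrite ler_piMr.
    by move=> h3; lra.
  have h1 : 2^-1 <= rho x by apply: r1; exists q.
  have h2 : rho x * rho' x <= rho' x by rewrite ler_piMl.
  by lra.
- move=> x Hx; have /andP[a0 a1] := r01 x; have /andP[b0 b1] := r01' x.
  have h1 : rho x <= eps / 2 by apply: r2 => q qs; apply: Hx; rewrite inE qs orbT.
  have h2 : rho' x <= eps / 2.
    by apply: le_trans (r2' x _) _; [apply: Hx; rewrite mem_head|rewrite ge_min lexx].
  by have := mulr_ge0 a0 b0; lra.
Qed.

(** A translate z' of the centre lies in the half-open cell, and the ball contains a small square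
    with lower left corner z' that stays in the cell. The bound is the normalised area of this
    square, the same for all [g]. *)
Lemma avg_ball_gt0 z (t : R) : 0 < t -> exists2 m : R, 0 < m &
  forall g, intg L g -> (forall x, 0 <= g x) -> (forall x, tdist L z x < t -> 1 <= g x) -> m <= avg L g.
Proof.
move=> t0; have [k [/= c1 c2]] := to_cell L0 z; pose z' := z + lattice L k.
have oB := @open_tdist_lt z t.
have Bz : [set x | tdist L z x < t] z' by rewrite /mkset /z' (tdist_lattice L0) tdist_self.
have [d d0 Hd] := open_box oB Bz.
move: c1 c2; rewrite !in_itv /= => /andP[a1 b1] /andP[a2 b2].
have [e [e0 ed e1 e2]] : exists e : R, [/\ 0 < e, e < d, z'.1 + e <= L & z'.2 + e <= L].
  exists (Num.min (d / 2) (Num.min (L - z'.1) (L - z'.2))); split.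
  - by rewrite !lt_min divr_gt0 //= !subr_gt0 b1 b2.
  - by rewrite gt_min ltr_pdivrMr // ltr_pMr // ltr1n.
  - by rewrite -lerBrDl !ge_min lexx !orbT.
  - by rewrite -lerBrDl !ge_min lexx !orbT.
pose I1 : set R := `[z'.1, z'.1 + e[%classic; pose I2 : set R := `[z'.2, z'.2 + e[%classic.
pose Q : set T2 := I1 `*` I2.
have m1 : measurable I1 by exact: measurable_itv.
have m2 : measurable I2 by exact: measurable_itv.
have mQ : measurable Q by exact: measurableX.
have QC : Q `<=` cell L.
  move=> x []; rewrite /I1 /I2 /= !in_itv /= => /andP[h1 h2] /andP[h3 h4]; split => /=; rewrite in_itv /=.
    by rewrite (le_trans a1 h1) (lt_le_trans h2 e1).
  by rewrite (le_trans a2 h3) (lt_le_trans h4 e2).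
have muQ : leb2 Q = (e ^+ 2)%:E.
  etransitivity; first exact: (product_measure1E lebesgue_measure lebesgue_measure m1 m2).
  have E (y : R) : lebesgue_measure (`[y, y + e[%classic : set R) = e%:E.
    by rewrite lebesgue_measure_itv /= lte_fin ltrDl e0 -EFinB addrAC subrr add0r.
  transitivity (e%:E * e%:E)%E; first by congr (_ * _)%E; exact: E.
  by rewrite -EFinM.
have aQ : avg L (\1_Q : R * R -> R) = (L ^+ 2)^-1 * e ^+ 2.
  rewrite /avg /Rintegral; congr (_ * _).
  have -> : (\int[leb2]_(x in cell L) (\1_Q x)%:E = (e ^+ 2)%:E)%E; last by [].
  rewrite integral_indic //; last exact: measurable_cell.
  by rewrite setIidl.
exists ((L ^+ 2)^-1 * e ^+ 2).
  by rewrite mulr_gt0 ?invr_gt0 ?exprn_gt0.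
move=> g ig g0 Hg; rewrite -aQ; apply: avg_le => //.
  exact/(bdd_intg L0)/indic_bdd.
move=> x _; rewrite indicE; case: (boolP (x \in Q)) => [|_]; last exact: g0.
rewrite inE => -[]; rewrite /I1 /I2 /= !in_itv /= => /andP[h1 h2] /andP[h3 h4]; apply: Hg; apply: Hd.
  by rewrite ger0_norm ?subr_ge0 // ltrBlDl (lt_trans h2) // ltrD2l.
by rewrite ger0_norm ?subr_ge0 // ltrBlDl (lt_trans h4) // ltrD2l.
Qed.

End control.

(** * The cutoff that vanishes near the obstacle *)

Section cutoff_functions.
Context {R : realType} (L : R) (L0 : 0 < L).
Implicit Types (x z : R * R) (G O : set (R * R)) (s : seq ((R * R) * R)) (f : R * R -> R).

Lemma periodic_bounded f : continuous f -> periodic_on L setT f ->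
  exists M : R, forall x, `|f x| <= M.
Proof.
move=> cf pf; have [_ [M HM]] := continuous_bdd L cf; exists M => x.
by have [k ck] := to_cell L0 x; rewrite -(pf k x) //; exact: HM.
Qed.

Lemma derive_open0 f (c : R) (W : set (R * R)) (v : R * R) : open W ->
  (forall x, W x -> f x = c) -> forall x, W x -> 'D_v f x = 0.
Proof.
move=> oW H x Wx; have N : \near x, f x = (fun=> c) x.
  have : nbhs x W by apply: open_nbhs_nbhs.
  by apply: filterS => y; exact: H.
by rewrite (near_eq_derive v N) derive_cst.
Qed.

Lemma periodic_Lap f : periodic_on L setT f -> periodic_on L setT (Lap f).
Proof.
move=> pf.
have p1 : periodic_on L setT (d1 (d1 f)) := periodic_derive (1, 0) (periodic_derive (1, 0) pf).
have p2 : periodic_on L setT (d2 (d2 f)) := periodic_derive (0, 1) (periodic_derive (0, 1) pf).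
move=> k x _; have e1 : d1 (d1 f) (x + lattice L k) = d1 (d1 f) x by exact: p1.
have e2 : d2 (d2 f) (x + lattice L k) = d2 (d2 f) x by exact: p2.
by rewrite /Lap e1 e2.
Qed.

(** Strict inequalities make this set open, so the derivatives of the cutoff, which is constant on
    it, vanish there; the complement of [G] lies inside. *)
Definition outer s : set (R * R) := [set x | forall p, p \in s -> 2 * p.2 < tdist L p.1 x].

Lemma open_outer s : open (outer s).
Proof.
elim: s => [|p s IH].
  have -> : outer [::] = setT by apply/seteqP; split => // x _ p.
  exact: openT.
have -> : outer (p :: s) = [set x | 2 * p.2 < tdist L p.1 x] `&` outer s.
  apply/seteqP; split => x /= H.
    by split; [apply: H; rewrite mem_head|move=> q qs; apply: H; rewrite inE qs orbT].
  by case: H => h1 h2 q; rewrite inE => /predU1P[->//|/h2].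
apply: openI => //.
have := @open_comp _ _ (tdist L p.1) [set y : R | 2 * p.2 < y] (fun x _ => @continuous_tdist R L p.1 x).
by apply; exact: open_gt.
Qed.

Definition cutoff_fun s x : R := \prod_(p <- s) (1 - bump (p.2^-1 * tdist L p.1 x)).

Lemma smooth_cutoff s : smooth (cutoff_fun s).
Proof.
apply: smooth_prod => p; apply: smoothB; first exact: smooth_cst.
by apply: smooth_bump; apply: smoothZ; exact: smooth_tdist.
Qed.

Lemma cutoff0 s p x : p \in s -> 0 < p.2 -> tdist L p.1 x <= p.2 -> cutoff_fun s x = 0.
Proof.
move=> ps p0 H; rewrite /cutoff_fun (big_rem p) //= bump1 ?subrr ?mul0r //.
by rewrite mulrC ler_pdivrMr // mul1r.
Qed.

Lemma cutoff1 s x : (forall p, p \in s -> 0 < p.2) ->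
  (forall p, p \in s -> 2 * p.2 <= tdist L p.1 x) -> cutoff_fun s x = 1.
Proof.
move=> p0 H; rewrite /cutoff_fun big_seq big1 // => p ps.
by rewrite bump0 ?subr0 // mulrC ler_pdivlMr ?p0 // H.
Qed.

Lemma interior_billiard O : (billiard O)° = ~` closure O.
Proof. by rewrite /billiard interiorC. Qed.

(** The points where [f] is nonzero lie in the complement of [U], which is closed, so their closure
    does not meet the closed obstacle. *)
Lemma test_vanishing O U f : open U -> closure O `<=` U -> periodic_on L setT f -> smooth f ->
  (forall x, U x -> f x = 0) -> test_function L O f.
Proof.
move=> oU OU pf sf H; split => //; rewrite interior_billiard => x Hx cOx.
have cU : closed (~` U) by rewrite closedC.
have : (~` U) x.
  rewrite (iffLR (closure_id _) cU); move: x Hx cOx => x Hx _; move: x Hx; apply: closureS.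
  by move=> x /= ne Ux; move/eqP: ne; apply; exact: H.
by apply; exact: OU.
Qed.

Lemma test_cutoff O G s : good_cover L O G s -> test_function L O (cutoff_fun s).
Proof.
move=> [Hs Hc]; pose U := [set x | exists2 p, p \in s & tdist L p.1 x < p.2].
apply: (@test_vanishing O U).
- have -> : U = \bigcup_(p in [set` s]) [set x | tdist L p.1 x < p.2].
    by apply/seteqP; split => x [p ps Hp]; exists p.
  by apply: bigcup_open => p _; exact: open_tdist_lt.
- exact: Hc.
- by move=> k x _; apply: eq_bigr => p _; rewrite tdist_lattice.
- exact: smooth_cutoff.
- move=> x [p ps Hp]; have [p0 _] := Hs p ps; apply: (cutoff0 ps p0); exact: ltW.
Qed.

Lemma tail_cutoff O G s : good_cover L O G s -> exists chi (M : R),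
  [/\ test_function L O chi, 0 <= M &
   [/\ forall x, (1 - chi x) ^+ 2 <= M * \1_G x, forall x, d1 chi x ^+ 2 <= M * \1_G x,
       forall x, d2 chi x ^+ 2 <= M * \1_G x & forall x, Lap chi x ^+ 2 <= M * \1_G x]].
Proof.
move=> gc; have tc := test_cutoff gc; have [Hs _] := gc.
have one x : outer s x -> cutoff_fun s x = 1.
  by move=> H; apply: cutoff1 => p ps; [have [] := Hs p ps|apply/ltW/H].
move: (cutoff_fun s) tc one => chi tc one; have [pc sc _] := tc.
have out x : ~ G x -> outer s x.
  move=> nG p ps; have [p0 H] := Hs p ps.
  have : 4 * p.2 <= tdist L p.1 x by rewrite leNgt; apply/negP => /H.
  by apply: lt_le_trans; rewrite ltr_pM2r // ltr_nat.
have D (v x : R * R) : outer s x -> 'D_v chi x = 0.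
  exact: (@derive_open0 chi 1 (outer s) v (@open_outer s) one x).
have DD (v v' x : R * R) : outer s x -> 'D_v' ('D_v chi) x = 0.
  exact: (@derive_open0 ('D_v chi) 0 (outer s) v' (@open_outer s) (D v) x).
have bound f : smooth f -> periodic_on L setT f -> (forall x, outer s x -> f x = 0) ->
    exists2 M : R, 0 <= M & forall x, f x ^+ 2 <= M * \1_G x.
  move=> sf pf f0; have [M HM] := periodic_bounded (smooth_continuous sf) pf.
  exists (M ^+ 2); first exact: sqr_ge0.
  move=> x; rewrite indicE; case: (boolP (x \in G)) => [_|/negP xG]; last first.
    by rewrite f0 ?expr0n /= ?mulr0 //; apply: out => Gx; apply: xG; rewrite inE.
  rewrite mulr1 -(real_normK (num_real (f x))) lerXn2r ?nnegrE //.
  exact: le_trans (HM x).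
have pD (v : R * R) := periodic_derive v pc; have sD (v : R * R) := smooth_derive v sc.
have [|||M0 M0_ H0] := bound (fun x => 1 - chi x).
- by apply: smoothB => //; exact: smooth_cst.
- by move=> k x _; rewrite pc.
- by move=> x /one ->; rewrite subrr.
have [|M1 M1_ H1] := bound _ (sD (1, 0)) (pD (1, 0)); first exact: D.
have [|M2 M2_ H2] := bound _ (sD (0, 1)) (pD (0, 1)); first exact: D.
have [||M3 M3_ H3] := bound (Lap chi) (smooth_Lap sc).
- exact: periodic_Lap.
- move=> x ox; have E1 : d1 (d1 chi) x = 0 := DD (1, 0) (1, 0) x ox.
  have E2 : d2 (d2 chi) x = 0 := DD (0, 1) (0, 1) x ox.
  by rewrite /Lap E1 E2 addr0.
exists chi, (M0 + M1 + M2 + M3); split => //; first by rewrite !addr_ge0.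
have le f (m : R) : (forall x, f x ^+ 2 <= m * \1_G x) -> m <= M0 + M1 + M2 + M3 ->
    forall x, f x ^+ 2 <= (M0 + M1 + M2 + M3) * \1_G x.
  move=> H mle x; apply: le_trans (H x) _; exact: ler_wpM2r.
by split; [apply: (le _ _ H0)|apply: (le _ _ H1)|apply: (le _ _ H2)|apply: (le _ _ H3)]; lra.
Qed.

End cutoff_functions.

(** * Strips swept by translates of a neighbourhood *)

Section strip_functions.
Context {R : realType} (L : R) (L0 : 0 < L).
Local Notation gap := (gap L).
Implicit Types (x z : R * R) (k : int * int) (f g : R * R -> R).

(** Profiles are built as functions on the plane that depend on the first coordinate, where the
    closure properties of [smooth] apply, and are then restricted to an axis to give a sequence of
    one-variable derivatives. *)
Lemma derivatives_section f : smooth f -> derivatives (fun m t => iter m (@d1 R) f (t, 0)).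
Proof.
move=> sf; have sm m : smooth (iter m (@d1 R) f).
  by elim: m => [|m IH] //=; exact: (smooth_derive (1, 0) IH).
move=> m t; have := smooth_is_derive (t, 0) (1, 0) (sm m) => /is_derive_lineP H.
apply/is_derive_lineP; move: H; congr is_derive; apply/funext => h.
have -> // : h *: ((1, 0) : R * R) + (t, 0) = (h *: (1 : R) + t, 0).
by congr pair; rewrite /= /GRing.scale /= ?mulr0 ?addr0.
Qed.

Lemma periodic_section f m : periodic_on L setT f ->
  periodic (fun t => iter m (@d1 R) f (t, 0)) L.
Proof.
move=> pf t; have pm : periodic_on L setT (iter m (@d1 R) f).
  by elim: m => [|m IH] //=; exact: (periodic_derive (1, 0) IH).
rewrite -[RHS](pm (1, 0)) //.
have -> // : (t, 0) + lattice L (1, 0) = (t + L, 0).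
by congr pair; rewrite /= ?mul1r ?mul0r ?addr0.
Qed.

(* Since [k] is primitive, the lines [lin k = cst], which [perp k] spans, are
   closed and connected on the torus: finitely many translates of a
   neighbourhood of one of their points cover a strip. *)
Lemma strip_reach (W : set (R * R)) z k : open W -> periodic_set L W -> W z -> coprimez k.1 k.2 ->
  exists sg (J : seq R), 0 < sg /\
    forall x, gap (lin k z) (lin k x) < 3 * sg -> exists2 t, t \in J & W (x + t *: perp k).
Proof.
move=> oW pW Wz ck; have k0 := coprimez_neq0 ck.
have [d d0 Hd] := open_box oW Wz.
pose n : R := normz k; have n1 : 1 <= n by rewrite /n normzE ler1z dotz_ge1.
pose K : R := `|k.1%:~R| + `|k.2%:~R|.
have K0 : 0 <= K by rewrite addr_ge0.
pose e := d / (2 * K + 1); have e0 : 0 < e by rewrite divr_gt0 // ltr_wpDl // mulr_ge0.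
have eK : 2 * e * K < d.
  have : e * (2 * K + 1) = d by rewrite /e divfK // gt_eqF // ltr_wpDl // mulr_ge0.
  lra.
have [s s0 Hs] := gap_small L0 e0.
pose N := (Num.truncn (L / e)).+1; pose h := L / N%:R.
have N0 : 0 < N%:R :> R by rewrite ltr0n.
have h0 : 0 < h by rewrite divr_gt0.
have he : h < e.
  rewrite /h ltr_pdivrMr // -ltr_pdivrMl // mulrC.
  have := truncnS_gt (L / e); exact.
exists (s / 3), [seq - (i%:R * h) | i <- iota 0 N]; split; first by rewrite divr_gt0.
move=> x; rewrite mulrC divfK // => /Hs[m Hm].
have /coprimezP[[u v] /= B] := ck.
(* By Bezout this lattice translation adds m L to [lin k x], which brings it within [e] of
   [lin k z]. *)
pose nu : int * int := (u * m, v * m); pose y := x + lattice L nu.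
(* In the orthogonal basis [k], [perp k] the vector y - z has coordinates al / n and [be]; the first
   one is small. *)
pose al := lin k y - lin k z; pose be := ((y.2 - z.2) * k.1%:~R - (y.1 - z.1) * k.2%:~R) / n.
have Hal : `|al| < e.
  rewrite /al /y lin_lattice; have -> // : dotz k nu = m.
  by rewrite /dotz /nu /= -[RHS]mul1r -B; ring.
have ny : n != 0 by rewrite gt_eqF // (lt_le_trans ltr01).
have y1 : y.1 - z.1 = al / n * k.1%:~R - be * k.2%:~R.
  apply: (mulIf ny); rewrite /al /be /lin /n /normz; field.
  by move: ny; rewrite /n /normz.
have y2 : y.2 - z.2 = al / n * k.2%:~R + be * k.1%:~R.
  apply: (mulIf ny); rewrite /al /be /lin /n /normz; field.
  by move: ny; rewrite /n /normz.
(* Translation by L times [perp k] is a period: [be] is reduced to [b] in [0, L[, and then to a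
   remainder [c] below the step h < e of the grid of translations. *)
pose j := Num.floor (be / L).
have /andP[j1 j2] := floor_itv (be / L); rewrite -/j in j1 j2.
rewrite ler_pdivlMr // in j1; rewrite ltr_pdivrMr // intrD mulrDl mul1r in j2.
pose b := be - j%:~R * L; have b0 : 0 <= b by rewrite subr_ge0.
have bL : b < L by rewrite ltrBlDl.
pose i := Num.truncn (b / h).
have /andP[i1 i2] : i%:R <= b / h < i.+1%:R by apply: truncn_itv; rewrite divr_ge0 // ltW.
rewrite ler_pdivlMr // in i1; rewrite ltr_pdivrMr // -natr1 mulrDl mul1r in i2.
exists (- (i%:R * h)).
  have iN : i \in iota 0 N by rewrite mem_iota add0n -(ltr_nat R) -(ltr_pM2r h0)
    (le_lt_trans i1) // /h [X in _ < X]mulrC divfK ?gt_eqF.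
  exact: (@map_f _ _ (fun i : nat => - (i%:R * h)) _ _ iN).
apply/(pW (nu + (j * k.2, - j * k.1))).
pose c := b - i%:R * h; have c0 : 0 <= c by rewrite subr_ge0.
have ce : c < e by rewrite (lt_trans _ he) // ltrBlDl.
have na : `|al / n| < e.
  by rewrite normrM normfV (ger0_norm (le_trans ler01 n1)) ltr_pdivrMr ?(lt_le_trans ltr01) // (lt_le_trans Hal) // ler_peMr // ltW.
have bound (p q : R) : `|p| <= K -> `|q| <= K -> `|p| + `|q| <= K -> `|al / n * p + c * q| < d.
  move=> Hp Hq Hpq; apply: le_lt_trans (ler_normD _ _) _; rewrite (normrM (al / n)) (normrM c) (ger0_norm c0).
  have : `|al / n| * `|p| <= e * `|p| by rewrite ler_wpM2r // ltW.
  have : c * `|q| <= e * `|q| by rewrite ler_wpM2r // ltW.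
  have : e * (`|p| + `|q|) <= e * K by rewrite ler_pM2l.
  have : 0 <= e * K by rewrite mulr_ge0 // ltW.
  lra.
have le1 : `|k.1%:~R : R| <= K by rewrite /K lerDl.
have le2 : `|k.2%:~R : R| <= K by rewrite /K lerDr.
apply: Hd.
  have -> : (x + - (i%:R * h) *: perp k + lattice L (nu + (j * k.2, - j * k.1))).1 - z.1 =
      al / n * k.1%:~R + c * (- k.2%:~R).
    rewrite /perp /= /GRing.scale /= intrD !intrM /c /b; transitivity (y.1 - z.1 + (i%:R * h + j%:~R * L) * k.2%:~R).
      by rewrite /y /lattice /nu /= !intrM; ring.
    by rewrite y1; ring.
  by apply: bound; rewrite ?normrN.
have -> : (x + - (i%:R * h) *: perp k + lattice L (nu + (j * k.2, - j * k.1))).2 - z.2 =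
    al / n * k.2%:~R + c * k.1%:~R.
  rewrite /perp /= /GRing.scale /= intrD !intrM intrN /c /b; transitivity (y.2 - z.2 - (i%:R * h + j%:~R * L) * k.1%:~R).
    by rewrite /y /lattice /nu /= !intrM; ring.
  by rewrite y2; ring.
by apply: bound => //; rewrite addrC.
Qed.

End strip_functions.

(** * One-dimensional profiles with an exponential weight *)

Section strip_control.
Context {R : realType} (L : R) (L0 : 0 < L).
Local Notation gap := (gap L).
Implicit Types (x z : R * R) (k : int * int) (f g : R * R -> R).

(* A branch of [y - s0] on the circle; it lets [exp (sig * y)] descend to the
   circle after multiplication by a cutoff that vanishes near [s0]. *)
Definition sawtooth (s0 y : R) : R := y - s0 - (Num.floor ((y - s0) / L))%:~R * L.

Lemma sawtooth_ge0 s0 y : 0 <= sawtooth s0 y.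
Proof.
have /andP[+ _] := floor_itv ((y - s0) / L).
by rewrite ler_pdivlMr // /sawtooth subr_ge0.
Qed.

Lemma sawtooth_periodic s0 : periodic (sawtooth s0) L.
Proof.
move=> y; rewrite /sawtooth.
have -> : (y + L - s0) / L = (y - s0) / L + 1%:~R by field; rewrite gt_eqF.
by rewrite floorDrz ?intr_int // intrKfloor intrD; ring.
Qed.

Lemma gap_eq0 s0 (m : int) : gap s0 (s0 + m%:~R * L) = 0.
Proof. by rewrite periodic_intmul ?gap_self //; exact: gap_periodic. Qed.

Lemma sawtooth_local s0 x : 0 < gap s0 x.1 -> exists c : R,
  \forall y \near x, sawtooth s0 (y.1 : R) = y.1 - c.
Proof.
move=> g0; pose m := Num.floor ((x.1 - s0) / L); exists (s0 + m%:~R * L).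
have /andP[m1 m2] := floor_itv ((x.1 - s0) / L); rewrite -/m in m1 m2.
rewrite ler_pdivlMr // in m1; rewrite ltr_pdivrMr // intrD mulrDl mul1r in m2.
have m1' : m%:~R * L < x.1 - s0.
  rewrite lt_neqAle m1 andbT; apply/eqP => E.
  by move: g0; have -> : x.1 = s0 + m%:~R * L; [rewrite E; ring|rewrite gap_eq0 ltxx].
have N1 : \forall y \near x, m%:~R * L < (y : R * R).1 - s0.
  have C : (fun y : R * R => y.1 - s0) y @[y --> x] --> x.1 - s0.
    by apply: cvgB; [exact: cvg_fst|exact: cvg_cst].
  exact: (cvgr_gt _ C).
have N2 : \forall y \near x, (y : R * R).1 - s0 < m%:~R * L + L.
  have C : (fun y : R * R => y.1 - s0) y @[y --> x] --> x.1 - s0.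
    by apply: cvgB; [exact: cvg_fst|exact: cvg_cst].
  exact: (cvgr_lt _ C).
near=> y; have h1 : m%:~R * L < y.1 - s0 by near: y.
have h2 : y.1 - s0 < m%:~R * L + L by near: y.
rewrite /sawtooth (@floor_def _ _ m); first by ring.
rewrite ler_pdivlMr // ltr_pdivrMr // (ltW h1) /= intrD mulrDl mul1r h2 //.
Unshelve. all: by end_near. Qed.

Variables (k : int * int) (s : seq (R * R)) (sg : R * R -> R) (sig : R) (z0 : R * R).
Hypotheses (sg0 : forall z, z \in s -> 0 < sg z) (z0s : z0 \in s) (sig0 : 0 <= sig).

Let bumps x : R := \prod_(z <- s) (1 - bump ((sg z)^-1 * gap (lin k z) x.1)).
(** The jump of the sawtooth is at [lin k z0], where the bump factor of [z0] makes the product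
    vanish. On [far] all bump factors are 1, so the profile is locally a multiple of exp(sig y),
    which d/dy - sig annihilates. *)
Let profile x : R := bumps x * expR (sig * sawtooth (lin k z0) x.1).

Let bumps01 x : 0 <= bumps x.
Proof. by apply: prodr_ge0 => z _; rewrite subr_ge0 bump_le1. Qed.

Let bumps_near0 z x : z \in s -> gap (lin k z) x.1 <= sg z -> bumps x = 0.
Proof.
move=> zs H; rewrite /bumps (big_rem z) //= bump1 ?subrr ?mul0r //.
by rewrite mulrC ler_pdivrMr ?sg0 // mul1r.
Qed.

Let bumps_far x : (forall z, z \in s -> 2 * sg z <= gap (lin k z) x.1) -> bumps x = 1.
Proof.
move=> H; rewrite /bumps big_seq big1 // => z zs.
by rewrite bump0 ?subr0 // mulrC ler_pdivlMr ?sg0 // H.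
Qed.

Let continuous_gap1 a : continuous (fun x : R * R => gap a x.1).
Proof.
have : smooth (fun x : R * R => gap a x.1).
  by have := smooth_gap L a 1 0; congr smooth; apply/funext => x; rewrite mul1r mul0r addr0.
exact: smooth_continuous.
Qed.

Let smooth_profile : smooth profile.
Proof.
have sb : smooth bumps.
  apply: smooth_prod => z; apply: smoothB; first exact: smooth_cst.
  apply: smooth_bump; apply: smoothZ.
  by have := smooth_gap L (lin k z) 1 0; congr smooth; apply/funext => x; rewrite mul1r mul0r addr0.
apply: smooth_local => x; have [H|H] := ltP (gap (lin k z0) x.1) (sg z0).
  exists (fun=> 0); first exact: smooth_cst.
  have C := @continuous_gap1 (lin k z0) x.
  have N : \forall y \near x, gap (lin k z0) (y : R * R).1 < sg z0 by exact: (cvgr_lt _ C).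
  near=> y.
  by rewrite /profile (@bumps_near0 z0) ?mul0r //; apply: ltW; near: y.
have [c Hc] := sawtooth_local (lt_le_trans (sg0 z0s) H).
exists (fun y => bumps y * expR (sig * (1 * y.1 + 0 * y.2) - sig * c)).
  apply: smoothM => //; apply: smooth_expR; apply: smoothB; last exact: smooth_cst.
  by apply: smoothZ; exact: smooth_linear.
near=> y; rewrite /profile; have -> : sawtooth (lin k z0) y.1 = y.1 - c by near: y.
by rewrite mul1r mul0r addr0 mulrBr.
Unshelve. all: by end_near. Qed.

Let periodic_profile : periodic_on L setT profile.
Proof.
move=> j x _; have E1 : bumps (x + lattice L j) = bumps x.
  by apply: eq_bigr => z _; rewrite /lattice /= periodic_intmul //; exact: gap_periodic.
have E2 : sawtooth (lin k z0) (x + lattice L j).1 = sawtooth (lin k z0) x.1.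
  by rewrite /lattice /= periodic_intmul //; exact: sawtooth_periodic.
by rewrite /profile E1 E2.
Qed.

Let A m t := iter m (@d1 R) profile (t, 0).

Let far : set (R * R) := [set x | forall z, z \in s -> 2 * sg z < gap (lin k z) x.1].

Let open_far : open far.
Proof.
rewrite /far; elim: (s) => [|z r IH].
  have -> : [set x : R * R | forall z, z \in [::] -> 2 * sg z < gap (lin k z) x.1] = setT.
    by apply/seteqP; split => // x _ p.
  exact: openT.
have -> : [set x : R * R | forall z', z' \in z :: r -> 2 * sg z' < gap (lin k z') x.1] =
    [set x | 2 * sg z < gap (lin k z) x.1] `&` [set x : R * R | forall z, z \in r -> 2 * sg z < gap (lin k z) x.1].
  apply/seteqP; split => x /= H.
    by split; [apply: H; rewrite mem_head|move=> q qs; apply: H; rewrite inE qs orbT].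
  by case: H => h1 h2 q; rewrite inE => /predU1P[->//|/h2].
apply: openI => //.
have := @open_comp _ _ (fun x : R * R => gap (lin k z) x.1) [set y : R | 2 * sg z < y] (fun x _ => @continuous_gap1 (lin k z) x).
by apply; exact: open_gt.
Qed.

Let d1_profile x : far x -> d1 profile x = sig * profile x.
Proof.
move=> fx; have [c Hc] : exists c : R, \forall y \near x, sawtooth (lin k z0) (y.1 : R) = y.1 - c.
  by apply: sawtooth_local; apply: lt_trans (fx _ z0s); rewrite mulr_gt0 // sg0.
pose h y : R := expR (sig * (y : R * R).1 - sig * c).
have N : \near x, profile x = h x.
  have F : nbhs x far by apply: open_nbhs_nbhs.
  near=> y; rewrite /profile /h bumps_far; last first.
    by move=> z zs; apply: ltW; have : far y by [near: y]; apply.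
  have -> : sawtooth (lin k z0) y.1 = y.1 - c by near: y.
  by rewrite mul1r mulrBr.
rewrite /d1 (near_eq_derive ((1, 0) : R * R) N) (nbhs_singleton N).
have D : is_derive x (1, 0) (fun y : R * R => sig * y.1 - sig * c) sig.
  apply/is_derive_lineP.
  have -> : (fun t : R => sig * (t *: (1, 0) + x).1 - sig * c) = (fun t : R => sig * t + (sig * x.1 - sig * c)).
    by apply/funext => t; rewrite /= /GRing.scale /=; ring.
  by apply: is_derive_eq; rewrite /GRing.scale /=; ring.
have [_ ->] := is_derive_comp1 (is_derive_expR (sig * x.1 - sig * c)) D.
by rewrite mulrC.
Unshelve. all: by end_near. Qed.

Let d1d1_profile x : far x -> d1 (d1 profile) x = sig * (sig * profile x).
Proof.
move=> fx; have N : \near x, d1 profile x = (fun x => sig * profile x) x.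
  have F : nbhs x far by apply: open_nbhs_nbhs.
  by apply: filterS F => y; exact: d1_profile.
rewrite {1}/d1 (near_eq_derive ((1, 0) : R * R) N) dZ //.
by rewrite -/(d1 profile x) d1_profile.
Qed.

Lemma strip_profile O : closure O `<=` [set x | exists2 z, z \in s & gap (lin k z) (lin k x) < sg z] ->
  exists A (B : R), [/\ derivatives A, forall m, periodic (A m) L, test_function L O (kfun A k 0) &
   [/\ forall x, 0 <= kfun A k 0 x, forall x, strip1 sig A k x ^+ 2 <= B, forall x, strip2 sig A k x ^+ 2 <= B &
     forall x, (forall z, z \in s -> 2 * sg z < gap (lin k z) (lin k x)) ->
       [/\ 1 <= kfun A k 0 x, strip1 sig A k x = 0 & strip2 sig A k x = 0]]].
Proof.
move=> OU; have dA := derivatives_section smooth_profile.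
have pA m := periodic_section m periodic_profile.
have bd f : smooth f -> periodic_on L setT f -> exists B : R, forall x, f x ^+ 2 <= B.
  move=> sf pf; have [M HM] := periodic_bounded L0 (smooth_continuous sf) pf.
  exists (M ^+ 2) => x; rewrite -(real_normK (num_real (f x))) lerXn2r ?nnegrE //.
  exact: le_trans (HM x).
have dA1 := derivatives_dshift sig dA; have dA2 := derivatives_dshift sig dA1.
have pA1 := periodic_dshift sig pA; have pA2 := periodic_dshift sig pA1.
have [B1 H1] := bd _ (smooth_kfun k 0 dA1) (kfun_periodic k 0 pA1).
have [B2 H2] := bd _ (smooth_kfun k 0 dA2) (kfun_periodic k 0 pA2).
have b1 : 0 <= B1 by apply: le_trans (H1 0); exact: sqr_ge0.
have b2 : 0 <= B2 by apply: le_trans (H2 0); exact: sqr_ge0.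
exists A, (B1 + B2); split => //.
  pose U := [set x | exists2 z, z \in s & gap (lin k z) (lin k x) < sg z].
  apply: (@test_vanishing _ L O U).
  - have -> : U = \bigcup_(z in [set` s]) [set x | gap (lin k z) (lin k x) < sg z].
      by apply/seteqP; split => x [p ps Hp]; exists p.
    apply: bigcup_open => z _.
    have C : continuous (fun x => gap (lin k z) (lin k x)).
      exact/smooth_continuous/(smooth_gap L (lin k z)).
    have := @open_comp _ _ (fun x : R * R => gap (lin k z) (lin k x)) [set y : R | y < sg z] (fun x _ => @C x).
    by apply; exact: open_lt.
  - exact: OU.
  - exact: kfun_periodic.
  - exact: smooth_kfun.
  - by move=> x [z zs Hz]; rewrite /kfun /A /= /profile (@bumps_near0 z) ?mul0r //; exact: ltW.
split.
- by move=> x; rewrite /kfun /A /= /profile mulr_ge0 // expR_ge0.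
- by move=> x; rewrite strip1E; apply: le_trans (H1 x) _; rewrite lerDl.
- by move=> x; rewrite strip2E; apply: le_trans (H2 x) _; rewrite lerDr.
move=> x Hx; have fx : far (lin k x, 0) by [].
have E1 := d1_profile fx; have E2 := d1d1_profile fx.
rewrite /strip1 /strip2 /kfun /A /= E1 E2; split; [|by rewrite subrr|ring].
rewrite /profile bumps_far ?mul1r; last by move=> z zs; apply/ltW/fx.
(* The sawtooth and [sig] are nonnegative, so the exponential is at least 1. *)
by rewrite -expR0 ler_expR mulr_ge0 // sawtooth_ge0.
Qed.

End strip_control.

(** * Strip data that do not depend on the weight *)

Section strip_cover.
Context {R : realType} (L : R) (L0 : 0 < L).
Implicit Types (x z : R * R) (k : int * int) (rho : R * R -> R).

(** [A], [J] and [M] depend only on the set [W] where the weights are at least 1/2, so they are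
    available before rho is chosen. Around each strip the bump factor vanishes up to gap sg, is
    constant beyond 2 sg, and points with gap below 3 sg are moved into [W] by some translation in
    [J]. *)
Lemma strip_cover O (W : set (R * R)) k (sig : R) : open W -> periodic_set L W ->
  closure O `<=` W -> O !=set0 -> periodic_set L O -> coprimez k.1 k.2 -> 0 <= sig ->
  exists A (J : seq R) (M : R), [/\ derivatives A, forall m, periodic (A m) L,
    test_function L O (kfun A k 0), 1 <= M & forall x, 0 <= kfun A k 0 x] /\
  forall rho, (forall x, 0 <= rho x) -> (forall x, W x -> 2^-1 <= rho x) ->
    let w x := \sum_(t <- J) rho (x + t *: perp k) in
    [/\ forall x, 1 <= M * (kfun A k 0 x + w x), forall x, strip1 sig A k x ^+ 2 <= M * w x &
      forall x, strip2 sig A k x ^+ 2 <= M * w x].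
Proof.
move=> oW pW OW [p Op] pO ck sig0.
have /choice[q Hq] : forall z, exists q : R * seq R, closure O z -> 0 < q.1 /\
    forall x, gap L (lin k z) (lin k x) < 3 * q.1 -> exists2 t, t \in q.2 & W (x + t *: perp k).
  move=> z; have [Oz|nOz] := pselect (closure O z); last by exists (0, [::]) => /nOz.
  by have [sg [J [H1 H2]]] := strip_reach L0 oW pW (OW _ Oz) ck; exists (sg, J).
have [||| s [sO Hs]] := @periodic_cover R L L0 (closure O)
  (fun z => [set x | gap L (lin k z) (lin k x) < (q z).1]) (@closed_closure _ O) (periodic_closure pO).
- by move=> z Oz /=; rewrite gap_self; have [] := Hq z Oz.
- move=> z; have C : continuous (fun x => gap L (lin k z) (lin k x)).
    exact/smooth_continuous/(smooth_gap L (lin k z)).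
  have := @open_comp _ _ (fun x : R * R => gap L (lin k z) (lin k x)) [set y : R | y < (q z).1] (fun x _ => @C x).
  by apply; exact: open_lt.
- move=> z j x /=; rewrite lin_lattice periodic_intmul //; exact: gap_periodic.
have [z0 z0s _] := Hs p (subset_closure Op).
have sg0 z : z \in s -> 0 < (q z).1 by move=> /sO/Hq[].
have [A [B [dA pA tA [a0 S1 S2 far]]]] := strip_profile L0 sg0 z0s sig0 Hs.
have B0 : 0 <= B by apply: le_trans (S1 0); exact: sqr_ge0.
(* Outside the region where the profile is purely exponential w >= 1/2, so that M w is at least B
   and at least 1. *)
exists A, (flatten [seq (q z).2 | z <- s]), (2 * B + 2); split; first by split => //; lra.
move=> rho rho0 rhoW w.
have w0 x : 0 <= w x by apply: sumr_ge0.
have near x : (exists2 z, z \in s & gap L (lin k z) (lin k x) <= 2 * (q z).1) -> 2^-1 <= w x.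
  move=> [z zs Hz]; have [q0 H] := Hq z (sO z zs).
  have [|t tJ Wt] := H x; first by apply: le_lt_trans Hz _; rewrite ltr_pM2r // ltr_nat.
  have tin : t \in flatten [seq (q z).2 | z <- s] by apply/flatten_mapP; exists z.
  apply: le_trans (rhoW _ Wt) _; rewrite /w (big_rem t) //= lerDl.
  by apply: sumr_ge0.
have cases x : (forall z, z \in s -> 2 * (q z).1 < gap L (lin k z) (lin k x)) \/ 2^-1 <= w x.
  have [H|/existsNP[z /not_implyP[zs /negP nz]]] := pselect (forall z, z \in s -> 2 * (q z).1 < gap L (lin k z) (lin k x)); first by left.
  by right; apply: near; exists z => //; rewrite leNgt.
split=> x; have wx := w0 x; (have [/far[h1 h2 h3]|h] := cases x).
- have : 0 <= (2 * B + 1) * kfun A k 0 x by rewrite mulr_ge0 //; lra.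
  have : 0 <= (2 * B + 2) * w x by rewrite mulr_ge0 //; lra.
  by lra.
- have : 0 <= (2 * B + 2) * kfun A k 0 x by rewrite mulr_ge0 //; lra.
  have : 0 <= 2 * B * w x by rewrite mulr_ge0 //; lra.
  by lra.
- by rewrite h2 expr0n /= mulr_ge0 //; lra.
- apply: le_trans (S1 x) _; have : (2 * B) * 2^-1 <= 2 * B * w x by rewrite ler_wpM2l //; lra.
  by lra.
- by rewrite h3 expr0n /= mulr_ge0 //; lra.
- apply: le_trans (S2 x) _; have : (2 * B) * 2^-1 <= 2 * B * w x by rewrite ler_wpM2l //; lra.
  by lra.
Qed.

End strip_cover.

(** * High frequencies *)

Section high_frequency.
Context {R : realType} (L : R) (L0 : 0 < L).
Local Notation kap := (kap L).
Implicit Types (x z : R * R) (xi k : int * int) (rho h U : R * R -> R) (F G : seq (int * int))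
  (c : int * int -> R[i]).

Lemma hat_err_le h : bdd L h -> exists2 B : R, 0 <= B &
  forall (r : R * R -> R[i]) F, csqi L r -> uniq F -> hat_err L h r F <= B * avg L (sqn \o r).
Proof.
move=> bh; have [_ [M HM]] := bh; exists (M ^+ 2); first exact: sqr_ge0.
move=> r F sr uF; have s1 := csqiM (cbdd_real bh) sr.
apply: le_trans (bessel L0 s1 uF) _; rewrite -avgZ; last exact: sqn_intg.
apply: avg_le; [exact: sqn_intg|exact/intgZ/sqn_intg|] => x /HM hx /=.
rewrite sqnM sqn_real ler_wpM2r ?sqn_ge0 // -(real_normK (num_real (h x))).
by rewrite lerXn2r ?nnegrE // (le_trans _ hx).
Qed.

Lemma hat_err_ge0 h (r : R * R -> R[i]) F : 0 <= hat_err L h r F.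
Proof. by apply: sumr_ge0 => xi _; exact: sqn_ge0. Qed.

Lemma csqi_resid U F c : sqi L U -> csqi L (resid L U F c).
Proof.
by move=> sU; apply: csqiB => //; [exact: csqi_real|apply: cbdd_csqi => //; exact: cbdd_trig].
Qed.

Lemma either_bound (S C D a e f : R) : 0 <= C -> 0 <= D -> 0 <= a -> 0 <= e -> 0 <= f ->
  S <= C * (a + e) \/ S <= D * (a + f) -> S <= (C + D) * (a + (e + f)).
Proof.
move=> C0 D0 a0 e0 f0.
have := (mulr_ge0 C0 a0, mulr_ge0 D0 a0, mulr_ge0 C0 e0, mulr_ge0 D0 e0, mulr_ge0 C0 f0, mulr_ge0 D0 f0).
by move=> [[[[[? ?] ?] ?] ?] ?] [] ?; lra.
Qed.

(** The value of [mu] on the line decides between the shifts sig = 0 and sig = 1. Both sets of data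
    are prepared beforehand, three functions each, which makes [C] and the six functions [h]
    independent of [lam] and of the line. *)
Lemma strip_class O (W : set (R * R)) k : open W -> periodic_set L W ->
  closure O `<=` W -> O !=set0 -> periodic_set L O -> coprimez k.1 k.2 ->
  exists (C : R) (h : nat -> R * R -> R), [/\ 0 <= C, forall i, bdd L (h i) &
  forall rho, rtrigp L rho -> (forall x, 0 <= rho x) -> (forall x, W x -> 2^-1 <= rho x) ->
  forall (lam : R) U F c (c0 : int), weak_solution L O lam U -> uniq F ->
    \sum_(xi <- line F k c0) sqn (c xi) <= C * (avg L (fun x => rho x * sqn (trig L (line F k c0) c x)) +
       \sum_(i < 6) hat_err L (h i) (resid L U F c) (line F k c0))].
Proof.
move=> oW pW OW O0 pO ck; have k0 := coprimez_neq0 ck.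
have key (sig : R) : 0 <= sig -> exists (C : R) (h0 h1 h2 : R * R -> R), [/\ 0 <= C,
  [/\ bdd L h0, bdd L h1 & bdd L h2] &
  forall rho, rtrigp L rho -> (forall x, 0 <= rho x) -> (forall x, W x -> 2^-1 <= rho x) ->
  forall (lam : R) U F c (c0 : int), weak_solution L O lam U -> uniq F ->
    let mu := lam * normz k - kap ^+ 2 * (c0%:~R) ^+ 2 in
    (sig = 1 /\ - normz k ^+ 2 / 4 <= mu) \/ (sig = 0 /\ mu <= - normz k ^+ 2 / 4) ->
    \sum_(xi <- line F k c0) sqn (c xi) <= C * (avg L (fun x => rho x * sqn (trig L (line F k c0) c x)) +
       (hat_err L h0 (resid L U F c) (line F k c0) + hat_err L h1 (resid L U F c) (line F k c0) +
        hat_err L h2 (resid L U F c) (line F k c0)))].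
  move=> sig0; have [A [J [M [[dA pA tA M1 a0] HW]]]] := strip_cover L0 oW pW OW O0 pO ck sig0.
  have dA1 := derivatives_dshift sig dA; have dA2 := derivatives_dshift sig dA1.
  have C0 : 0 <= 1100 * M ^+ 3.
    have : 0 <= M ^+ 3 by rewrite exprn_ge0 // (le_trans ler01).
    by move: (M ^+ 3); clear=> m m0; lra.
  exists (1100 * M ^+ 3 * (size J).+1%:R), (kfun A k 0), (strip1 sig A k), (strip2 sig A k); split.
  - exact: mulr_ge0.
  - split; [|rewrite strip1E|rewrite strip2E]; by apply: smooth_bdd; exact: smooth_kfun.
  move=> rho tr rho0 rhoW lam U F c c0 ws uF mu Hmu.
  pose w x := \sum_(t <- J) rho (x + t *: perp k).
  have [H0 H1 H2] : [/\ forall x, 1 <= M * (kfun A k 0 x + w x),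
    forall x, strip1 sig A k x ^+ 2 <= M * w x & forall x, strip2 sig A k x ^+ 2 <= M * w x].
    exact: HW.
  have bw : bdd L w.
    rewrite /w; elim: (J) => [|t J' IH].
      by under eq_fun do rewrite big_nil; exact: bdd_cst.
    under eq_fun do rewrite big_cons; apply: bddD => //.
    exact/rtrigp_bdd/rtrigp_shift.
  have w0 x : 0 <= w x by apply: sumr_ge0.
  have SL := strip_line L0 c ws dA pA tA k0 Hmu bw M1 a0 w0 H0 H1 H2 uF.
  apply: le_trans SL _.
  (* The modulus is invariant along [perp k] on a line of frequencies, so all translates of rho give
     the same average. *)
  have -> : avg L (fun x => w x * sqn (trig L (line F k c0) c x)) =
      (size J)%:R * avg L (fun x => rho x * sqn (trig L (line F k c0) c x)).
    have sT : csqi L (trig L (line F k c0) c) by apply: cbdd_csqi => //; exact: cbdd_trig.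
    transitivity (\sum_(t <- J) avg L (fun x => rho (x + t *: perp k) * sqn (trig L (line F k c0) c x))).
      rewrite -(avg_sum L0) => [|t]; last by apply: weight_intg => //; exact/rtrigp_bdd/rtrigp_shift.
      by apply: eq_avg => x _; rewrite /w mulr_suml.
    have inl xi : xi \in line F k c0 -> detz xi k = c0 by rewrite mem_filter => /andP[/eqP].
    rewrite (eq_bigr (fun=> avg L (fun x => rho x * sqn (trig L (line F k c0) c x)))) => [|t _].
      by rewrite big_const_seq count_predT iter_addr_0 mulr_natl.
    exact: (avg_line_shift L0 c t tr inl).
  rewrite -[leRHS]mulrA ler_wpM2l // -natr1.
  have a_ge0 : 0 <= avg L (fun x => rho x * sqn (trig L (line F k c0) c x)).
    by apply: avg_ge0 => x _; rewrite mulr_ge0 // sqn_ge0.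
  have E0 : 0 <= hat_err L (kfun A k 0) (resid L U F c) (line F k c0) +
      hat_err L (strip1 sig A k) (resid L U F c) (line F k c0) +
      hat_err L (strip2 sig A k) (resid L U F c) (line F k c0) by rewrite !addr_ge0 ?hat_err_ge0.
  move: a_ge0 E0 (ler0n R (size J)); clear; move: (avg L _) (_ + _ + _) (_%:R) => a e n a0 e0 n0.
  by have := mulr_ge0 n0 e0; lra.
have [C0 [a0 [a1 [a2 [C00 [b0 b1 b2] H0]]]]] := key 0 (lexx 0).
have [C1 [e0 [e1 [e2 [C10 [d0 d1 d2] H1]]]]] := key 1 ler01.
(* The default value 0 keeps [h i] bounded for every natural number i. *)
pose h (i : nat) := nth (fun=> 0) [:: a0; a1; a2; e0; e1; e2] i.
exists (C0 + C1), h; split.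
- exact: addr_ge0.
- by do 6 (case=> //); move=> i; rewrite /h /= nth_nil; exact: bdd_cst.
move=> rho tr rho0 rhoW lam U F c c0 ws uF.
have a_ge0 : 0 <= avg L (fun x => rho x * sqn (trig L (line F k c0) c x)).
  by apply: avg_ge0 => x _; rewrite mulr_ge0 // sqn_ge0.
rewrite !big_ord_recl big_ord0 /= addr0 /h /=.
have := hat_err_ge0; set r := resid _ _ _ _ => P.
move: (P a0 r (line F k c0)) (P a1 r (line F k c0)) (P a2 r (line F k c0)) => P0 P1 P2.
move: (P e0 r (line F k c0)) (P e1 r (line F k c0)) (P e2 r (line F k c0)) => Q0 Q1 Q2.
set mu := lam * normz k - kap ^+ 2 * (c0%:~R) ^+ 2.
have E : (\sum_(xi <- line F k c0) sqn (c xi) <= C0 * (avg L (fun x => rho x * sqn (trig L (line F k c0) c x)) +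
    (hat_err L a0 r (line F k c0) + hat_err L a1 r (line F k c0) + hat_err L a2 r (line F k c0)))) \/
  (\sum_(xi <- line F k c0) sqn (c xi) <= C1 * (avg L (fun x => rho x * sqn (trig L (line F k c0) c x)) +
    (hat_err L e0 r (line F k c0) + hat_err L e1 r (line F k c0) + hat_err L e2 r (line F k c0)))).
  have [mu0|mu1] := leP mu (- normz k ^+ 2 / 4); [left|right].
    by apply: (H0 rho tr rho0 rhoW lam U F c c0 ws uF); right.
  by apply: (H1 rho tr rho0 rhoW lam U F c c0 ws uF); left; split => //; exact: ltW.
move: E P0 P1 P2 Q0 Q1 Q2 C00 C10 a_ge0; clear.
move: (hat_err L a0 r _) (hat_err L a1 r _) (hat_err L a2 r _) (hat_err L e0 r _) (hat_err L e1 r _) (hat_err L e2 r _).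
move: (avg L _) (\sum_(_ <- _) _) => a S p0 p1 p2 q0 q1 q2 E P0 P1 P2 Q0 Q1 Q2 C00 C10 a_ge0.
have -> : p0 + (p1 + (p2 + (q0 + (q1 + q2)))) = (p0 + p1 + p2) + (q0 + q1 + q2) by ring.
by apply: either_bound; rewrite ?addr_ge0.
Qed.

End high_frequency.

(** * Summation over the classes of the annulus *)

Section high_frequency_estimate.
Context {R : realType} (L : R) (L0 : 0 < L).
Local Notation kap := (kap L).
Implicit Types (x z : R * R) (xi k : int * int) (rho h U : R * R -> R) (F : seq (int * int))
  (c : int * int -> R[i]).

(** A fixed bump r1, of degree governed by [K], sees widely spaced frequencies as uncoupled: its
    weighted mass is its average, at least m / 2, times the mass S. Since r1 <= 2 rho + e with e <=
    m / 4, the term e S is absorbed and 8 / m results. The spacing [K] is fixed before rho. *)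
Lemma point_control (z : R * R) (t : R) : 0 < t -> exists (C : R) (K : nat), 0 <= C /\
  forall rho, bdd L rho -> (forall x, 0 <= rho x) ->
    (forall x, tdist L z x < 2 * t -> 2^-1 <= rho x) ->
  forall F c, uniq F ->
    (forall xi eta, xi \in F -> eta \in F -> xi != eta -> K%:Z < dotz (xi - eta) (xi - eta)) ->
    \sum_(xi <- F) sqn (c xi) <= C * avg L (fun x => rho x * sqn (trig L F c x)).
Proof.
move=> t0; have [m m0 Hm] := avg_ball_gt0 L0 z t0.
pose e := Num.min (m / 4) 2^-1.
have e0 : 0 < e by rewrite lt_min divr_gt0 //= invr_gt0.
have t2 : t < 2 * t by lra.
have [r1 [tr1 r01 rge rle]] := threshold_poly (rtrigp_tdist L z) (tdist01 L z) t0 t2 e0.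
have [D D0 HD] := rtrigp_degree L0 tr1.
exists (8 / m), (absz D); split; first by rewrite divr_ge0 // ltW.
move=> rho br rho0 rhoN F c uF HF.
have b1 := rtrigp_bdd tr1.
have mr : m <= 2 * avg L r1.
  rewrite -avgZ; last exact: (bdd_intg L0).
  apply: Hm; first exact/intgZ/(bdd_intg L0).
    by move=> x; rewrite mulr_ge0 //; case/andP: (r01 x).
  move=> x xt; have := rge x (ltW xt); have : e <= 2^-1 by rewrite ge_min lexx orbT.
  lra.
have sT : csqi L (trig L F c) by apply: cbdd_csqi => //; exact: cbdd_trig.
have E1 : avg L (fun x => r1 x * sqn (trig L F c x)) = avg L r1 * \sum_(xi <- F) sqn (c xi).
  apply: decouple_points => // xi eta xiF etaF ne; apply: HD.
  by have := HF xi eta xiF etaF ne; rewrite abszE gtr0_norm.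
set S := \sum_(xi <- F) _ in E1 *.
have S0 : 0 <= S by apply: sumr_ge0 => xi _; exact: sqn_ge0.
have I := weight_intg br sT; set X := avg L _.
have H : avg L r1 * S <= 2 * X + e * S.
  rewrite -E1 /S -(avg_sqn_trig L0 c uF) /X -!avgZ //; last exact: sqn_intg.
  rewrite -avgD; [|exact: intgZ|exact/intgZ/sqn_intg].
  apply: avg_le; [exact: weight_intg|by apply: intgD; [exact: intgZ|exact/intgZ/sqn_intg]|].
  move=> x _ /=; rewrite mulrA -mulrDl ler_wpM2r ?sqn_ge0 //.
  have /andP[r10 r11] := r01 x; have p0 := rho0 x.
  have [xt|xt] := ltP (tdist L z x) (2 * t); first by have := rhoN x xt; lra.
  by have := rle x xt; lra.
have eS : e * S <= m / 4 * S by rewrite ler_wpM2r // ge_min lexx.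
have mS : m * S <= 2 * avg L r1 * S by rewrite ler_wpM2r.
have -> : 8 / m * X = (8 * X) / m by rewrite mulrAC.
rewrite ler_pdivlMr //; move: H eS mS; clear; move: (avg L r1) => a; lra.
Qed.

(** [C] precedes rho so that the smallness of rho outside [G] can be adapted to it; [dl] and [Lam0]
    follow rho, since the classes are defined by the degree of rho. *)
Lemma high_frequency O G s : open O -> O !=set0 -> periodic_set L O ->
  good_cover L O G s -> s != [::] ->
  exists2 C : R, 0 <= C & forall rho, rtrigp L rho -> (forall x, 0 <= rho x) ->
    (forall x, collar L s x -> 2^-1 <= rho x) ->
  exists dl Lam0 : R, 0 < dl /\ forall Lam U F c, Lam0 <= Lam ->
    weak_solution L O (kap ^+ 2 * Lam) U -> uniq F ->
    {in F, forall xi, annulus Lam dl xi} ->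
    1 <= dl * Lam /\
    \sum_(xi <- F) sqn (c xi) <= C * (avg L (fun x => rho x * sqn (trig L F c x)) +
       avg L (fun x => sqn (resid L U F c x))).
Proof.
move=> oO O0 pO gc s0; have [Hs Hc] := gc.
have [p ps] : exists p, p \in s by case: (s) s0 => // q r _; exists q; rewrite mem_head.
have [p0 _] := Hs p ps.
have [C1 [K [C10 H1]]] := point_control p.1 p0.
have oW : open (collar L s).
  have -> : collar L s = \bigcup_(q in [set` s]) [set x | tdist L q.1 x < 2 * q.2].
    by apply/seteqP; split => x [q qs Hq]; exists q.
  by apply: bigcup_open => q _; exact: open_tdist_lt.
have pW : periodic_set L (collar L s).
  move=> k x; split=> -[q qs Hq]; exists q => //; move: Hq; by rewrite tdist_lattice.
have OW : closure O `<=` collar L s.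
  move=> x /Hc[q qs Hq]; exists q => //; have [q0 _] := Hs q qs.
  by apply: lt_trans Hq _; lra.
pose P k (q : R * (nat -> R * R -> R)) := [/\ 0 <= q.1, forall i, bdd L (q.2 i) &
  forall rho, rtrigp L rho -> (forall x, 0 <= rho x) -> (forall x, collar L s x -> 2^-1 <= rho x) ->
  forall (lam : R) U F c (c0 : int), weak_solution L O lam U -> uniq F ->
    \sum_(xi <- line F k c0) sqn (c xi) <= q.1 * (avg L (fun x => rho x * sqn (trig L (line F k c0) c x)) +
       \sum_(i < 6) hat_err L (q.2 i) (resid L U F c) (line F k c0))].
have /choice[q Hq] : forall k, exists q, [/\ 0 <= q.1, forall i, bdd L (q.2 i) & coprimez k.1 k.2 -> P k q].
  move=> k; have [ck|nck] := boolP (coprimez k.1 k.2); last first.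
    by exists (0, fun _ _ => 0); split => // i; exact: bdd_cst.
  have [C [h [C0 bh H]]] := strip_class L0 oW pW OW O0 pO ck.
  by exists (C, h).
(* These finitely many directions are chosen by [K], independently of rho. Lines in other directions
   have spacing beyond [K] and are treated by [point_control]. *)
pose Ks := short_vectors K.
pose Err r F := \sum_(k <- Ks) \sum_(i < 6) hat_err L ((q k).2 i) r F.
have Err0 r F : 0 <= Err r F.
  by do 2 (apply: sumr_ge0 => ? _); exact: hat_err_ge0.
(* The classes are disjoint, so the errors of all of them together are still bounded by one
   application of Bessel for each function, whatever the number of classes. *)
have [B B0 HB] : exists2 B : R, 0 <= B & forall r F, csqi L r -> uniq F -> Err r F <= B * avg L (sqn \o r).
  have /choice[b Hb] : forall ki : (int * int) * nat, exists b : R, 0 <= b /\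
      forall r F, csqi L r -> uniq F -> hat_err L ((q ki.1).2 ki.2) r F <= b * avg L (sqn \o r).
    move=> ki; have [_ bh _] := Hq ki.1.
    by have [b b0 Hb] := hat_err_le L0 (bh ki.2); exists b.
  exists (\sum_(k <- Ks) \sum_(i < 6) b (k, val i)).
    by apply: sumr_ge0 => k _; apply: sumr_ge0 => i _; have [] := Hb (k, val i).
  move=> r F sr uF; rewrite mulr_suml; apply: ler_sum => k _; rewrite mulr_suml.
  by apply: ler_sum => i _; have [_] := Hb (k, val i); apply.
pose C2 := C1 + \sum_(k <- Ks) (q k).1.
have Cs0 : 0 <= \sum_(k <- Ks) (q k).1 by apply: sumr_ge0 => k _; have [] := Hq k.
have C20 : 0 <= C2 by rewrite addr_ge0.
exists (C2 * (1 + B)); first by rewrite mulr_ge0 // addr_ge0.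
move=> rho tr rho0 rhoN; have br := rtrigp_bdd tr.
have [Dz Dz0 HD] := rtrigp_degree L0 tr; pose D := absz Dz.
have DE : Dz = D by rewrite /D abszE gtr0_norm.
have D0 : (0 < D)%N by rewrite absz_gt0 gt_eqF.
have D0R : 0 < D%:R :> R by rewrite ltr0n.
(* The largest value allowed by the condition 100 eta D^2 <= 1 of [parallel_numeric]; [dl] is then
   eta / 6 as in [tangent_numeric]. *)
pose eta : R := (100 * D%:R ^+ 2)^-1.
have D2 : 0 < D%:R ^+ 2 :> R by rewrite exprn_gt0.
have eta0 : 0 < eta by rewrite invr_gt0 mulr_gt0.
have etaD : 100 * eta * D%:R ^+ 2 <= 1.
  by rewrite /eta le_eqVlt; apply/orP; left; apply/eqP; field; rewrite gt_eqF.
pose dl := eta / 6; have dl0 : 0 < dl by rewrite divr_gt0.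
exists dl, (D%:R ^+ 2 / eta + dl^-1); split => // Lam U F c HL ws uF FA.
have s1 : 1 <= dl * Lam.
  rewrite mulrC -ler_pdivrMr // mul1r; apply: le_trans HL; rewrite lerDr.
  by rewrite divr_ge0 // ltW.
have DL : D%:R ^+ 2 <= eta * Lam.
  rewrite mulrC -ler_pdivrMr //; apply: le_trans HL; rewrite lerDl.
  by rewrite invr_ge0 ltW.
have de : 6 * dl <= eta by rewrite /dl mulrC divfK.
split => //; have [sU _] := ws; set r := resid L U F c; have sr : csqi L r by exact: csqi_resid.
pose lab := label D Lam eta.
have HX : \sum_(l <- undup (map lab F)) avg L (fun x => rho x * sqn (trig L [seq xi <- F | lab xi == l] c x)) =
    avg L (fun x => rho x * sqn (trig L F c x)).
  apply: decouple => // xi zeta xiF zF ne; apply: HD; rewrite DE ltNge; apply: contra ne => Hn.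
  apply/eqP/esym; apply: (label_near D0 eta0 dl0 etaD de s1 DL) => //; exact: FA.
have HE : \sum_(l <- undup (map lab F)) Err r [seq xi <- F | lab xi == l] = Err r F.
  rewrite /Err exchange_big /=; apply: eq_bigr => k _; rewrite exchange_big /=; apply: eq_bigr => i _.
  exact: sum_fibers.
have main l : l \in undup (map lab F) ->
    \sum_(xi <- [seq xi <- F | lab xi == l]) sqn (c xi) <=
    C2 * (avg L (fun x => rho x * sqn (trig L [seq xi <- F | lab xi == l] c x)) +
      Err r [seq xi <- F | lab xi == l]).
  rewrite mem_undup => /mapP[a aF ->]; set Fl := [seq _ <- _ | _].
  have uFl : uniq Fl by exact: filter_uniq.
  have X0 : 0 <= avg L (fun x => rho x * sqn (trig L Fl c x)).
    by apply: avg_ge0 => x _; rewrite mulr_ge0 // sqn_ge0.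
  (* This covers two kinds of classes: single points, and lines whose direction has squared length
     above [K]. *)
  have pt : (forall xi zeta, xi \in Fl -> zeta \in Fl -> xi != zeta -> K%:Z < dotz (xi - zeta) (xi - zeta)) ->
      \sum_(xi <- Fl) sqn (c xi) <= C2 * (avg L (fun x => rho x * sqn (trig L Fl c x)) + Err r Fl).
    move=> HF; apply: le_trans (H1 rho br rho0 _ Fl c uFl HF) _.
      by move=> x Hx; apply: rhoN; exists p.
    by apply: ler_pM => //; rewrite ?lerDl.
  have [Hp|[k kS HFl]] := label_class D0 eta0 dl0 etaD de s1 FA aF.
    apply: pt => xi zeta; rewrite !mem_filter => /andP[/eqP e1 xiF] /andP[/eqP e2 zF].
    by rewrite (Hp _ xiF e1) (Hp _ zF e2) eqxx.
  move: kS; rewrite mem_short_vectors => // /andP[ck kD].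
  have [kK|kK] := leP (dotz k k) K%:Z; last first.
    apply: pt => xi zeta; rewrite /Fl HFl !mem_filter => /andP[/eqP e1 xiF] /andP[/eqP e2 zF] ne.
    have [m Em] : exists m, xi - zeta = scalez m k.
      by apply: coprime_parallel => //; rewrite detzB e1 e2 subrr.
    apply: lt_le_trans kK _; rewrite Em.
    have -> : dotz (scalez m k) (scalez m k) = m ^+ 2 * dotz k k by rewrite /dotz /=; ring.
    rewrite ler_peMl ?dotz_ge0 // -gtz0_ge1 exprn_even_gt0 //=.
    by apply: contra ne => /eqP m0; rewrite -subr_eq0 Em m0 /scalez !mul0r.
  have kin : k \in Ks by rewrite mem_short_vectors ck.
  have [q0 _ /(_ ck)[_ _ H]] := Hq k.
  have := H rho tr rho0 rhoN (kap ^+ 2 * Lam) U F c (detz a k) ws uF.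
  rewrite -HFl -/Fl -/r => {}H; apply: le_trans H _.
  have e0 : 0 <= \sum_(i < 6) hat_err L ((q k).2 i) r Fl by apply: sumr_ge0 => i _; exact: hat_err_ge0.
  apply: ler_pM => //; first exact: addr_ge0.
    rewrite /C2 (big_rem k) //= addrCA lerDl addr_ge0 //.
    by apply: sumr_ge0 => j _; have [] := Hq j.
  rewrite lerD2l /Err (big_rem k) //= lerDl; apply: sumr_ge0 => j _.
  by apply: sumr_ge0 => i _; exact: hat_err_ge0.
rewrite -(sum_fibers lab); apply: (@le_trans _ _ (C2 * (avg L (fun x => rho x * sqn (trig L F c x)) + Err r F))).
  rewrite -HX -HE mulrDr !mulr_sumr -big_split /= [leLHS]big_seq [leRHS]big_seq.
  by apply: ler_sum => l lin; rewrite -mulrDr; exact: main.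
rewrite -mulrA ler_wpM2l //; have HBr := HB r F sr uF.
have X0 : 0 <= avg L (fun x => rho x * sqn (trig L F c x)).
  by apply: avg_ge0 => x _; rewrite mulr_ge0 // sqn_ge0.
have R0 : 0 <= avg L (sqn \o r) by apply: avg_ge0 => x _; exact: sqn_ge0.
move: X0 R0 B0 HBr; rewrite /comp; clear; move: (Err r F) (avg L (fun x => sqn (r x))) (avg L _) => e y a a0 y0 B0 H.
by have := mulr_ge0 B0 a0; lra.
Qed.

End high_frequency_estimate.

(** * Low frequencies *)

Section low_frequency.
Context {R : realType} (L : R) (L0 : 0 < L).
Local Notation kap := (kap L).
Implicit Types (x z v : R * R) (xi eta zeta : int * int) (rho h U : R * R -> R) (F : seq (int * int))
  (c : int * int -> R[i]).

Definition tball z (t : R) : set (R * R) := [set x | tdist L z x < t].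

Lemma tball_bdd z t : bdd L (\1_(tball z t) : R * R -> R).
Proof. by apply: indic_bdd; apply: open_measurable2; exact: open_tdist_lt. Qed.

Lemma tball_shift z (t : R) : 0 < t -> exists b d : R, [/\ 0 < b, 0 < d &
  forall v, `|v.1| < d -> `|v.2| < d -> forall x, tdist L (z + v) x < b -> tdist L z x < t].
Proof.
move=> t0; have zB : tball z t z by rewrite /tball /= tdist_self.
have [d d0 Hd] := open_box (@open_tdist_lt R L z t) zB.
have d2 : 0 < d / 2 by rewrite divr_gt0.
have [s s0 Hs] := gap_small L0 d2; exists (s / 4), (d / 2); split => //; first by rewrite divr_gt0.
move=> v v1 v2 x; rewrite /tdist ltr_pM2r ?invr_gt0 // => H.
have [g1 g2] := (gap_ge0 L (z + v).1 x.1, gap_ge0 L (z + v).2 x.2).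
have [|m1 h1] := Hs (z + v).1 x.1; first by lra.
have [|m2 h2] := Hs (z + v).2 x.2; first by lra.
have : tball z t (x + lattice L (m1, m2)).
  apply: Hd; rewrite /=.
    have -> : x.1 + m1%:~R * L - z.1 = (x.1 + m1%:~R * L - (z.1 + v.1)) + v.1 by ring.
    by apply: le_lt_trans (ler_normD _ _) _; rewrite [ltRHS]splitr ltrD.
  have -> : x.2 + m2%:~R * L - z.2 = (x.2 + m2%:~R * L - (z.2 + v.2)) + v.2 by ring.
  by apply: le_lt_trans (ler_normD _ _) _; rewrite [ltRHS]splitr ltrD.
by rewrite /tball /= (tdist_lattice L0) /tdist ltr_pdivrMr // mulrC.
Qed.

Lemma ee_neq1 zeta v : phase L zeta v != 0 -> `|phase L zeta v| < pi -> ee L zeta v != 1.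
Proof.
move=> p0 pp; apply/eqP => /(congr1 (@complex.Re R)) /=.
have -> : cos (phase L zeta v) = cos `|phase L zeta v|.
  by case: (ger0P (phase L zeta v)) => // _; rewrite cosN.
have : cos `|phase L zeta v| < cos 0.
  by rewrite ltr_cos ?normr_gt0 // in_itv /= ?lexx ?normr_ge0 ?(ltW pp) // (ltW (pi_gt0 R)).
by rewrite cos0 => /[swap] ->; rewrite ltxx.
Qed.

(** The shift is a multiple t of (1, M), with M above every |zeta.1|. The phase of zeta is then kap
    t (zeta.1 + M zeta.2), where the integer factor is nonzero; a small t keeps the phase below pi
    in absolute value, so that the character differs from 1. *)
Lemma separating_shift (d : R) F : 0 < d -> (forall zeta, zeta \in F -> zeta != 0) ->
  exists v, [/\ `|v.1| < d, `|v.2| < d & forall zeta, zeta \in F -> ee L zeta v != 1].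
Proof.
move=> d0 F0; pose M : int := 1 + \sum_(zeta <- F) `|zeta.1|.
pose q zeta : int := zeta.1 + M * zeta.2.
pose T : R := 1 + \sum_(zeta <- F) `|(q zeta)%:~R|.
have M1 : 1 <= M by rewrite lerDl sumr_ge0.
have T1 : 1 <= T by rewrite lerDl sumr_ge0.
have Mz zeta : zeta \in F -> `|zeta.1| < M.
  move=> zF; rewrite /M (big_rem zeta) //= addrCA ltrDl ltr_pwDl //.
  by apply: sumr_ge0.
have Tz zeta : zeta \in F -> `|(q zeta)%:~R| <= T.
  by move=> zF; rewrite /T (big_rem zeta) //= addrCA lerDl addr_ge0 // sumr_ge0.
have qz zeta : zeta \in F -> q zeta != 0.
  move=> zF; have := F0 _ zF; have := Mz _ zF; rewrite /q; case: zeta zF => a b _ /=.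
  move=> aM; apply: contra => /eqP E; have b0 : b = 0 by move: aM E M1; clear; nia.
  by move: E; rewrite b0 mulr0 addr0 => ->.
have k0 := kap_gt0 L0; have p0 := pi_gt0 R.
have M1R : 1 <= M%:~R :> R by rewrite ler1z.
pose t := Num.min (d / (2 * M%:~R)) (pi / (2 * kap * T)).
have M0 : 0 < M%:~R :> R by lra.
have T0 : 0 < T by lra.
have A0 : 0 < 2 * M%:~R :> R by rewrite mulr_gt0.
have B0 : 0 < 2 * kap * T by rewrite mulr_gt0 // mulr_gt0.
have t0 : 0 < t by rewrite lt_min; apply/andP; split; exact: divr_gt0.
have td : t * (2 * M%:~R) <= d by rewrite -ler_pdivlMr // ge_min lexx.
have tp : t * (2 * kap * T) <= pi.
  by rewrite -ler_pdivlMr // ge_min lexx orbT.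
have tM : t <= t * M%:~R by rewrite ler_peMr // ltW.
exists (t, t * M%:~R); split => /=.
- by rewrite ger0_norm ?(ltW t0) //; lra.
- by rewrite ger0_norm ?mulr_ge0 ?(ltW t0) //; lra.
move=> zeta zF.
have E : phase L zeta (t, t * M%:~R) = kap * t * (q zeta)%:~R.
  by rewrite /phase /q /= intrD intrM; ring.
have kt : 0 < kap * t by rewrite mulr_gt0.
apply: ee_neq1; rewrite E; first by rewrite mulf_neq0 ?intr_eq0 ?qz // gt_eqF.
rewrite normrM (gtr0_norm kt); apply: (@le_lt_trans _ _ (kap * t * T)).
  by rewrite ler_pM2l // Tz.
have : 0 < kap * t * T by rewrite mulr_gt0 //; lra.
by move: tp; lra.
Qed.

Lemma shift_difference xi F c v x :
  trig L (xi :: F) c (x + v) - ee L xi v * trig L (xi :: F) c x =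
  trig L F (fun eta => (ee L eta v - ee L xi v) * c eta) x.
Proof.
rewrite trig_add /trig !big_cons mulrDr opprD addrACA mulr_sumr.
rewrite -mulrA subrr add0r -sumrB; apply: eq_bigr => eta _.
by rewrite !mulrBl !mulrA.
Qed.

Lemma sqn_gt0 (w : R[i]) : (0 < sqn w) = (w != 0).
Proof.
case: w => p q; rewrite lt_def sqn_ge0 andbT /sqn /= paddr_eq0 ?sqr_ge0 // !sqrf_eq0.
by rewrite eq_complex /=.
Qed.

(** s is the mass of the removed frequency, S' that of the others, de a lower bound for the squared
    multipliers created by the shift, m the lower bound for the average of the indicator of the
    ball, and e the size of the polynomial bump outside the larger ball. The terms with e are
    absorbed. *)
Lemma low_numeric (C' de m e N S' s : R) : 0 <= C' -> 0 < de -> 0 < m -> 0 <= N -> 0 <= S' -> 0 <= s ->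
  de * S' <= C' * (4 * (N + e * (s + S')) + 2 * N) -> m * s <= 2 * N + 2 * S' ->
  8 * (1 + 2 / m) * (C' / de) * e <= 1 -> 0 <= e ->
  s + S' <= (12 * (1 + 2 / m) * (C' / de) + 4 / m) * N.
Proof.
move=> C0 d0 m0 N0 S0 s0 H1 H2 He e0.
have E1 : S' <= C' / de * (6 * N + 4 * e * (s + S')).
  rewrite mulrAC ler_pdivlMr // mulrC; apply: le_trans H1 _; rewrite ler_wpM2l //; lra.
have E2 : s <= 2 / m * N + 2 / m * S'.
  by rewrite -mulrDr mulrAC ler_pdivlMr // mulrC mulrDr.
have q0 : 0 <= 2 / m by rewrite divr_ge0 // ltW.
have r0 : 0 <= C' / de by rewrite divr_ge0 // ltW.
have -> : 4 / m = 2 * (2 / m) by rewrite mulrA; congr (_ / _); ring.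
move: E1 E2 He q0 r0 N0 S0 s0 e0; clear; move: (2 / m) (C' / de) => q r E1 E2 He q0 r0 N0 S0 s0 e0.
have K : s + S' <= q * N + (1 + q) * S' by lra.
have K2 : (1 + q) * S' <= (1 + q) * (r * (6 * N + 4 * e * (s + S'))) by rewrite ler_wpM2l //; lra.
have K3 : 8 * (1 + q) * r * e * (s + S') <= s + S' by rewrite ler_piMl // addr_ge0.
lra.
Qed.

Lemma low_frequency F z (t : R) : uniq F -> 0 < t -> exists2 C : R, 0 <= C &
  forall c, \sum_(xi <- F) sqn (c xi) <= C * avg L (fun x => \1_(tball z t) x * sqn (trig L F c x)).
Proof.
elim: F z t => [|xi F IH] z t /=.
  by move=> _ _; exists 0 => // c; rewrite big_nil mul0r.
move=> /andP[xiF uF] t0; have uX : uniq (xi :: F) by rewrite /= xiF.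
have [b [d [b0 d0 Hbd]]] := tball_shift z t0.
have [m m0 Hm] := avg_ball_gt0 L0 z t0.
(* The induction hypothesis is used on a ball of radius [a] below [b], so that after the shift by
   [v] even the ball of radius [b] stays inside the given one. *)
have a0 : 0 < Num.min (b / 2) t by rewrite lt_min divr_gt0.
have [C' C'0 HC'] := IH z _ uF a0; set a := Num.min _ _ in a0 HC'.
have ab : a < b by rewrite /a gt_min ltr_pdivrMr // ltr_pMr // ltr1n.
have at_ : a <= t by rewrite /a ge_min lexx orbT.
have [|v [v1 v2 Hv]] := @separating_shift d [seq eta - xi | eta <- F] d0.
  by move=> zeta /mapP[eta etaF ->]; rewrite subr_eq0; apply: contraNneq xiF => <-.
have Hv' eta : eta \in F -> 0 < sqn (ee L eta v - ee L xi v).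
  move=> etaF; have -> : ee L eta v - ee L xi v = ee L xi v * (ee L (eta - xi) v - 1).
    by rewrite mulrBr mulr1 -eeD [xi + _]addrC subrK.
  by rewrite sqnM sqn_ee mul1r sqn_gt0 subr_eq0; apply: Hv; exact: map_f.
have [de de0 Hde] : exists2 de : R, 0 < de & forall eta, eta \in F -> de <= sqn (ee L eta v - ee L xi v).
  elim: (F) Hv' => [|eta r IHr] H; first by exists 1.
  have [|de de0 Hde] := IHr; first by move=> ze zr; apply: H; rewrite inE zr orbT.
  exists (Num.min de (sqn (ee L eta v - ee L xi v))).
    by rewrite lt_min de0 H // mem_head.
  by move=> ze; rewrite inE ge_min => /predU1P[->|/Hde ->//]; rewrite lexx orbT.
(* The first bound makes the bump at least 1/2 on the small ball, the second one is the absorption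
   condition of [low_numeric]. *)
pose e := Num.min 2^-1 (8 * (1 + 2 / m) * (C' / de) + 1)^-1.
have q0 : 0 <= 8 * (1 + 2 / m) * (C' / de).
  by rewrite !mulr_ge0 ?addr_ge0 ?divr_ge0 ?invr_ge0 // ltW.
have q1 : 0 < 8 * (1 + 2 / m) * (C' / de) + 1 by rewrite ltr_wpDl.
have e0 : 0 < e by rewrite lt_min !invr_gt0 q1 ltr0n.
have e2 : e <= 2^-1 by rewrite ge_min lexx.
have eq1 : 8 * (1 + 2 / m) * (C' / de) * e <= 1.
  apply: (@le_trans _ _ (8 * (1 + 2 / m) * (C' / de) * (8 * (1 + 2 / m) * (C' / de) + 1)^-1)).
    by rewrite ler_wpM2l // ge_min lexx orbT.
  by rewrite ler_pdivrMr // mul1r lerDl.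
have [r [tr r01 rge rle]] := threshold_poly (rtrigp_tdist L z) (tdist01 L z) a0 ab e0.
exists (12 * (1 + 2 / m) * (C' / de) + 4 / m).
  by rewrite addr_ge0 ?divr_ge0 ?mulr_ge0 ?addr_ge0 ?divr_ge0 ?invr_ge0 // ltW.
move=> c; set X := trig L (xi :: F) c; set N := avg L _.
have bT G f : cbdd L (trig L G f) by exact: cbdd_trig.
have sT G f : csqi L (trig L G f) by exact: cbdd_csqi.
have sX : csqi L X by exact: sT.
pose X' x := X (x + v); have sX' : csqi L X'.
  have -> : X' = trig L (xi :: F) (fun eta => ee L eta v * c eta) by apply/funext => x; exact: trig_add.
  exact: sT.
have bB s : bdd L (\1_(tball z s) : R * R -> R) by exact: tball_bdd.
have N0 : 0 <= N.
  by apply: avg_ge0 => x _; rewrite mulr_ge0 ?sqn_ge0.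
have SX : avg L (sqn \o X) = sqn (c xi) + \sum_(eta <- F) sqn (c eta).
  by rewrite avg_sqn_trig // big_cons.
rewrite big_cons; apply: (@low_numeric C' de m e) => //.
- by apply: sumr_ge0 => eta _; exact: sqn_ge0.
- exact: sqn_ge0.
- rewrite mulr_sumr; apply: (@le_trans _ _ (\sum_(eta <- F) sqn ((ee L eta v - ee L xi v) * c eta))).
    rewrite [leLHS]big_seq [leRHS]big_seq; apply: ler_sum => eta /Hde h.
    by rewrite sqnM ler_wpM2r // sqn_ge0.
  apply: le_trans (HC' _) _; rewrite ler_wpM2l //.
  apply: (@le_trans _ _ (2 * avg L (fun x => \1_(tball z a) x * sqn (X' x)) +
      2 * avg L (fun x => \1_(tball z a) x * sqn (X x)))).
    have I1 := weight_intg (bB a) sX'; have I2 := weight_intg (bB a) sX.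
    rewrite -!avgZ // -avgD; [|exact: intgZ|exact: intgZ].
    apply: avg_le; [exact: weight_intg|by apply: intgD; exact: intgZ|] => x _.
    rewrite -shift_difference -/X -/(X' x) ![2 * _]mulrCA -mulrDr ler_wpM2l //.
    by apply: le_trans (sqnB_le _ _) _; rewrite sqnM sqn_ee mul1r.
  have h2 : avg L (fun x => \1_(tball z a) x * sqn (X x)) <= N.
    apply: avg_le; [exact: weight_intg|exact: weight_intg|] => x _.
    rewrite ler_wpM2r ?sqn_ge0 // !indicE; case: (boolP (x \in tball z a)) => // /[!inE] h.
    have xin : x \in tball z t by rewrite inE; exact: lt_le_trans h at_.
    by rewrite xin.
  (* [avg_shift] concerns trigonometric polynomials, so the indicator is first majorised by 2 r; the
     part of the translated bump outside the ball costs e times the total mass. *)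
  have h1 : avg L (fun x => \1_(tball z a) x * sqn (X' x)) <= 2 * (N + e * avg L (sqn \o X)).
    have tX := rtrigpM (rtrigp_shift (- v) tr) (rtrigp_sqn_trig L (xi :: F) c).
    apply: (@le_trans _ _ (2 * avg L (fun x => r x * sqn (X' x)))).
      have br := rtrigp_bdd tr; rewrite -avgZ; last exact: weight_intg.
      apply: avg_le; [exact: weight_intg|exact/intgZ/weight_intg|] => x _.
      rewrite mulrA ler_wpM2r ?sqn_ge0 // indicE; case: (boolP (x \in tball z a)) => [/[!inE] h|_].
        have := rge x (ltW h); move: e2; clear; rewrite /=; lra.
      by rewrite mulr_ge0 //; case/andP: (r01 x).
    rewrite ler_pM2l // (_ : avg L _ = avg L (fun x => r (x - v) * sqn (X x))); last first.
      rewrite -(avg_shift L0 v tX); apply: eq_avg => x _; by rewrite addrK.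
    have bs := rtrigp_bdd (rtrigp_shift (- v) tr).
    rewrite -avgZ; last exact: sqn_intg.
    rewrite -avgD; [|exact: weight_intg|exact/intgZ/sqn_intg].
    apply: avg_le; [exact: weight_intg|by apply: intgD; [exact: weight_intg|exact/intgZ/sqn_intg]|] => x _ /=.
    rewrite -mulrDl ler_wpM2r ?sqn_ge0 // indicE.
    have E : tdist L (z + v) x = tdist L z (x - v) by rewrite /tdist /gap /= !opprD !addrA !(addrAC _ (- v.1)) !(addrAC _ (- v.2)).
    have [h|h] := ltP (tdist L z (x - v)) b.
      have xin : x \in tball z t by rewrite inE; apply: (Hbd v v1 v2); rewrite E.
      rewrite xin.
      by have /andP[_] := r01 (x - v); move: e0; clear; rewrite /=; lra.
    have := rle _ h; move: e0; clear; case: (x \in _) => /=; lra.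
  rewrite -SX; move: h1 h2; clear; lra.
- have Ec : 2 * N + 2 * \sum_(eta <- F) sqn (c eta) =
      2 * N + 2 * avg L (sqn \o trig L F c) by rewrite avg_sqn_trig.
  have mB : m <= avg L (\1_(tball z t) : R * R -> R).
    apply: Hm; [exact: (bdd_intg L0)|by move=> x; case/andP: (indic01 (tball z t) x)|].
    move=> x xt; have xin : x \in tball z t by rewrite inE.
    by rewrite indicE xin.
  rewrite Ec; apply: (@le_trans _ _ (sqn (c xi) * avg L (\1_(tball z t) : R * R -> R))).
    by rewrite mulrC ler_wpM2l // sqn_ge0.
  have I1 := bdd_intg L0 (bB t); have I2 := weight_intg (bB t) sX; have I3 := sqn_intg (sT F c).
  rewrite -(avgZ _ I1) -(avgZ _ I2) -(avgZ _ I3).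
  rewrite -avgD; [|exact: intgZ|exact: intgZ].
  apply: avg_le; [exact: intgZ|by apply: intgD; exact: intgZ|] => x _ /=.
  have EX : c xi * ee L xi x = X x - trig L F c x by rewrite /X /trig big_cons addrK.
  have := sqnB_le (X x) (trig L F c x); rewrite -EX sqnM sqn_ee mulr1.
  have := sqn_ge0 (X x); have := sqn_ge0 (trig L F c x).
  move: (sqn (X x)) (sqn (trig _ _ _ _)) (sqn (c xi)) (indic01 (tball z t) x); clear.
  rewrite indicE; case: (x \in _) => /= p q s _ ? ? ?; lra.
- exact: ltW.
Qed.

End low_frequency.

(** * Eigenfunctions *)

Section real_estimate.
Context {R : realType} (L : R) (L0 : 0 < L).
Local Notation kap := (kap L).
Implicit Types (x z : R * R) (xi k : int * int) (rho h U : R * R -> R) (F : seq (int * int))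
  (c : int * int -> R[i]).

Lemma resid_weight rho U F c : bdd L rho -> (forall x, 0 <= rho x <= 1) -> sqi L U ->
  avg L (fun x => rho x * sqn (trig L F c x)) <=
  2 * avg L (fun x => rho x * U x ^+ 2) + 2 * avg L (fun x => sqn (resid L U F c x)).
Proof.
move=> br r01 sU; have sr := csqi_resid L0 F c sU; have I1 := sqn_intg sr.
have sT : csqi L (trig L F c) by apply: cbdd_csqi => //; exact: cbdd_trig.
have I2 : intg L (fun x => rho x * U x ^+ 2).
  have := weight_intg br (csqi_real L0 sU); congr intg; apply/funext => x.
  by rewrite sqn_real.
rewrite -!avgZ // -avgD; [|exact: intgZ|exact: intgZ].
apply: avg_le; [exact: weight_intg|by apply: intgD; exact: intgZ|] => x _ /=.
have /andP[h0 h1] := r01 x.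
have := sqnB_le (U x)%:C%C (resid L U F c x); rewrite /resid subKr sqn_real -/(resid L U F c x).
have := sqn_ge0 (resid L U F c x).
move: (sqn (resid L U F c x)) (sqn (trig L F c x)) => e s e0 H.
have : rho x * s <= rho x * (2 * U x ^+ 2 + 2 * e) by rewrite ler_wpM2l.
have : rho x * e <= e by rewrite ler_piMl.
by rewrite mulrDr !(mulrCA _ 2); lra.
Qed.

(** Q is the total mass of U, S the mass of the kept coefficients, [out] that of the discarded ones,
    E the residual, N the mass on G and d the density error. The term 2 C e Q is at most half of Q
    and is absorbed. *)
Lemma assemble_numeric (C T N Q S E e out d : R) : 0 <= C -> 0 <= T -> 0 <= N -> 0 <= Q -> 0 <= d ->
  Q <= 2 * S + 2 * E -> S <= C * (N + e * Q + E) -> 4 * C * e <= 1 ->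
  E <= 2 * d + 2 * out -> out <= 2 * (T * N) + 2 * d ->
  Q <= (4 * C * (1 + 4 * T) + 16 * T) * N + 24 * (C + 1) * d.
Proof.
move=> C0 T0 N0 Q0 d0 H1 H2 H3 H4 H5.
have E1 : E <= 6 * d + 4 * (T * N) by lra.
have E2 : C * E <= C * (6 * d + 4 * (T * N)) by rewrite ler_wpM2l.
have E3 : 4 * C * e * Q <= Q by rewrite ler_piMl.
lra.
Qed.

(** The predicate [A] selects the frequencies where the observability hypothesis applies; at all
    others the symbol is large and [tail_estimate] applies. Both the annulus and a bounded set of
    frequencies are used as [A]. *)
Lemma assemble O G (lam C e : R) (U chi : R * R -> R) (A : pred (int * int)) (B M : R) :
  open G -> weak_solution L O lam U -> test_function L O chi ->
  0 <= C -> 0 <= B -> 0 <= M -> 4 * C * e <= 1 ->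
  (forall x, (1 - chi x) ^+ 2 <= M * \1_G x) -> (forall x, d1 chi x ^+ 2 <= M * \1_G x) ->
  (forall x, d2 chi x ^+ 2 <= M * \1_G x) -> (forall x, Lap chi x ^+ 2 <= M * \1_G x) ->
  (forall xi, ~~ A xi -> 1 + 4 * (kap ^+ 2 * normz xi) <= B * (lam - kap ^+ 2 * normz xi) ^+ 2) ->
  (forall F c, uniq F -> {in F, forall xi, A xi} ->
     \sum_(xi <- F) sqn (c xi) <= C * (avg L (fun x => \1_G x * U x ^+ 2) + e * avg L (fun x => U x ^+ 2) +
        avg L (fun x => sqn (resid L U F c x)))) ->
  avg L (fun x => U x ^+ 2) <= (4 * C * (1 + 4 * ((24 * B + 2) * M)) + 16 * ((24 * B + 2) * M)) *
    avg L (fun x => \1_G x * U x ^+ 2).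
Proof.
move=> oG ws tc C0 B0 M0 Ce c0 c1 c2 cL HA obs; have [sU _] := ws.
have bG : bdd L (\1_G : R * R -> R) by apply: indic_bdd; exact: open_measurable2.
set T := (24 * B + 2) * M; set N := avg L (fun x => \1_G x * U x ^+ 2) in obs *; set Q := avg L (fun x => U x ^+ 2) in obs *.
have T0 : 0 <= T by rewrite mulr_ge0 // addr_ge0 // mulr_ge0.
have N0 : 0 <= N by apply: avg_ge0 => x _; rewrite mulr_ge0 ?sqr_ge0.
have Q0 : 0 <= Q by apply: avg_ge0 => x _; rewrite sqr_ge0.
have K0 : 0 < 24 * (C + 1) by rewrite mulr_gt0 // ltr_wpDl.
(* U is only approximated by trigonometric polynomials; the approximation error is scaled so that
   its final contribution is [d], which is arbitrary. *)
apply/ler_addgt0Pr => d d0; pose d' := d / (24 * (C + 1)).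
have d'0 : 0 < d' by rewrite divr_gt0.
have -> : d = 24 * (C + 1) * d' by rewrite /d' mulrCA divff ?mulr1 // gt_eqF.
have [F0 [c [uF0 HF0]]] := trig_dense L0 sU d'0.
pose F := [seq xi <- F0 | A xi]; pose F1 := [seq xi <- F0 | ~~ A xi].
have uF : uniq F by exact: filter_uniq.
have uF1 : uniq F1 by exact: filter_uniq.
have sT H f : csqi L (trig L H f) by apply: cbdd_csqi => //; exact: cbdd_trig.
have sr0 := csqi_resid L0 F0 c sU; have sr := csqi_resid L0 F c sU.
have HF0' : avg L (sqn \o resid L U F0 c) <= d' by [].
pose E := avg L (fun x => sqn (resid L U F c x)); pose out := \sum_(xi <- F1) sqn (c xi).
apply: (@assemble_numeric C T N Q (\sum_(xi <- F) sqn (c xi)) E e out) => //.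
- exact: ltW.
- rewrite -(avg_sqn_trig L0 c uF) /E /Q.
  have I1 := sqn_intg (sT F c); have I2 := sqn_intg sr; have I3 := sqn_intg (csqi_real L0 sU).
  rewrite -(avgZ _ I1) -(avgZ _ I2) -avgD; [|exact: intgZ|exact: intgZ].
  apply: avg_le; [|by apply: intgD; exact: intgZ|].
    by move: I3; congr intg; apply/funext => x; rewrite sqn_real.
  move=> x _; have := sqnD_le (trig L F c x) (resid L U F c x).
  by rewrite /resid addrC subrK sqn_real.
- apply: obs => // xi; by rewrite mem_filter => /andP[].
- have Er x : resid L U F c x = resid L U F0 c x + trig L F1 c x.
    have E0 : trig L F0 c x = trig L F c x + trig L F1 c x.
      by rewrite /trig /F /F1 !big_filter; exact: bigID.
    by rewrite /resid E0 opprD addrA subrK.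
  have I1 := sqn_intg sr0; have I2 := sqn_intg (sT F1 c).
  apply: (@le_trans _ _ (2 * avg L (fun x => sqn (resid L U F0 c x)) + 2 * avg L (fun x => sqn (trig L F1 c x)))).
    rewrite -(avgZ _ I1) -(avgZ _ I2) -avgD; [|exact: intgZ|exact: intgZ].
    apply: avg_le; [exact: sqn_intg|by apply: intgD; exact: intgZ|] => x _.
    by rewrite Er; exact: sqnD_le.
  have -> : avg L (fun x => sqn (trig L F1 c x)) = out by exact: (avg_sqn_trig L0 c uF1).
  by rewrite lerD2r ler_pM2l.
- have tail := @tail_estimate R L L0 O lam U chi (\1_G) M B F1 ws tc bG M0 B0 c0 c1 c2 cL uF1.
  have {}tail : \sum_(xi <- F1) sqn (hatM L (fun=> 1) U xi) <= T * N.
    by apply: tail => xi; rewrite mem_filter => /andP[/HA].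
  apply: (@le_trans _ _ (2 * \sum_(xi <- F1) sqn (hatM L (fun=> 1) U xi) +
     2 * \sum_(xi <- F1) sqn (hat L (resid L U F0 c) xi))); last first.
    apply: lerD; rewrite ler_pM2l //; apply: le_trans HF0'.
    exact: bessel.
  rewrite !mulr_sumr -big_split /= /out [leLHS]big_seq [leRHS]big_seq.
  apply: ler_sum => xi; rewrite mem_filter => /andP[_ xiF0].
  have sU' := csqi_real L0 sU.
  (* A coefficient of the approximant is the Fourier coefficient of U minus that of the residual, so
     the tail estimate for U applies up to the density error. *)
  have Ec : c xi = hatM L (fun=> 1) U xi - hat L (resid L U F0 c) xi.
    rewrite /resid hatB // hat_trig // xiF0 /hatM.
    have -> : hat L (fun x => 1%:C%C * (U x)%:C%C) xi = hat L (fun x => (U x)%:C%C) xi.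
      by apply: eq_hat => x _; rewrite mul1r.
    by rewrite subKr.
  by rewrite Ec; exact: sqnB_le.
Qed.

(** Off the annulus (P - Lam)^2 exceeds dl Lam >= 1. This bounds 1, Lam and P - Lam, and hence P, by
    multiples of (P - Lam)^2. *)
Lemma high_tail (Lam dl P k : R) : 0 < k -> 0 < dl -> 1 <= dl * Lam -> 0 <= P ->
  dl * Lam < (P - Lam) ^+ 2 ->
  1 + 4 * (k * P) <= (1 + 4 * k * (1 + dl^-1)) / k ^+ 2 * (k * Lam - k * P) ^+ 2.
Proof.
move=> k0 d0 s1 P0 H; set y := P - Lam in H.
have -> : (1 + 4 * k * (1 + dl^-1)) / k ^+ 2 * (k * Lam - k * P) ^+ 2 = (1 + 4 * k * (1 + dl^-1)) * y ^+ 2.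
  by rewrite /y; field; rewrite !gt_eqF.
have y1 : 1 <= y ^+ 2 by lra.
have yy : y <= y ^+ 2.
  have [y0|y0] := leP y 1; first exact: le_trans y1.
  by rewrite expr2 ler_peMl // ltW // (lt_trans ltr01).
have Ly : Lam <= dl^-1 * y ^+ 2 by rewrite mulrC ler_pdivlMr // mulrC ltW.
have PE : P <= (1 + dl^-1) * y ^+ 2 by rewrite -[leLHS](subrK Lam) mulrDl mul1r lerD.
have : 4 * k * P <= 4 * k * ((1 + dl^-1) * y ^+ 2) by rewrite ler_wpM2l // mulr_ge0 // ltW.
rewrite mulrDl mul1r !mulrA; lra.
Qed.

(** [Lam] may be negative of any size: P - Lam is at least P / 2 and at least 1. *)
Lemma low_tail (Lam P k R1 : R) : 0 < k -> 2 <= R1 -> 2 * Lam <= R1 -> R1 <= P ->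
  1 + 4 * (k * P) <= (1 + 8 * k) / k ^+ 2 * (k * Lam - k * P) ^+ 2.
Proof.
move=> k0 h1 h2 h3; set y := P - Lam.
have -> : (1 + 8 * k) / k ^+ 2 * (k * Lam - k * P) ^+ 2 = (1 + 8 * k) * y ^+ 2.
  by rewrite /y; field; rewrite !gt_eqF.
have y1 : 1 <= y by rewrite /y; lra.
have yy : y <= y ^+ 2 by rewrite expr2 ler_peMl //; lra.
have : k * P <= k * (2 * y) by rewrite ler_pM2l // /y; lra.
have : k * y <= k * y ^+ 2 by rewrite ler_pM2l.
by have y2 := le_trans y1 yy; clearbody y; lra.
Qed.

Lemma trig_extend F H c : uniq F -> uniq H -> {subset F <= H} ->
  trig L F c = trig L H (fun xi => if xi \in F then c xi else 0).
Proof.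
move=> uF uH FH; apply/funext => x; rewrite /trig.
rewrite (perm_big [seq xi <- H | xi \in F]) /=; last first.
  apply: uniq_perm => //; first exact: filter_uniq.
  move=> xi; rewrite mem_filter; case: (boolP (xi \in F)) => // /FH ->//.
rewrite big_filter big_mkcond; apply: eq_bigr => xi _; by case: ifP; rewrite ?mul0r.
Qed.

(** The constant of [low_frequency] depends on the list of frequencies; padding [c] by zeros to a
    fixed box makes it uniform in [F]. *)
Lemma low_frequency_box z (t : R) (D : nat) : 0 < t -> exists2 C : R, 0 <= C &
  forall F c, uniq F -> {in F, forall xi, dotz xi xi <= D} ->
    \sum_(xi <- F) sqn (c xi) <= C * avg L (fun x => \1_(tball L z t) x * sqn (trig L F c x)).
Proof.
move=> t0; have [C C0 HC] := low_frequency L0 z (undup_uniq (frequency_box D)) t0.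
exists C => // F c uF FD.
have FB : {subset F <= undup (frequency_box D)}.
  by move=> xi /FD H; rewrite mem_undup mem_frequency_box.
have E := trig_extend c uF (undup_uniq _) FB.
rewrite -(avg_sqn_trig L0 c uF) E avg_sqn_trig ?undup_uniq //; exact: HC.
Qed.

Lemma real_estimate O G : open O -> O !=set0 -> periodic_set L O -> open G -> periodic_set L G ->
  closure O `<=` G -> exists2 C : R, 0 < C & forall (lam : R) U, weak_solution L O lam U ->
    avg L (fun x => U x ^+ 2) <= C * avg L (fun x => \1_G x * U x ^+ 2).
Proof.
move=> oO O0 pO oG pG OG.
have [s [gc s0]] := exists_good_cover L0 oG pG pO OG O0.
have bG : bdd L (\1_G : R * R -> R) by apply: indic_bdd; exact: open_measurable2.
have [chi [M [tc M0 [c0 c1 c2 cL]]]] := tail_cutoff L0 gc.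
have [C1 C10 HC1] := high_frequency L0 oO O0 pO gc s0.
(* [resid_weight] turns C1 into 3 C1, and [assemble] requires 4 (3 C1) e <= 1. *)
pose e := (12 * C1 + 1)^-1.
have e1 : 0 < 12 * C1 + 1 by rewrite ltr_wpDl // mulr_ge0.
have e0 : 0 < e by rewrite invr_gt0.
have [rho [tr r01 rN rG]] := control_poly gc e0.
have rho0 x : 0 <= rho x by case/andP: (r01 x).
have [dl [Lam0 [dl0 Hhigh]]] := HC1 rho tr rho0 rN.
have k0 : 0 < kap ^+ 2 by rewrite exprn_gt0 // kap_gt0.
have [p ps] : exists p, p \in s by case: (s) s0 => // q r _; exists q; rewrite mem_head.
have [Hs _] := gc; have [p0 Hp] := Hs p ps.
(* When Lam < Lam0, frequencies with |xi|^2 > D satisfy the hypotheses of [low_tail]. *)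
pose D := (Num.truncn (2 * `|Lam0| + 2)).+1.
have DR : 2 * `|Lam0| + 2 <= D%:R by apply/ltW/truncnS_gt.
have [|C2 C20 Hlow] := @low_frequency_box p.1 (4 * p.2) D; first by rewrite mulr_gt0.
pose K (C B : R) := 4 * C * (1 + 4 * ((24 * B + 2) * M)) + 16 * ((24 * B + 2) * M).
have Kge0 C B : 0 <= C -> 0 <= B -> 0 <= K C B.
  by move=> ? ?; rewrite /K !addr_ge0 ?mulr_ge0 ?addr_ge0 ?mulr_ge0 ?addr_ge0 ?mulr_ge0.
pose Bh : R := (1 + 4 * kap ^+ 2 * (1 + dl^-1)) / (kap ^+ 2) ^+ 2.
pose Bl : R := (1 + 8 * kap ^+ 2) / (kap ^+ 2) ^+ 2.
have Bh0 : 0 <= Bh.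
  have i0 : 0 <= dl^-1 by rewrite invr_ge0 ltW.
  apply: divr_ge0; last exact: sqr_ge0.
  apply: addr_ge0 => //; apply: mulr_ge0; last exact: addr_ge0.
  by apply: mulr_ge0 => //; exact: sqr_ge0.
have Bl0 : 0 <= Bl.
  apply: divr_ge0; last exact: sqr_ge0.
  by apply: addr_ge0 => //; apply: mulr_ge0 => //; exact: sqr_ge0.
have Kh0 : 0 <= K (3 * C1) Bh by apply: Kge0 => //; exact: mulr_ge0.
have Kl0 : 0 <= K (2 * C2) Bl by apply: Kge0 => //; exact: mulr_ge0.
exists (1 + (K (3 * C1) Bh + K (2 * C2) Bl)); first by rewrite ltr_pwDl // addr_ge0.
move=> lam U ws; have [sU _] := ws; pose Lam := lam / kap ^+ 2.
have lamE : kap ^+ 2 * Lam = lam by rewrite /Lam mulrC divfK // gt_eqF.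
have N0 : 0 <= avg L (fun x => \1_G x * U x ^+ 2) by apply: avg_ge0 => x _; rewrite mulr_ge0 ?sqr_ge0.
have Q0 : 0 <= avg L (fun x => U x ^+ 2) by apply: avg_ge0 => x _; rewrite sqr_ge0.
have IU h : bdd L h -> intg L (fun x => h x * U x ^+ 2).
  move=> bh; have := weight_intg bh (csqi_real L0 sU); congr intg; apply/funext => x.
  by rewrite sqn_real.
have R0 F c : 0 <= avg L (fun x => sqn (resid L U F c x)).
  by apply: avg_ge0 => x _; exact: sqn_ge0.
suff [H|H] : avg L (fun x => U x ^+ 2) <= K (3 * C1) Bh * avg L (fun x => \1_G x * U x ^+ 2) \/
    avg L (fun x => U x ^+ 2) <= K (2 * C2) Bl * avg L (fun x => \1_G x * U x ^+ 2).
- by apply: le_trans H _; rewrite ler_wpM2r // addrCA lerDl addr_ge0.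
- by apply: le_trans H _; rewrite ler_wpM2r // addrA lerDr addr_ge0.
have [hi|lo] := leP Lam0 Lam; [left|right].
  have wsL : weak_solution L O (kap ^+ 2 * Lam) U by rewrite lamE.
  (* The empty list is used only to extract the bound 1 <= dl Lam. *)
  have [//|s1 _] := Hhigh Lam U [::] (fun=> 0) hi wsL erefl.
  apply: (@assemble O G lam (3 * C1) e U chi (annulus Lam dl) Bh M) => //.
  - exact: mulr_ge0.
  - rewrite mulrA -[4 * 3]natrM /e ler_pdivrMr // mul1r; lra.
  - move=> xi; rewrite /annulus -ltNge => H; rewrite -lamE; apply: high_tail => //.
    by rewrite normzE ler0z dotz_ge0.
  move=> F c uF FA; have [_ H] := Hhigh Lam U F c hi wsL uF FA; apply: le_trans H _.
  have brho := rtrigp_bdd tr.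
  have H1 := resid_weight F c brho r01 sU.
  have H2 : avg L (fun x => rho x * U x ^+ 2) <= avg L (fun x => \1_G x * U x ^+ 2) + e * avg L (fun x => U x ^+ 2).
    have I1 : intg L (fun x => U x ^+ 2).
      by have := IU _ (bdd_cst L 1); congr intg; apply/funext => x; rewrite mul1r.
    rewrite -(avgZ _ I1) -avgD; [|exact: IU|exact: intgZ].
    apply: avg_le; [exact: IU|by apply: intgD; [exact: IU|exact: intgZ]|] => x _.
    rewrite -mulrDl ler_wpM2r ?sqr_ge0 // indicE; case: (boolP (x \in G)) => [_|/negP xG].
      by have /andP[_ h] := r01 x; rewrite /=; lra.
    by rewrite add0r; apply: rG => Gx; apply: xG; rewrite inE.
  have := R0 F c; move: H1 H2 N0 Q0 C10 e0; clear.
  move: (avg L (fun x => rho x * sqn (trig L F c x))) (avg L (fun x => rho x * U x ^+ 2))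
    (avg L (fun x => \1_G x * U x ^+ 2)) (avg L (fun x => U x ^+ 2)) (avg L (fun x => sqn (resid L U F c x))).
  move=> a b n q r H1 H2 n0 q0 C0 e0 r0.
  have eq0 : 0 <= e * q by rewrite mulr_ge0 // ltW.
  by rewrite [3 * C1]mulrC -mulrA ler_wpM2l //; lra.
apply: (@assemble O G lam (2 * C2) 0 U chi (fun xi => dotz xi xi <= D) Bl M) => //.
- exact: mulr_ge0.
- by rewrite mulr0.
- move=> xi; rewrite -ltNge => H; rewrite -lamE; apply: (@low_tail _ _ _ D%:R) => //.
  + by apply: le_trans DR; rewrite lerDr mulr_ge0.
  + apply: le_trans DR; have := ler_norm Lam0; lra.
  + by rewrite normzE [D%:R]pmulrn ler_int ltW.
move=> F c uF FD; apply: le_trans (Hlow F c uF FD) _.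
have sT : csqi L (trig L F c) by apply: cbdd_csqi => //; exact: cbdd_trig.
have H1 : avg L (fun x => \1_(tball L p.1 (4 * p.2)) x * sqn (trig L F c x)) <= avg L (fun x => \1_G x * sqn (trig L F c x)).
  apply: avg_le; [apply: weight_intg => //; exact: tball_bdd|exact: weight_intg|] => x _.
  rewrite ler_wpM2r ?sqn_ge0 // !indicE; case: (boolP (x \in tball L _ _)) => // /[!inE] /Hp Gx.
  have xG : x \in G by rewrite inE.
  by rewrite xG.
have H2 := resid_weight F c bG (indic01 G) sU.
rewrite mul0r addr0 [2 * C2]mulrC -mulrA ler_wpM2l // mulrDr.
exact: le_trans H1 H2.
Qed.

End real_estimate.

(** * From the relative neighbourhood to an open set of the torus *)

Section obstacle.
Context {R : realType} (L : R) (L0 : 0 < L).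
Implicit Types (O V W G : set (R * R)).

Lemma lattice_add (k j : int * int) : lattice L (k + j) = lattice L k + lattice L j.
Proof. by rewrite /lattice /= !intrD; congr pair; rewrite /= mulrDl. Qed.

Lemma obstacle_open_periodic O : convex_obstacle L O -> [/\ open O, O !=set0 & periodic_set L O].
Proof.
move=> [[A [oA [a Aa] _ _ ->]] _]; split.
- have -> : [set x | exists k, A (x + lattice L k)] = \bigcup_k ((fun x => x + lattice L k) @^-1` A).
    by apply/seteqP; split => x; [case=> k Ak; exists k|case=> k _ Ak; exists k].
  apply: bigcup_open => k _; apply: open_comp => // x _.
  by apply: (@continuousD _ _ _ id (fun=> lattice L k) x) => //; exact: cvg_cst.
- exists a, 0; have -> // : a + lattice L 0 = a.
  by rewrite /lattice !mul0r; exact: addr0.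
- move=> k x; split=> -[j Aj].
    by exists (k + j); rewrite lattice_add addrA.
  by exists (j - k); rewrite -addrA -lattice_add [k + _]addrC subrK.
Qed.

(** V is the trace on S of an open set W, so the union of V and O equals the union of W and O. *)
Lemma neighbourhood_open O V : open O -> periodic_set L O -> rel_neighbourhood L O V ->
  [/\ open (V `|` O), periodic_set L (V `|` O), closure O `<=` V `|` O & V = (V `|` O) `&` billiard O].
Proof.
move=> oO pO [pV [W oW VW] bV]; split.
- have -> : V `|` O = W `|` O; last exact: openU.
  rewrite VW; apply/seteqP; split => x; first by move=> [[Wx _]|Ox]; [left|right].
  by have [Ox|nOx] := pselect (O x); [right|move=> [Wx|//]; left].
- by move=> k x; rewrite /setU /= (propext (pV k x)) (propext (pO k x)).
- move=> x cx; have [Ox|nOx] := pselect (O x); [by right|left].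
  by apply: bV; split => // /interior_subset.
- rewrite VW; apply/seteqP; split => x; first by move=> [Wx Sx]; split => //; left; split.
  by move=> [[[Wx _]|Ox] Sx].
Qed.

End obstacle.

(** * Real and imaginary parts of a complex eigenfunction *)

Section eigenfunctions.
Context {R : realType} (L : R) (L0 : 0 < L) (O : set (R * R)) (oO : open O).
Local Notation S := (billiard O).
Local Notation Re := (@complex.Re R).
Local Notation Im := (@complex.Im R).
Implicit Types (u f : R * R -> R[i]) (V : set (R * R)).

Lemma mass_avg u V : V `<=` S -> mass L V u =
  L ^+ 2 * avg L (fun x => \1_V x * ((Re \o u) \_ S) x ^+ 2 + \1_V x * ((Im \o u) \_ S) x ^+ 2).
Proof.
move=> VS; rewrite /mass tint_avg //; congr (_ * _); apply: eq_avg => x _.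
rewrite !patchE indicE; case: ifPn => xV; last by rewrite !mul0r addr0.
have xS : x \in S by move: xV; rewrite !inE => /VS.
rewrite xS !mul1r /=; case: (u x) => a b /=.
by rewrite sqr_sqrtr // addr_ge0 // sqr_ge0.
Qed.

Lemma laplacian_real_sqi bc (v g : R * R -> R) : laplacian_real bc L O v g ->
  sqi L (v \_ S) /\ sqi L (g \_ S).
Proof.
move=> [Lg [g1 [g2 [Dv _]]]]; have [Lv _ _ _] := form_domain_H1 Dv.
by split; apply: L2_sqi.
Qed.

(** The real operator couples the two parts a and b of u through Im lam. Its symmetry, applied to
    the pair a, b, cancels the terms with Re lam and leaves Im lam times the mass of u. *)
Lemma eigenvalue_real bc (lam : R[i]) u f : laplacian bc L O u f ->
  {ae leb2, forall x, (S `&` cell L) x -> - f x = lam * u x} ->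
  Im lam * (avg L (fun x => ((Re \o u) \_ S) x ^+ 2) + avg L (fun x => ((Im \o u) \_ S) x ^+ 2)) = 0.
Proof.
move=> [D1 D2] ae; have sym := laplacian_symmetric L0 D1 D2.
have [sa sfa] := laplacian_real_sqi D1; have [sb sfb] := laplacian_real_sqi D2.
set a := (fun x => Re (u x)) in sa sym *; set b := (fun x => Im (u x)) in sb sym *.
have A1 : {ae leb2, forall x, (S `&` cell L) x -> Re (f x) = - Re lam * a x + Im lam * b x}.
  case: ae => N [mN N0 HN]; exists N; split => // x Hx; apply: HN => /= H; apply: Hx => /H E.
  by rewrite -[f x]opprK E ReN ReM opprB mulNr addrC.
have A2 : {ae leb2, forall x, (S `&` cell L) x -> Im (f x) = - Re lam * b x + - Im lam * a x}.
  case: ae => N [mN N0 HN]; exists N; split => // x Hx; apply: HN => /= H; apply: Hx => /H E.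
  by rewrite -[f x]opprK E ImN ImM opprD !mulNr.
have comb (p q : R) v w : sqi L (v \_ S) -> sqi L (w \_ S) ->
    sqi L ((fun x => p * v x + q * w x) \_ S).
  move=> sv sw; have := sqiD (sqiM (bdd_cst L p) sv) (sqiM (bdd_cst L q) sw); congr sqi.
  by apply/funext => x; rewrite !patchE; case: ifP; rewrite ?mulr0 ?addr0.
rewrite (avg_ae_mul sfa (comb _ _ _ _ sa sb) sb A1) in sym.
rewrite (avg_ae_mul sfb (comb _ _ _ _ sb sa) sa A2) in sym.
have Iab := sqiM_intg sa sb; have [_ Iaa] := sa; have [_ Ibb] := sb.
have E1 : avg L (fun x => ((fun x => - Re lam * a x + Im lam * b x) \_ S) x * (b \_ S) x) =
    - Re lam * avg L (fun x => (a \_ S) x * (b \_ S) x) + Im lam * avg L (fun x => (b \_ S) x ^+ 2).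
  rewrite -(avgZ _ Iab) -(avgZ _ Ibb) -avgD; [|exact: intgZ|exact: intgZ].
  by apply: eq_avg => x _; rewrite !patchE; case: ifP => _; rewrite -?[point]/(0 : R); ring.
have E2 : avg L (fun x => ((fun x => - Re lam * b x + - Im lam * a x) \_ S) x * (a \_ S) x) =
    - Re lam * avg L (fun x => (a \_ S) x * (b \_ S) x) + - Im lam * avg L (fun x => (a \_ S) x ^+ 2).
  rewrite -(avgZ _ Iab) -(avgZ _ Iaa) -avgD; [|exact: intgZ|exact: intgZ].
  by apply: eq_avg => x _; rewrite !patchE; case: ifP => _; rewrite -?[point]/(0 : R); ring.
rewrite E1 E2 in sym; move/addrI: sym; rewrite mulNr => sym.
by rewrite mulrDr sym subrr || rewrite mulrDr addrC sym addNr.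
Qed.

Lemma real_part_weak bc (lam : R[i]) u f : Im lam = 0 -> laplacian bc L O u f ->
  {ae leb2, forall x, (S `&` cell L) x -> - f x = lam * u x} ->
  weak_solution L O (Re lam) ((Re \o u) \_ S) /\ weak_solution L O (Re lam) ((Im \o u) \_ S).
Proof.
move=> lam0 [D1 D2] ae.
have A1 : {ae leb2, forall x, (S `&` cell L) x -> - Re (f x) = Re lam * Re (u x)}.
  case: ae => N [mN N0 HN]; exists N; split => // x Hx; apply: HN => /= H; apply: Hx => /H E.
  by rewrite -ReN E ReM lam0 mul0r subr0.
have A2 : {ae leb2, forall x, (S `&` cell L) x -> - Im (f x) = Re lam * Im (u x)}.
  case: ae => N [mN N0 HN]; exists N; split => // x Hx; apply: HN => /= H; apply: Hx => /H E.
  by rewrite -ImN E ImM lam0 mul0r addr0.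
have [sa _] := laplacian_real_sqi D1; have [sb _] := laplacian_real_sqi D2.
split; split => // phi tp.
- exact: (eigen_weak L0 oO D1 A1 tp).
- exact: (eigen_weak L0 oO D2 A2 tp).
Qed.

End eigenfunctions.

Theorem theorem2 (R : realType) (L : R) (O V : set (R * R))
    (bc : boundary_condition) :
  0 < L ->
  convex_obstacle L O ->
  rel_neighbourhood L O V ->
  exists2 C : R, 0 < C &
    forall (lam : R[i]) (u f : R * R -> R[i]),
      laplacian bc L O u f ->
      {ae leb2, forall x, (billiard O `&` cell L) x -> - f x = lam * u x} ->
      C^-1 * mass L (billiard O) u <= mass L V u.
Proof.
move=> L0 Ob nV; have [oO O0 pO] := obstacle_open_periodic Ob.
have [oG pG OG VG] := neighbourhood_open oO pO nV; set G := V `|` O in oG pG OG VG.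
have [C C0 HC] := real_estimate L0 oO O0 pO oG pG OG.
exists C => // lam u f Lu ae; have [D1 D2] := Lu.
have VS : V `<=` billiard O by rewrite VG; exact: subIsetr.
have [sa _] := laplacian_real_sqi oO D1; have [sb _] := laplacian_real_sqi oO D2.
pose a : R * R -> R := (@complex.Re R \o u) \_ (billiard O); pose b : R * R -> R := (@complex.Im R \o u) \_ (billiard O).
rewrite (mass_avg L0 u VS) (mass_avg L0 u (@subset_refl _ (billiard O))) -/a -/b.
have L20 : 0 < L ^+ 2 by rewrite exprn_gt0.
have bG : bdd L (\1_G : R * R -> R) by apply: indic_bdd; exact: open_measurable2.
have IG (h : R * R -> R) : sqi L h -> intg L (fun x => \1_G x * h x ^+ 2).
  move=> sh; have := weight_intg bG (csqi_real L0 sh); congr intg; apply/funext => x.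
  by rewrite sqn_real.
have [_ Ia] := sa; have [_ Ib] := sb.
have EV : avg L (fun x => \1_V x * a x ^+ 2 + \1_V x * b x ^+ 2) =
    avg L (fun x => \1_G x * a x ^+ 2) + avg L (fun x => \1_G x * b x ^+ 2).
  rewrite -avgD; [|exact: IG|exact: IG]; apply: eq_avg => x _; rewrite /a /b !patchE !indicE.
  case: (boolP (x \in billiard O)) => xS; last by rewrite !expr0n /= !mulr0.
  have -> // : (x \in V) = (x \in G).
  rewrite VG; apply/idP/idP; rewrite !inE; first by case.
  by move=> Gx; split => //; move: xS; rewrite inE.
have ES : avg L (fun x => \1_(billiard O) x * a x ^+ 2 + \1_(billiard O) x * b x ^+ 2) =
    avg L (fun x => a x ^+ 2) + avg L (fun x => b x ^+ 2).
  rewrite -avgD //; apply: eq_avg => x _; rewrite /a /b !patchE !indicE.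
  by case: ifP => _; rewrite ?mul1r // !expr0n /= !mulr0.
rewrite EV ES mulrCA ler_pM2l // ler_pdivrMl //.
have N0 : 0 <= avg L (fun x => \1_G x * a x ^+ 2) + avg L (fun x => \1_G x * b x ^+ 2).
  by apply: addr_ge0; apply: avg_ge0 => x _; rewrite mulr_ge0 ?sqr_ge0.
(* If [lam] is not real, the mass of [u] is 0 and the inequality is trivial; otherwise both parts
   are real weak solutions for the same eigenvalue. *)
have /eqP := eigenvalue_real L0 oO Lu ae; rewrite mulf_eq0 => /orP[/eqP lam0|/eqP E]; last first.
  by rewrite E mulr_ge0 // ltW.
have [wa wb] := real_part_weak L0 oO lam0 Lu ae.
by rewrite mulrDr; apply: lerD; [exact: HC wa|exact: HC wb].
Qed.
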